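(* Let $n\in\mathbb{N}$ and let $f\in C_b^{(n)}\big(\mathcal{P}_2(\mathbb{R}^e);\mathbb{R}^d\big)$. Then for any $\mu,\nu\in\mathcal{P}_{n+1}(\mathbb{R}^e)$ with joint distribution $\Pi^{\mu,\nu}$, $$f(\nu)=\sum_{a\in A^n}\frac{1}{|a|!}\,\mathbf{D}^af(\mu)[\Pi^{\mu,\nu}]+R_n^{\Pi^{\mu,\nu}}(f),$$ where $$R_n^{\Pi^{\mu,\nu}}(f)=\frac{1}{(n-1)!}\sum_{a\in A_n}\int_{(\mathbb{R}^e)^{\oplus2}}\!\!\cdots\int_{(\mathbb{R}^e)^{\oplus2}}f^a[\Pi^{\mu,\nu}]\cdot\bigotimes_{i=1}^{|a|}(y_{a_i}-x_{a_i})\;d\Pi^{\mu,\nu}(x_1,y_1)\cdots d\Pi^{\mu,\nu}(x_{m[a]},y_{m[a]})$$ and $$f^a[\Pi^{\mu,\nu}]=\int_0^1\Big(\partial_af\big(\Pi_\xi^{\mu,\nu},x_1+\xi(y_1-x_1),\dots,x_{m[a]}+\xi(y_{m[a]}-x_{m[a]})\big)-\partial_af\big(\mu,x_1,\dots,x_{m[a]}\big)\Big)(1-\xi)^{|a|-1}d\xi.$$ Further, $$\big|R_n^{\Pi^{\mu,\nu}}(f)\big|\le C\int_{(\mathbb{R}^e)^{\oplus2}}|y-x|^{n+1}\,d\Pi^{\mu,\nu}(x,y)$$ for a constant $C$ depending only on the bounds for $f$ and its derivatives (including the Lipschitz bounds).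
   Context: **Measures.** $\mathcal{P}_q(\mathbb{R}^e)$ is the set of Borel probability measures on $\mathbb{R}^e$ with finite $q$-th moment; $\mathbb{W}^{(1)}$ is the 1-Wasserstein distance. A joint distribution $\Pi^{\mu,\nu}$ of $\mu,\nu$ is any probability measure on $(\mathbb{R}^e)^{\oplus2}$ with marginals $\mu$ (coordinate $x$) and $\nu$ (coordinate $y$); no optimality is required. For $\xi\in[0,1]$, $\Pi_\xi^{\mu,\nu}$ is the push-forward of $\Pi^{\mu,\nu}$ under $(x,y)\mapsto x+\xi(y-x)$. **Lions derivative.** On an atomless probability space $(\Omega,\mathcal F,\mathbb P)$, a function $g$ on $\mathcal{P}_2(\mathbb{R}^e)$ with values in a finite-dimensional space $V$ is Lions-differentiable at $\mu$ if its lift $G(X)=g(\mathbb{P}\circ X^{-1})$, $X\in L^2(\Omega,\mathbb{P};\mathbb{R}^e)$, is Fréchet differentiable at some $X$ with law $\mu$; the derivative is $\partial_\mu g(\mu,\cdot):\mathbb{R}^e\to\mathrm{Lin}(\mathbb{R}^e,V)$ with $DG(X)[h]=\mathbb{E}[\partial_\mu g(\mu,X)\cdot h]$. **Partition sequences.** $A_n$ is the set of sequences $(a_i)_{i=1}^n$ of positive integers with $a_1=1$ and $a_k\le1+\max_{l<k}a_l$ for $k\ge2$; $A_0=\{\emptyset\}$; $A^n=\bigcup_{i=0}^nA_i$. For $a\in A_n$: $|a|=n$, $m[a]=\max_ia_i$ ($m[\emptyset]=0$). **Iterated derivatives.** $\partial_\emptyset f=f$, $\partial_{(1)}=\partial_\mu$;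 $\partial_{(a_1,\dots,a_k)}=\nabla_{x_{a_k}}\partial_{(a_1,\dots,a_{k-1})}$ if $a_k\le\max\{a_1,\dots,a_{k-1}\}$, and $\partial_{(a_1,\dots,a_k)}=\partial_\mu\partial_{(a_1,\dots,a_{k-1})}$ (producing the new free variable $x_{a_k}$) otherwise. The $i$-th tensor slot corresponds to the $i$-th derivative taken. **The class** $C_b^{(n)}(\mathcal{P}_2(\mathbb{R}^e);\mathbb{R}^d)$ consists of $f:\mathcal{P}_2(\mathbb{R}^e)\to\mathbb{R}^d$ for which there are functions $\partial_af:\mathcal{P}_2(\mathbb{R}^e)\times(\mathbb{R}^e)^{m[a]}\to\mathrm{Lin}((\mathbb{R}^e)^{\otimes|a|},\mathbb{R}^d)$, $a\in A^n$, obtained from $f$ by the recursion $\partial_\emptyset f=f$, $\partial_{(1)}f=\partial_\mu f$, $\partial_{(a_1,\dots,a_k)}f=\nabla_{x_{a_k}}\partial_{(a_1,\dots,a_{k-1})}f$ if $a_k\le\max\{a_1,\dots,a_{k-1}\}$ and $\partial_{(a_1,\dots,a_k)}f=\partial_\mu\partial_{(a_1,\dots,a_{k-1})}f$ otherwise (so for $1\le|a|\le n-1$, $\partial_af$ is differentiable in $x_1,\dots,x_{m[a]}$ and in $\mu$, with $\nabla_{x_j}\partial_af=\partial_{(a_1,\dots,a_k,j)}f$ and $\partial_\mu\partial_af=\partial_{(a_1,\dots,a_k,m[a]+1)}f$), such that for each $a$ with $1\le|a|\le n$ the function $\partial_af$ is bounded and Lipschitz continuous, $\mathcal{P}_2(\mathbb{R}^e)$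 being equipped with $\mathbb{W}^{(1)}$. **Differential operators.** $\mathbf{D}^\emptyset f(\mu)[\Pi^{\mu,\nu}]=f(\mu)$ and, for $a\neq\emptyset$, $$\mathbf{D}^af(\mu)[\Pi^{\mu,\nu}]=\int_{(\mathbb{R}^e)^{\oplus2}}\!\!\cdots\int_{(\mathbb{R}^e)^{\oplus2}}\partial_af(\mu,x_1,\dots,x_{m[a]})\cdot\bigotimes_{i=1}^{|a|}(y_{a_i}-x_{a_i})\;d\Pi^{\mu,\nu}(x_1,y_1)\cdots d\Pi^{\mu,\nu}(x_{m[a]},y_{m[a]}).$$ *)

(* Defs.v *)
From HB Require Import structures.
From mathcomp Require Import all_boot all_order all_algebra.
From mathcomp Require Import all_classical all_reals all_analysis.
From mathcomp Require Import measurable_realfun giry.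

Set Implicit Arguments.
Unset Strict Implicit.
Unset Printing Implicit Defensive.

Import Order.TTheory GRing.Theory Num.Def Num.Theory.
Import numFieldNormedType.Exports.

Local Open Scope classical_set_scope.
Local Open Scope ring_scope.

(** * Matrices as measurable spaces

  [R^e] is ['rV[R]_e]. MathComp-Analysis norms matrices by the sup norm;
  [enorm] is the Euclidean (Hilbert-Schmidt) norm, for which
  [enorm (v1 (x) ... (x) vk)] is the product of the [enorm vi]. *)

Definition enorm {R : realType} {p q : nat} (A : 'M[R]_(p, q)) : R :=
  Num.sqrt (\sum_i \sum_j A i j ^+ 2).

HB.instance Definition _ (R : realType) (p q : nat) :=
  @isMeasurable.Build (sigma_display (@open 'M[R]_(p, q))) 'M[R]_(p, q)
    <<s @open 'M[R]_(p, q) >>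
    (@sigma_algebra0 _ setT _) (@sigma_algebraC _ _)
    (@sigma_algebra_bigcup _ setT _).

Section measurable_matrix.
Context {R : realType} {p q : nat}.

Lemma measurable_entry (i : 'I_p) (j : 'I_q) :
  measurable_fun [set: 'M[R]_(p, q)] (fun A => A i j).
Proof.
apply: (measurability _ (RGenOpens.measurableE R)).
move=> _ [_ [a [b ->] <-]]; rewrite setTI; apply: sub_sigma_algebra.
have /continuousP := @coord_continuous R p q i j; apply.
exact: interval_open.
Qed.

(** Since [R^e] is second countable, its Borel sets are generated by the
  coordinates. *)
Lemma measurable_fun_mxP disp (T : measurableType disp) (f : T -> 'M[R]_(p, q)) :
  measurable_fun setT f <->
  forall i j, measurable_fun setT (fun w => f w i j).
Proof.
split=> [mf i j|mf].
  exact: (measurableT_comp (measurable_entry i j) mf).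
apply: (@measurability _ _ _ _ _ _ (@open 'M[R]_(p, q))) => //.
move=> _ [U oU <-]; rewrite setTI.
pose Q (A : 'M[rat]_(p, q)) : 'M[R]_(p, q) := \matrix_(i, j) ratr (A i j).
pose V (s : 'M[rat]_(p, q) * nat) : set 'M[R]_(p, q) :=
  [set B | forall i j, ball (Q s.1 i j) s.2.+1%:R^-1 (B i j)].
pose W (s : 'M[rat]_(p, q) * nat) : set T :=
  if `[< V s `<=` U >] then f @^-1` (V s) else set0.
suff -> : f @^-1` U = \bigcup_s W s.
  apply: countable_bigcupT_measurable; first exact: countableP.
  move=> s; rewrite /W; case: asboolP => // _.
  have -> : f @^-1` V s =
      \bigcap_(i in [set: 'I_p]) \bigcap_(j in [set: 'I_q])
        (fun w => f w i j) @^-1` ball (Q s.1 i j) s.2.+1%:R^-1.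
    apply/seteqP; split=> w /=.
      by move=> h i _ j _; exact: h.
    by move=> h i j; exact: h.
  apply: fin_bigcap_measurable => // i _.
  apply: fin_bigcap_measurable => // j _.
  rewrite -[X in measurable X]setTI; apply: mf => //.
  by apply: open_measurable; exact: ball_open.
apply/seteqP; split=> w /=; last first.
  by move=> [s _]; rewrite /W; case: asboolP => // sU; exact: sU.
move=> Uw.
have /nbhs_ballP[r /= r0 rU] : nbhs (f w) U by exact: open_nbhs_nbhs.
have [k rk] : exists k, 0 + k.+1%:R^-1 < r / 2.
  by apply: ltr_add_invr; rewrite divr_gt0.
rewrite add0r in rk.
have k0 : 0 < k.+1%:R^-1 :> R by rewrite invr_gt0.
have ex i j : exists x : rat, `|ratr x - f w i j| < k.+1%:R^-1.
  have lt_itv : f w i j - k.+1%:R^-1 < f w i j + k.+1%:R^-1.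
    by rewrite (@lt_trans _ _ (f w i j)) ?gtrBl ?ltrDl.
  have [x] := rat_in_itvoo lt_itv.
  by rewrite in_itv /= -ltr_distl => ?; exists x.
pose A : 'M[rat]_(p, q) := \matrix_(i, j) sval (cid (ex i j)).
have QA i j : `|Q A i j - f w i j| < k.+1%:R^-1.
  by rewrite !mxE; case: cid.
exists (A, k) => //; rewrite /W; case: asboolP => [_|].
  by move=> i j /=; exact: QA.
case=> B /= VB; apply: rU; split => // i j.
rewrite (splitr r); apply: (@ball_triangle _ _ (Q A i j)).
  by rewrite -ball_normE /= distrC; apply: lt_trans rk; exact: QA.
by apply: le_ball (VB i j); exact: ltW.
Qed.

Context disp {T : measurableType disp}.

Lemma measurable_addmx (X Y : T -> 'M[R]_(p, q)) :
  measurable_fun setT X -> measurable_fun setT Y ->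
  measurable_fun setT (fun w => X w + Y w).
Proof.
move=> /measurable_fun_mxP mX /measurable_fun_mxP mY.
apply/measurable_fun_mxP => i j; under eq_fun do rewrite mxE.
exact: measurable_funD.
Qed.

Lemma measurable_scalemx (c : R) (X : T -> 'M[R]_(p, q)) :
  measurable_fun setT X -> measurable_fun setT (fun w => c *: X w).
Proof.
move=> /measurable_fun_mxP mX.
apply/measurable_fun_mxP => i j; under eq_fun do rewrite mxE.
exact: measurable_funM.
Qed.

End measurable_matrix.

(** The entrywise Lebesgue integral. *)
Definition mint {disp} {T : measurableType disp} {R : realType} {p q : nat}
    (mu : {measure set T -> \bar R}) (D : set T) (F : T -> 'M[R]_(p, q)) :
    'M[R]_(p, q) :=
  \matrix_(i, j) \int[mu]_(w in D) F w i j.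

(** * Tensors

  A tensor in [(R^e)^{(x) k}] is a row vector of length [tdim e k = e ^ k], and
  a linear map [(R^e)^{(x) k} -> R^d] is a matrix acting on it from the right.
  With this recursion [Lin((R^e)^{(x) k.+1}, R^d)] is, by computation,
  ['M_(tdim e k * e, d)], that is [Lin(R^e, Lin((R^e)^{(x) k}, R^d))]. *)

Fixpoint tdim (e k : nat) : nat := if k is k'.+1 then (tdim e k' * e)%N else 1.

Definition tens1 {R : realType} {p e : nat} (t : 'rV[R]_p) (v : 'rV[R]_e) :
    'rV[R]_(p * e) :=
  mxvec (t^T *m v).

Fixpoint tens {R : realType} {e : nat} (v : nat -> 'rV[R]_e) (k : nat) :
    'rV[R]_(tdim e k) :=
  if k is k'.+1 then tens1 (tens v k') (v k') else const_mx 1.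

(** [contr A v] sends [t] to [A (t (x) v)]. *)
Definition contr {R : realType} {p e d : nat} (A : 'M[R]_(p * e, d))
    (v : 'rV[R]_e) : 'M[R]_(p, d) :=
  \matrix_(i < p) (tens1 (delta_mx 0 i) v *m A).

(** * Partition sequences *)

Definition maxseq (a : seq nat) : nat := (\max_(i <- a) i)%N.

(** [nth 0 a k] is $a_{k+1}$. *)
Definition pseq (a : seq nat) : bool :=
  [&& all (leq 1) a, (nth 1 a 0 == 1)%N &
      [forall k : 'I_(size a),
        (0 < k)%N ==> (nth 0 a k <= 1 + \max_(l < k) nth 0 a l)%N]].

Lemma pseq_le (a : seq nat) : pseq a -> all (fun i => i <= size a)%N a.
Proof.
move=> /and3P[_ a0 /forallP h].
suff H k : (k < size a)%N -> (nth 0 a k <= k.+1)%N.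
  apply/(all_nthP 0) => k ka; exact: leq_trans (H k ka) ka.
elim/ltn_ind: k => k IH ka.
case: (posnP k) => [k0|k0].
  by move: ka; rewrite k0; case: a a0 {h IH} => //= x a /eqP ->.
apply: leq_trans (implyP (h (Ordinal ka)) k0) _.
rewrite add1n ltnS; apply/bigmax_leqP => l _.
by apply: leq_trans (IH l (ltn_ord l) (ltn_trans (ltn_ord l) ka)) _.
Qed.

(** The enumeration of $A_k$; by [pseq_le] its entries are at most [k]. *)
Definition pseqs (k : nat) : seq (k.-tuple nat) :=
  [seq b : k.-tuple nat <- [seq map_tuple (@nat_of_ord k.+1) a | a : k.-tuple 'I_k.+1]
  | pseq b].

Lemma mem_pseqs k (a : k.-tuple nat) : (a \in pseqs k) = pseq a.
Proof.
rewrite mem_filter andb_idr// => ha.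
apply/mapP; exists (map_tuple (@inord k) a); first by rewrite mem_enum.
apply/val_inj => /=; rewrite -map_comp -[LHS]map_id.
apply/eq_in_map => i ia /=; rewrite inordK // ltnS.
by have /allP/(_ _ ia) := pseq_le ha; rewrite size_tuple.
Qed.

Lemma pseqs_uniq k : uniq (pseqs k).
Proof.
rewrite filter_uniq// map_inj_uniq ?enum_uniq// => a b /(congr1 val) /= E.
by apply/val_inj; apply: inj_map E; exact: ord_inj.
Qed.

(** * Measures on [R^e]

  The types [probability _ R] compare values on all sets, measurable or not:
  equality of Borel measures is [measure_eq], written [≡μ]. Functions on
  $\mathcal{P}_2(\mathbb{R}^e)$ are functions on [probability 'rV[R]_e R] whose
  values outside of $\mathcal{P}_2(\mathbb{R}^e)$ are irrelevant. *)

Section measures.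
Context {R : realType} {e : nat}.
Local Notation E := 'rV[R]_e.

Definition finite_moment (q : nat) (mu : probability E R) : Prop :=
  (\int[mu]_x (enorm x ^+ q)%:E < +oo)%E.

Definition joint (Pi : probability (E * E)%type R) (mu nu : probability E R) :
    Prop :=
  forall A : set E, measurable A ->
    Pi (A `*` setT) = mu A /\ Pi (setT `*` A) = nu A.

Definition W1 (mu nu : probability E R) : \bar R :=
  ereal_inf [set (\int[Pi]_z (enorm (z.2 - z.1))%:E)%E
            | Pi in [set Pi : probability (E * E)%type R | joint Pi mu nu]].

Definition interp (xi : R) (z : E * E) : E := z.1 + xi *: (z.2 - z.1).

Lemma measurable_interp xi : measurable_fun setT (interp xi).
Proof.
apply: measurable_addmx; first exact: measurable_fst.
apply: measurable_scalemx.
under eq_fun do rewrite -scaleN1r.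
apply: measurable_addmx; first exact: measurable_snd.
by apply: measurable_scalemx; exact: measurable_fst.
Qed.

HB.instance Definition _ xi := isMeasurableFun.Build _ _ _ _ (interp xi)
  (measurable_interp xi).

Definition joint_interp (Pi : probability (E * E)%type R) (xi : R) :
    probability E R :=
  distribution Pi (interp xi).

End measures.

(** * The Lions derivative *)

Definition atomless {disp} {T : measurableType disp} {R : realType}
    (P : probability T R) : Prop :=
  forall A, measurable A -> (0 < P A)%E ->
    exists B, [/\ measurable B, B `<=` A, (0 < P B)%E & (P B < P A)%E].

Section lions.
Context {disp} {T : measurableType disp} {R : realType} (P : probability T R).
Context {e : nat}.
Local Notation RV := {mfun T >-> 'rV[R]_e}.

Definition addRV (X Y : RV) (w : T) : 'rV[R]_e := X w + Y w.
Definition scaleRV (c : R) (X : RV) (w : T) : 'rV[R]_e := c *: X w.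

HB.instance Definition _ (X Y : RV) := isMeasurableFun.Build _ _ _ _ (addRV X Y)
  (measurable_addmx (measurable_funPT X) (measurable_funPT Y)).
HB.instance Definition _ c (X : RV) := isMeasurableFun.Build _ _ _ _
  (scaleRV c X) (measurable_scalemx c (measurable_funPT X)).

Definition L2norm (X : RV) : \bar R := ('N[P]_2%:E[EFin \o (enorm \o X)])%E.
Definition L2 (X : RV) : Prop := (L2norm X < +oo)%E.

(** [DG] is the Fréchet derivative at [X] of [G], as a function on
  $L^2(\Omega, \mathbb{P}; \mathbb{R}^e)$. *)
Definition frechet_derivative {p d : nat} (G : RV -> 'M[R]_(p, d)) (X : RV)
    (DG : RV -> 'M[R]_(p, d)) : Prop :=
  [/\ forall c h h', L2 h -> L2 h' ->
        DG (addRV (scaleRV c h) h') = c *: DG h + DG h',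
      exists K, forall h, L2 h -> enorm (DG h) <= K * fine (L2norm h) &
      forall eps, 0 < eps -> exists2 delta, 0 < delta &
        forall h, L2 h -> fine (L2norm h) <= delta ->
          enorm (G (addRV X h) - G X - DG h) <= eps * fine (L2norm h)].

(** [D] is a version of $\partial_\mu g(\mu, \cdot)$. *)
Definition lions_derivative {p d : nat}
    (g : probability 'rV[R]_e R -> 'M[R]_(p, d)) (mu : probability 'rV[R]_e R)
    (D : 'rV[R]_e -> 'M[R]_(p * e, d)) : Prop :=
  measurable_fun setT D /\
  exists X : RV,
    [/\ L2 X, distribution P X ≡μ mu,
        forall h : RV, L2 h -> forall i j,
          P.-integrable setT (fun w => (contr (D (X w)) (h w) i j)%:E) &
        frechet_derivative (fun Y => g (distribution P Y)) X
          (fun h => mint P setT (fun w => contr (D (X w)) (h w)))].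

End lions.

(** * The class $C_b^{(n)}$ *)

(** For [a] in $A_k$ with $m[a] = m$, [df k m a] is $\partial_a f$; the values
  for other [m] are irrelevant. The slots of [x] are numbered from 0, so the
  letter of slot [i] is [i.+1]. *)
Definition derivs (R : realType) (e d : nat) :=
  forall k m : nat, k.-tuple nat -> probability 'rV[R]_e R ->
    m.-tuple 'rV[R]_e -> 'M[R]_(tdim e k, d).

Definition set_slot {T : Type} {m : nat} (x : m.-tuple T) (i : 'I_m) (v : T) :
    m.-tuple T :=
  [tuple if l == i then v else tnth x l | l < m].

Section class.
Context {disp} {T : measurableType disp} {R : realType} (P : probability T R).
Context {e d : nat}.

Definition iterated_derivatives (n : nat)
    (f : probability 'rV[R]_e R -> 'rV[R]_d) (df : derivs R e d) : Prop :=
  [/\ forall mu nu : probability 'rV[R]_e R, finite_moment 2 mu ->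
        mu ≡μ nu -> f mu = f nu,
      forall mu, finite_moment 2 mu -> df 0 0 [tuple] mu [tuple] = f mu,
      forall k m (a : k.-tuple nat) mu (x : m.-tuple 'rV[R]_e) (i : 'I_m),
        (k < n)%N -> pseq a -> maxseq a = m -> finite_moment 2 mu ->
        is_diff (tnth x i) (fun v => df k m a mu (set_slot x i v))
          (contr (df k.+1 m (rcons_tuple a i.+1) mu x)) &
      forall k m (a : k.-tuple nat) mu (x : m.-tuple 'rV[R]_e),
        (k < n)%N -> pseq a -> maxseq a = m -> finite_moment 2 mu ->
        lions_derivative P (fun nu => df k m a nu x) mu
          (fun v => df k.+1 m.+1 (rcons_tuple a m.+1) mu (rcons_tuple x v))].

(** [f] is in $C_b^{(n)}$ with derivatives [df], [B a] and [L a] being a bound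
  and a Lipschitz constant of $\partial_a f$. *)
Definition Cb (n : nat) (B L : seq nat -> R)
    (f : probability 'rV[R]_e R -> 'rV[R]_d) (df : derivs R e d) : Prop :=
  iterated_derivatives n f df /\
  forall k m (a : k.-tuple nat),
    (0 < k <= n)%N -> pseq a -> maxseq a = m ->
    (forall mu (x : m.-tuple 'rV[R]_e), finite_moment 2 mu ->
      enorm (df k m a mu x) <= B a) /\
    (forall mu nu (x y : m.-tuple 'rV[R]_e),
      finite_moment 2 mu -> finite_moment 2 nu ->
      ((enorm (df k m a mu x - df k m a nu y))%:E <=
       (L a)%:E * (W1 mu nu + (\sum_(i < m) enorm (tnth x i - tnth y i))%:E))%E).

End class.

(** * Differential operators and the remainder *)

Section expansion.
Context {R : realType} {e d : nat}.
Local Notation E := 'rV[R]_e.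

(** The integral over $(x_m, y_m)$ is the outermost one. *)
Fixpoint iint (Pi : probability (E * E)%type R) {p q : nat} (m : nat) :
    (m.-tuple (E * E) -> 'M[R]_(p, q)) -> 'M[R]_(p, q) :=
  match m with
  | 0 => fun F => F [tuple]
  | m'.+1 => fun F =>
      mint Pi setT (fun z => iint Pi (fun zs : m'.-tuple (E * E) =>
        F (rcons_tuple zs z)))
  end.

(** $\bigotimes_{i=1}^{k} (y_{a_i} - x_{a_i})$, where [nth 0 z j] is
  $(x_{j+1}, y_{j+1})$. *)
Definition increments {k m : nat} (a : k.-tuple nat) (z : m.-tuple (E * E)) :
    'rV[R]_(tdim e k) :=
  tens (fun i => let xy := nth 0 z (nth 0%N a i).-1 in xy.2 - xy.1) k.

Definition Dop (df : derivs R e d) {k : nat} (a : k.-tuple nat)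
    (mu : probability E R) (Pi : probability (E * E)%type R) : 'rV[R]_d :=
  iint Pi (fun z : (maxseq a).-tuple (E * E) =>
    increments a z *m df k (maxseq a) a mu (map_tuple fst z)).

Definition remainder_kernel (df : derivs R e d) {k : nat} (a : k.-tuple nat)
    (mu : probability E R) (Pi : probability (E * E)%type R)
    (z : (maxseq a).-tuple (E * E)) : 'M[R]_(tdim e k, d) :=
  mint lebesgue_measure `[0, 1]%classic (fun xi : R =>
    (1 - xi) ^+ k.-1 *:
      (df k (maxseq a) a (joint_interp Pi xi) (map_tuple (interp xi) z) -
       df k (maxseq a) a mu (map_tuple fst z))).

Definition remainder (n : nat) (df : derivs R e d) (mu : probability E R)
    (Pi : probability (E * E)%type R) : 'rV[R]_d :=
  (n.-1`!%:R)^-1 *: \sum_(a <- pseqs n)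
    iint Pi (fun z : (maxseq a).-tuple (E * E) =>
      increments a z *m remainder_kernel df mu Pi z).

End expansion.

(* Main.v *)
(** Along the path [xi |-> Pi_xi] the function [f] is differentiated repeatedly.
  The terms of order [k] integrate
  [d_a f (Pi_xi, x + xi (y - x)) . (x)_i (y_(a_i) - x_(a_i))], [a] in [A_k]; their
  derivative in [xi] produces one term for each way of appending a letter to
  [a]: the old letters come from the space variables, the new one from the
  measure. Applying Taylor's formula with integral remainder to [f (Pi_xi)]
  between 0 and 1, and Fubini's theorem to the remainder, gives the expansion.
  The remainder is bounded with the Lipschitz constants of the derivatives of
  order [n], [W1 (Pi_xi) mu <= xi * int |y - x| dPi] and Jensen's inequality.

  The chain rule in the measure needs care, because the lift of [f] is Fréchet
  differentiable at one random variable [X] of law [Pi_xi] only, and there need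
  be no [Z] on the same space such that [(X, Z)] has the law of
  [(x + xi (y - x), y - x)]. As the space is atomless, there is such a [Z] after
  both sides have been rounded to countably many values; letting the scale of
  the rounding depend on the increment of [xi] makes the error negligible. *)

Require Import Defs.
From HB Require Import structures.
From mathcomp Require Import all_boot all_order all_algebra.
From mathcomp Require Import all_classical all_reals all_analysis.
From mathcomp Require Import measurable_realfun giry ring lra.

Set Implicit Arguments.
Unset Strict Implicit.
Unset Printing Implicit Defensive.

Import Order.TTheory GRing.Theory Num.Def Num.Theory.
Import numFieldNormedType.Exports.

Local Open Scope classical_set_scope.
Local Open Scope ring_scope.

(** * The Euclidean norm of tensors *)

Section enorm_theory.
Context {R : realType}.

(** Differentiation under the integral sign rests on a quantitative expansion: the increment of the
    integrand between times r and r + t is linear in t up to t ^ 2 times a polynomial in the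
    distances |y_i - x_i|, and such an error can be integrated. To obtain it, the measure and every
    space variable receive a time of their own; each partial derivative is Lipschitz in all these
    times, which controls the increment on the diagonal. For a sequence of length k the error has
    degree k + 2, at most n + 1 as long as k < n: this is what the moments of order n + 1 pay for.
    At order n only Lipschitz continuity is left. It gives the kernel of the remainder one factor
    beyond the n increments, hence again degree n + 1.

    Order 0 stands apart, since the class neither bounds [f] nor makes it Lipschitz; there the chain
    rule uses continuity at a single law, extracted from the Lions derivative itself.

    The constant is fixed before the dimensions. Hence the estimates that enter it use the Euclidean
    norm, which is multiplicative on tensors, and never pass through single entries. *)

Lemma CauchySchwarz_sum (I : finType) (a b : I -> R) :
  (\sum_i a i * b i) ^+ 2 <= (\sum_i a i ^+ 2) * (\sum_i b i ^+ 2).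
Proof.
(* Lagrange's identity: this sum is twice the difference of the two sides. *)
have : 0 <= \sum_i \sum_j (a i * b j - a j * b i) ^+ 2.
  by do 2!apply: sumr_ge0 => ? _; exact: sqr_ge0.
have -> : \sum_i \sum_j (a i * b j - a j * b i) ^+ 2 =
    \sum_i \sum_j (a i ^+ 2 * b j ^+ 2) + \sum_i \sum_j (a j ^+ 2 * b i ^+ 2)
    - \sum_i \sum_j (a i * b i) * (a j * b j) *+ 2.
  rewrite -big_split -sumrB /=; apply: eq_bigr => i _.
  rewrite -big_split -sumrB /=; apply: eq_bigr => j _; ring.
rewrite [X in _ + X - _]exchange_big /=.
have E1 : \sum_i \sum_j a i ^+ 2 * b j ^+ 2 = (\sum_i a i ^+ 2) * (\sum_i b i ^+ 2).
  by rewrite mulr_suml; apply: eq_bigr => i _; rewrite mulr_sumr.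
have E2 : \sum_i \sum_j a i * b i * (a j * b j) *+ 2 = (\sum_i a i * b i) ^+ 2 *+ 2.
  rewrite expr2 mulr_suml -sumrMnl; apply: eq_bigr => i _.
  by rewrite mulr_sumr sumrMnl.
by rewrite E1 E2 -mulr2n -mulrnBl pmulrn_lge0// subr_ge0.
Qed.

Section fixed_size.
Context {p q : nat}.
Implicit Types A B : 'M[R]_(p, q).

Lemma enorm_ge0 A : 0 <= enorm A.
Proof. exact: sqrtr_ge0. Qed.

Lemma sqr_enorm A : enorm A ^+ 2 = \sum_i \sum_j A i j ^+ 2.
Proof.
by rewrite sqr_sqrtr//; do 2!apply: sumr_ge0 => ? _; exact: sqr_ge0.
Qed.

Lemma enorm_le A (c : R) : 0 <= c -> \sum_i \sum_j A i j ^+ 2 <= c ^+ 2 -> enorm A <= c.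
Proof. by move=> c0; rewrite -sqr_enorm ler_sqr// nnegrE enorm_ge0. Qed.

Lemma enorm0 : enorm (0 : 'M[R]_(p, q)) = 0.
Proof.
apply/eqP; rewrite -sqrf_eq0 sqr_enorm big1// => i _.
by rewrite big1// => j _; rewrite mxE expr0n.
Qed.

Lemma enormZ (c : R) A : enorm (c *: A) = `|c| * enorm A.
Proof.
apply/eqP; rewrite -(@eqrXn2 _ 2)// ?mulr_ge0 ?enorm_ge0//.
rewrite exprMn !sqr_enorm real_normK ?num_real// mulr_sumr.
apply/eqP/eq_bigr => i _; rewrite mulr_sumr; apply: eq_bigr => j _.
by rewrite mxE exprMn.
Qed.

Lemma enormN A : enorm (- A) = enorm A.
Proof. by rewrite -scaleN1r enormZ normrN1 mul1r. Qed.

Lemma enormB A B : enorm (A - B) = enorm (B - A).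
Proof. by rewrite -opprB enormN. Qed.

Lemma enorm_inner A B : \sum_i \sum_j A i j * B i j <= enorm A * enorm B.
Proof.
have [|h] := leP (\sum_i \sum_j A i j * B i j) 0.
  by move/le_trans; apply; rewrite mulr_ge0 ?enorm_ge0.
rewrite -ler_sqr ?nnegrE ?mulr_ge0 ?enorm_ge0 ?(ltW h)// exprMn !sqr_enorm.
rewrite !pair_bigA /=.
exact: (CauchySchwarz_sum (fun i : 'I_p * 'I_q => A i.1 i.2)).
Qed.

Lemma enormD A B : enorm (A + B) <= enorm A + enorm B.
Proof.
apply: enorm_le; first by rewrite addr_ge0 ?enorm_ge0.
have -> : \sum_i \sum_j (A + B) i j ^+ 2 =
    \sum_i \sum_j A i j ^+ 2 + \sum_i \sum_j B i j ^+ 2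
      + (\sum_i \sum_j A i j * B i j) *+ 2.
  rewrite -sumrMnl -!big_split; apply: eq_bigr => i _ /=.
  rewrite -sumrMnl -!big_split; apply: eq_bigr => j _ /=.
  rewrite mxE; ring.
by rewrite -!sqr_enorm sqrrD; have := enorm_inner A B; lra.
Qed.

Lemma enorm_dist A B C : enorm (A - C) <= enorm (A - B) + enorm (B - C).
Proof. by rewrite -[A in leLHS](subrK B) -addrA enormD. Qed.

Lemma enorm_sum (I : Type) (s : seq I) (F : I -> 'M[R]_(p, q)) :
  enorm (\sum_(i <- s) F i) <= \sum_(i <- s) enorm (F i).
Proof.
elim/big_rec2: _ => [|i x y _ h]; first by rewrite enorm0.
by rewrite (le_trans (enormD _ _))// lerD2l.
Qed.

Lemma entry_le_enorm A i j : `|A i j| <= enorm A.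
Proof.
rewrite -ler_sqr ?nnegrE ?enorm_ge0// sqr_enorm real_normK ?num_real//.
rewrite (bigD1 i)//= (bigD1 j)//= -addrA lerDl addr_ge0//.
  by apply: sumr_ge0 => ? _; exact: sqr_ge0.
by do 2!apply: sumr_ge0 => ? _; exact: sqr_ge0.
Qed.

End fixed_size.

Lemma enorm_le_sum {p q} (A : 'M[R]_(p, q)) :
  enorm A <= \sum_i \sum_j `|A i j|.
Proof.
rewrite {1}[A]matrix_sum_delta (le_trans (enorm_sum _ _))//.
apply: ler_sum => i _; rewrite (le_trans (enorm_sum _ _))//.
apply: ler_sum => j _; rewrite enormZ ler_piMr// enorm_le//.
rewrite (bigD1 i)//= (bigD1 j)//= big1 => [|k kj]; last first.
  by rewrite mxE (negPf kj) andbF expr0n.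
rewrite addr0 big1 ?addr0 => [|k ki].
  by rewrite mxE !eqxx expr1n.
by rewrite big1// => l _; rewrite mxE (negPf ki) expr0n.
Qed.

Lemma enorm_mulmx {p q r} (A : 'M[R]_(p, q)) (B : 'M[R]_(q, r)) :
  enorm (A *m B) <= enorm A * enorm B.
Proof.
apply: enorm_le; first by rewrite mulr_ge0 ?enorm_ge0.
rewrite exprMn !sqr_enorm mulr_suml; apply: ler_sum => i _.
rewrite [X in _ * X]exchange_big mulr_sumr; apply: ler_sum => j _.
by rewrite mxE; exact: CauchySchwarz_sum.
Qed.

Lemma sum_mxvec {p q} (F : 'I_(p * q) -> R) :
  \sum_k F k = \sum_i \sum_j F (mxvec_index i j).
Proof.
rewrite pair_bigA /= (reindex (uncurry (@mxvec_index p q)))/=.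
  by apply: eq_bigr => -[].
by case: (curry_mxvec_bij p q) => g h1 h2; exists g => x _; [apply: h1|apply: h2].
Qed.

Lemma tens1E {p e} (t : 'rV[R]_p) (v : 'rV[R]_e) i j :
  tens1 t v 0 (mxvec_index i j) = t 0 i * v 0 j.
Proof. by rewrite /tens1 mxvecE mxE big_ord1 mxE. Qed.

Lemma enorm_tens1 {p e} (t : 'rV[R]_p) (v : 'rV[R]_e) :
  enorm (tens1 t v) = enorm t * enorm v.
Proof.
apply/eqP; rewrite -(@eqrXn2 _ 2)// ?mulr_ge0 ?enorm_ge0//.
rewrite exprMn !sqr_enorm !big_ord1 sum_mxvec mulr_suml; apply/eqP.
apply: eq_bigr => i _; rewrite mulr_sumr; apply: eq_bigr => j _.
by rewrite tens1E exprMn.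
Qed.

Lemma contrE {p e d} (A : 'M[R]_(p * e, d)) (v : 'rV[R]_e) i j :
  contr A v i j = \sum_l v 0 l * A (mxvec_index i l) j.
Proof.
rewrite 2!mxE sum_mxvec (bigD1 i)//= [X in _ + X]big1 ?addr0 => [|k ki].
  by apply: eq_bigr => l _; rewrite tens1E mxE !eqxx mul1r.
by apply: big1 => l _; rewrite tens1E mxE (negPf ki) andbF !mul0r.
Qed.

(** Moving the last tensor factor into the matrix turns the integrand of an extended sequence into
    the increments of the old one applied to a directional derivative. *)
Lemma mulmx_contr {p e d} (t : 'rV[R]_p) (v : 'rV[R]_e) (A : 'M[R]_(p * e, d)) :
  tens1 t v *m A = t *m contr A v.
Proof.
apply/rowP => j; rewrite !mxE sum_mxvec; apply: eq_bigr => i _.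
rewrite contrE mulr_sumr; apply: eq_bigr => l _.
by rewrite tens1E mulrA.
Qed.

Lemma enorm_contr {p e d} (A : 'M[R]_(p * e, d)) (v : 'rV[R]_e) :
  enorm (contr A v) <= enorm A * enorm v.
Proof.
apply: enorm_le; first by rewrite mulr_ge0 ?enorm_ge0.
rewrite exprMn !sqr_enorm big_ord1 sum_mxvec mulr_suml; apply: ler_sum => i _.
rewrite exchange_big mulr_suml; apply: ler_sum => j _.
by rewrite contrE mulrC; exact: CauchySchwarz_sum.
Qed.

Lemma contrBl {p e d} (A B : 'M[R]_(p * e, d)) (v : 'rV[R]_e) :
  contr (A - B) v = contr A v - contr B v.
Proof.
apply/matrixP => i j; rewrite [RHS]mxE [X in _ = _ + X]mxE !contrE.
rewrite -sumrN -big_split /=.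
by apply: eq_bigr => l _; rewrite !mxE mulrBr.
Qed.

Lemma contrDr {p e d} (A : 'M[R]_(p * e, d)) (v w : 'rV[R]_e) :
  contr A (v + w) = contr A v + contr A w.
Proof.
apply/matrixP => i j; rewrite [RHS]mxE !contrE -big_split/=.
by apply: eq_bigr => l _; rewrite mxE mulrDl.
Qed.

Lemma contrZr {p e d} (A : 'M[R]_(p * e, d)) (c : R) (v : 'rV[R]_e) :
  contr A (c *: v) = c *: contr A v.
Proof.
apply/matrixP => i j; rewrite [RHS]mxE !contrE mulr_sumr.
by apply: eq_bigr => l _; rewrite mxE mulrA.
Qed.


Lemma contrBr {p e d} (A : 'M[R]_(p * e, d)) (v w : 'rV[R]_e) :
  contr A (v - w) = contr A v - contr A w.
Proof. by rewrite contrDr -(scaleN1r w) contrZr scaleN1r. Qed.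

End enorm_theory.

(** * Real integrals and laws of random variables *)

Section real_integrals.
Context {disp} {T : measurableType disp} {R : realType}.
Variables (mu : {measure set T -> \bar R}) (D : set T).
Hypothesis mD : measurable D.
Implicit Types f g : T -> R.

Local Notation rintegrable f := (mu.-integrable D (EFin \o f)).

Lemma eq_rintegrable f g : f =1 g -> rintegrable g -> rintegrable f.
Proof. by move/funext => ->. Qed.

Lemma rintegrable_dom f g : measurable_fun D f -> rintegrable g ->
  (forall x, D x -> `|f x| <= g x) -> rintegrable f.
Proof.
move=> mf ig fg; apply: le_integrable ig => //; first exact/measurable_EFinP.
by move=> x Dx /=; rewrite lee_fin (le_trans (fg x Dx))// ler_norm.
Qed.

Lemma rintegrableD f g : rintegrable f -> rintegrable g ->
  rintegrable (fun x => f x + g x).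
Proof. by move=> /integrableD h /h; exact. Qed.

Lemma rintegrableZ c f : rintegrable f -> rintegrable (fun x => c * f x).
Proof. by move=> h; exact: (integrableZl mD c h). Qed.

Lemma rintegrableB f g : rintegrable f -> rintegrable g ->
  rintegrable (fun x => f x - g x).
Proof. by move=> /integrableB h /h; exact. Qed.

Lemma rintegrable_sum (I : Type) (s : seq I) (F : I -> T -> R) :
  (forall i, rintegrable (F i)) -> rintegrable (fun x => \sum_(i <- s) F i x).
Proof.
move=> iF; elim: s => [|i s IH].
  rewrite (_ : _ \o _ = cst 0%:E) ?integrable0//.
  by apply/funext => x /=; rewrite big_nil.
have := rintegrableD (iF i) IH; congr (integrable _ _ _).
by apply/funext => x /=; rewrite big_cons.
Qed.

Lemma Rintegral_sum (I : Type) (s : seq I) (F : I -> T -> R) :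
  (forall i, rintegrable (F i)) ->
  \int[mu]_(x in D) (\sum_(i <- s) F i x) = \sum_(i <- s) \int[mu]_(x in D) F i x.
Proof.
move=> iF; elim: s => [|i s IH].
  by under eq_Rintegral do rewrite big_nil; rewrite big_nil /Rintegral integral0.
under eq_Rintegral do rewrite big_cons.
by rewrite RintegralD ?big_cons ?IH//; exact: rintegrable_sum.
Qed.

Lemma normr_Rintegral_le f g : measurable_fun D f -> rintegrable g ->
  (forall x, D x -> `|f x| <= g x) ->
  `|\int[mu]_(x in D) f x| <= \int[mu]_(x in D) g x.
Proof.
move=> mf ig fg; have If := rintegrable_dom mf ig fg.
rewrite (le_trans (le_normr_Rintegral mD If))// le_Rintegral//.
by have := integrable_norm If.
Qed.

(** Pairing the integral [M] with itself gives |M|^2 = int <M, F> <= |M| int g, so that no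
    dimensional factor is lost. *)
Lemma enorm_mint {p q} (F : T -> 'M[R]_(p, q)) g :
  (forall i j, rintegrable (fun x => F x i j)) -> rintegrable g ->
  (forall x, D x -> enorm (F x) <= g x) ->
  enorm (mint mu D F) <= \int[mu]_(x in D) g x.
Proof.
move=> iF ig Fg; set M := mint mu D F.
have [->|/eqP M0] := eqVneq (enorm M) 0.
  by apply: Rintegral_ge0 => x Dx; rewrite (le_trans (enorm_ge0 (F x)))// Fg.
have Mp : 0 < enorm M by rewrite lt_def enorm_ge0 andbT; exact/eqP.
rewrite -(ler_pM2l Mp) -expr2 sqr_enorm.
have iMF i : rintegrable (fun x => \sum_j M i j * F x i j).
  by apply: rintegrable_sum => j; exact: rintegrableZ.
rewrite -RintegralZl//.
have -> : \sum_i \sum_j M i j ^+ 2 =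
    \int[mu]_(x in D) (\sum_i \sum_j M i j * F x i j).
  rewrite Rintegral_sum//; apply: eq_bigr => i _.
  rewrite Rintegral_sum//; last by move=> j; exact: rintegrableZ.
  by apply: eq_bigr => j _; rewrite RintegralZl// expr2 [in X in _ * X]mxE.
apply: le_Rintegral => //; first exact: rintegrable_sum.
  exact: rintegrableZ.
move=> x Dx; rewrite (le_trans (enorm_inner _ _))// ler_wpM2l ?enorm_ge0//.
exact: Fg.
Qed.

End real_integrals.

Notation rintegrable mu D f := (mu.-integrable D (EFin \o f)).

(** * Equality in law across probability spaces *)

Section laws.
Context {d1} {T1 : measurableType d1} {d2} {T2 : measurableType d2} {R : realType}.
Variables (P : probability T1 R) (Q : probability T2 R).

(** With [id] on one side it says that a measure is the law of a map. It serves instead of an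
    equality between probabilities, which would also compare non-measurable sets. *)
Definition same_law d (V : measurableType d) (X : T1 -> V) (Y : T2 -> V) : Prop :=
  [/\ measurable_fun setT X, measurable_fun setT Y &
      forall A, measurable A -> P (X @^-1` A) = Q (Y @^-1` A)].

Lemma same_law_comp d (V : measurableType d) d' (V' : measurableType d')
    (X : T1 -> V) (Y : T2 -> V) (h : V -> V') : measurable_fun setT h ->
  same_law X Y -> same_law (h \o X) (h \o Y).
Proof.
move=> mh [mX mY XY]; split; [exact: measurableT_comp| exact: measurableT_comp|].
move=> A mA; apply: (XY (h @^-1` A)).
by rewrite -[X in measurable X]setTI; exact: mh.
Qed.

Lemma same_law_ge0_integral d (V : measurableType d) (X : T1 -> V) (Y : T2 -> V)
    (h : V -> \bar R) : measurable_fun setT h -> (forall x, 0 <= h x)%E ->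
  same_law X Y -> (\int[P]_x h (X x) = \int[Q]_y h (Y y))%E.
Proof.
move=> mh h0 [mX mY XY].
pose X' := [the {mfun T1 >-> V} of mfun_Sub (mem_set mX)].
pose Y' := [the {mfun T2 >-> V} of mfun_Sub (mem_set mY)].
have := @ge0_integral_distribution _ _ _ _ _ P X' h mh h0.
have := @ge0_integral_distribution _ _ _ _ _ Q Y' h mh h0.
rewrite /= => <- <-.
apply: eq_measure_integral => A mA _; exact: XY.
Qed.

Lemma same_law_rintegrable d (V : measurableType d) (X : T1 -> V) (Y : T2 -> V)
    (h : V -> R) : measurable_fun setT h -> same_law X Y ->
  rintegrable P setT (h \o X) -> rintegrable Q setT (h \o Y).
Proof.
move=> mh XY /integrableP[_ hX]; have [mX mY _] := XY; apply/integrableP; split.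
  by apply/measurable_EFinP; exact: measurableT_comp.
rewrite -(@same_law_ge0_integral _ _ X Y (fun v => `|(h v)%:E|%E))//.
by apply: measurableT_comp => //; exact/measurable_EFinP.
Qed.

Lemma same_law_Rintegral d (V : measurableType d) (X : T1 -> V) (Y : T2 -> V)
    (h : V -> R) : measurable_fun setT h -> same_law X Y ->
  \int[P]_x h (X x) = \int[Q]_y h (Y y).
Proof.
move=> mh XY; rewrite /Rintegral; congr fine; rewrite integralE [RHS]integralE.
have mE : measurable_fun setT (EFin \o h) by exact/measurable_EFinP.
have [mp mn] : measurable_fun setT (EFin \o h)^\+%E /\
    measurable_fun setT (EFin \o h)^\-%E.
  by split; [exact: measurable_funepos|exact: measurable_funeneg].
congr (_ - _)%E.
  rewrite (funepos_comp (EFin \o h) X) (funepos_comp (EFin \o h) Y).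
  by rewrite (same_law_ge0_integral mp _ XY).
rewrite (funeneg_comp (EFin \o h) X) (funeneg_comp (EFin \o h) Y).
by rewrite (same_law_ge0_integral mn _ XY).
Qed.

End laws.

(** * Atomless probability spaces *)

Section atomless_spaces.
Context {disp} {T : measurableType disp} {R : realType} (P : probability T R).
Implicit Types A B C D : set T.

Local Notation pr A := (fine (P A)).

Lemma prob_fin A : measurable A -> P A = (pr A)%:E.
Proof. by move=> mA; rewrite fineK// fin_num_measure. Qed.

Lemma pr_ge0 A : 0 <= pr A.
Proof. by rewrite fine_ge0. Qed.

Lemma pr_le A B : measurable A -> measurable B -> A `<=` B -> pr A <= pr B.
Proof.
by move=> mA mB AB; rewrite -lee_fin -!prob_fin// le_measure// inE.
Qed.

Lemma prU A B : measurable A -> measurable B -> A `&` B = set0 ->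
  pr (A `|` B) = pr A + pr B.
Proof.
by move=> mA mB AB; rewrite measureU// fineD// fin_num_measure.
Qed.

Lemma prD A B : measurable A -> measurable B -> B `<=` A ->
  pr (A `\` B) = pr A - pr B.
Proof.
move=> mA mB BA; have mAB : measurable (A `\` B) by exact: measurableD.
have -> : pr A = pr (A `\` B) + pr B; last by rewrite addrK.
rewrite -prU// ?setDKI//; congr (pr _); apply/seteqP; split => x /=.
  by move=> Ax; have [Bx|Bx] := pselect (B x); [right|left].
by case=> [[]//|/BA].
Qed.

Hypothesis atomP : atomless P.

Lemma atomless_halving A : measurable A -> 0 < pr A -> exists B,
  [/\ measurable B, B `<=` A, 0 < pr B & pr B <= pr A / 2].
Proof.
move=> mA A0; have := atomP mA; rewrite prob_fin// lte_fin => /(_ A0)[B [mB BA]].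
rewrite prob_fin// !lte_fin => B0 BltA.
have [h|h] := leP (pr B) (pr A / 2); first by exists B.
exists (A `\` B); split => //; first exact: measurableD.
  by rewrite prD// subr_gt0.
by rewrite prD//; lra.
Qed.

Lemma atomless_small A e : measurable A -> 0 < pr A -> 0 < e -> exists B,
  [/\ measurable B, B `<=` A, 0 < pr B & pr B <= e].
Proof.
move=> mA A0 e0.
have H k : exists B, [/\ measurable B, B `<=` A, 0 < pr B & pr B <= 2 ^- k].
  elim: k => [|k [B [mB BA B0 Bk]]].
    exists A; split => //; rewrite expr0 invr1 -lee_fin -prob_fin//.
    exact: probability_le1.
  have [C [mC CB C0 CB2]] := atomless_halving mB B0.
  exists C; split => //; first exact: subset_trans BA.
  by rewrite exprS invfM (le_trans CB2)// mulrC ler_wpM2l// invr_ge0.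
have [k ke] : exists k, 2 ^- k <= e.
  exists (truncn e^-1).+1.
  rewrite -[leRHS]invrK lef_pV2 ?posrE ?invr_gt0 ?exprn_gt0//.
  rewrite (le_trans (ltW (truncnS_gt _)))// -natrX ler_nat ltnW//.
  exact: ltn_expl.
have [B [mB BA B0 Bk]] := H k.
by exists B; split => //; exact: le_trans ke.
Qed.

(** Sierpinski: greedy exhaustion, at each step at least half of the best
  possible gain. *)
Lemma atomless_subset A p : measurable A -> 0 <= p <= pr A ->
  exists B, [/\ measurable B, B `<=` A & pr B = p].
Proof.
move=> mA /andP[p0 pA].
pose adm C D := [/\ measurable D, D `<=` A `\` C & pr C + pr D <= p].
have step C : measurable C -> C `<=` A -> pr C <= p ->
    exists2 D, adm C D & forall D', adm C D' -> pr D' <= 2 * pr D.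
  move=> mC CA Cp; pose S := [set pr D | D in adm C].
  have adm0 : adm C set0.
    by split => //; rewrite measure0 addr0.
  have Sub : has_sup S.
    split; first by exists (pr set0); exists set0.
    by exists p => _ [D [_ _ DS] <-]; rewrite (le_trans _ DS)// lerDr pr_ge0.
  have sD D : adm C D -> pr D <= sup S.
    by move=> aD; apply: sup_upper_bound => //; exists D.
  have s0 : 0 <= sup S by rewrite (le_trans _ (sD _ adm0))// pr_ge0.
  have [s00|/eqP s00] := eqVneq (sup S) 0.
    exists set0 => // D /sD; rewrite s00 => /le_trans; apply.
    by rewrite mulr_ge0// pr_ge0.
  have sp : 0 < sup S / 2 by rewrite divr_gt0// lt_def s0 andbT; exact/eqP.
  have [_ [D aD <-] Ds] := sup_adherent sp Sub.
  by exists D => // D' /sD D's; lra.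
pose good := {C | [/\ measurable C, C `<=` A & pr C <= p]}.
have g0 : [/\ measurable (@set0 T), set0 `<=` A & pr set0 <= p].
  by split => //; rewrite measure0.
have next (C : good) : {D | adm (sval C) D /\
    forall D', adm (sval C) D' -> pr D' <= 2 * pr D}.
  apply: cid; have [mC CA Cp] := svalP C.
  by have [D aD hD] := step _ mC CA Cp; exists D.
have gnext (C : good) : [/\ measurable (sval C `|` sval (next C)),
    sval C `|` sval (next C) `<=` A & pr (sval C `|` sval (next C)) <= p].
  have [[mD DC Cp] _] := svalP (next C); have [mC CA _] := svalP C.
  split; first exact: measurableU.
    by move=> x [/CA//|/DC[]].
  rewrite prU//; apply/seteqP; split=> // x [Cx /DC[_]].
  exact.
pose F := fix F n : good :=
  if n is n'.+1 then exist _ _ (gnext (F n')) else exist _ _ g0.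
pose G n := sval (F n).
pose Dn n := sval (next (F n)).
have GS n : G n.+1 = G n `|` Dn n by [].
have mG n : measurable (G n) by have [] := svalP (F n).
have GA n : G n `<=` A by have [] := svalP (F n).
have Gp n : pr (G n) <= p by have [] := svalP (F n).
have Dadm n : adm (G n) (Dn n) by have [] := svalP (next (F n)).
have Dmax n D' : adm (G n) D' -> pr D' <= 2 * pr (Dn n).
  by have [_] := svalP (next (F n)); exact.
have prG n : pr (G n.+1) = pr (G n) + pr (Dn n).
  have [mD DG _] := Dadm n; rewrite GS prU//.
  by apply/seteqP; split=> // x [Gx /DG[_]]; exact.
pose B := \bigcup_n G n.
have mB : measurable B by exact: bigcupT_measurable.
have ndG : nondecreasing_seq G.
  by apply/nondecreasing_seqP => n; rewrite GS subsetEset; exact: subsetUl.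
have BA : B `<=` A by move=> x [n _ /GA].
have cvG : P \o G @ \oo --> P B := nondecreasing_cvg_mu mG mB ndG.
have Bp : pr B <= p.
  rewrite -lee_fin -prob_fin// -(cvg_lim _ cvG)//; apply: lime_le.
    by apply/cvg_ex; exists (P B).
  by apply: nearW => n /=; rewrite prob_fin// lee_fin.
have [pB|/eqP pB] := eqVneq (pr B) p; first by exists B.
exfalso.
have pBlt : pr B < p by rewrite lt_neqAle Bp andbT; exact/eqP.
(* If the limit falls short of [p], a small piece [D] of what is left is admissible at every stage.
   Each stage then gains at least [pr D / 2], and the masses of [G n] outgrow [p]. *)
have [D [mD DA D0 Dp]] : exists D, [/\ measurable D, D `<=` A `\` B,
    0 < pr D & pr D <= p - pr B].
  apply: atomless_small; first exact: measurableD.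
    by rewrite prD// subr_gt0 (lt_le_trans pBlt).
  by rewrite subr_gt0.
have admD n : adm (G n) D.
  split => //.
    by move=> x /DA[Ax nBx]; split => // Gx; apply: nBx; exists n.
  have : pr (G n) <= pr B by apply: pr_le => // x Gx; exists n.
  lra.
have GnD n : n%:R * (pr D / 2) <= pr (G n).
  elim: n => [|n IH]; first by rewrite mul0r pr_ge0.
  rewrite prG -natr1 mulrDl mul1r lerD//.
  by have := Dmax n D (admD n); lra.
have := GnD (truncn (p / (pr D / 2))).+1.
apply/negP; rewrite -ltNge (le_lt_trans (Gp _))// -ltr_pdivrMr ?divr_gt0//.
exact: truncnS_gt.
Qed.

End atomless_spaces.

(** * Realising a discrete joint law on an atomless space *)

Section countably_valued.
Context {disp} {T : measurableType disp}.

(** Preimages are countable unions of cells, whence the absence of any condition on [phi]. *)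
Lemma measurable_fun_nat2 {d} {V : measurableType d} (a b : T -> nat)
    (phi : nat -> nat -> V) :
  measurable_fun setT a -> measurable_fun setT b ->
  measurable_fun setT (fun x => phi (a x) (b x)).
Proof.
move=> ma mb _ Y mY; rewrite setTI.
rewrite (_ : _ @^-1` _ = \bigcup_i \bigcup_(j in [set j | Y (phi i j)])
    (a @^-1` [set i] `&` b @^-1` [set j])).
  apply: bigcupT_measurable => i; apply: bigcup_measurable => j _.
  by apply: measurableI; rewrite -[X in measurable X]setTI; [apply: ma|apply: mb].
apply/seteqP; split=> [x Yx|x [i _ [j /= Yij [ai bj]]]]; last by rewrite ai bj.
by exists (a x) => //; exists (b x).
Qed.

Lemma measurable_to_nat (a : T -> nat) :
  (forall i, measurable (a @^-1` [set i])) -> measurable_fun setT a.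
Proof.
move=> ma _ Y _; rewrite setTI.
rewrite (_ : _ @^-1` _ = \bigcup_(i in Y) a @^-1` [set i]).
  by apply: bigcup_measurable => i _.
by apply/seteqP; split=> [x Yx|x [i /= + ax]]; [exists (a x)|rewrite ax].
Qed.

End countably_valued.

(** Inside the level set of [a] at [i], disjoint pieces with the masses of the cells of [(b, w)] are
    cut out by [atomless_subset], and [W] is the label of the piece. Stating the conclusion for all
    [phi] lets a single [W] serve every random variable built from the pair. *)
Lemma atomless_joint_law {d1} {T : measurableType d1} {d2} {S : measurableType d2}
    {R : realType} (P : probability T R) (Q : probability S R)
    (a : T -> nat) (b w : S -> nat) :
  atomless P -> measurable_fun setT w -> same_law P Q a b ->
  exists2 W : T -> nat, measurable_fun setT W &
    forall d (V : measurableType d) (phi : nat -> nat -> V),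
      same_law P Q (fun x => phi (a x) (W x)) (fun y => phi (b y) (w y)).
Proof.
move=> atomP mw [ma mb ab].
pose A i := a @^-1` [set i].
have mA i : measurable (A i) by rewrite -[X in measurable X]setTI; exact: ma.
pose B i j := b @^-1` [set i] `&` w @^-1` [set j].
have mB i j : measurable (B i j).
  by apply: measurableI; rewrite -[X in measurable X]setTI; [apply: mb|apply: mw].
have trivB i j i' j' :
    B i j `&` B i' j' !=set0 -> i = i' /\ j = j'.
  by move=> [x [[/= <- <-] [/= <- <-]]].
(* [C i k] carries the mass of the first [k] cells [B i j] *)
have next i : exists C : nat -> set T, forall k,
    [/\ measurable (C k), C k `<=` A i, C k `<=` C k.+1 &
        fine (P (C k)) = \sum_(j < k) fine (Q (B i j))].
  have sumB k : \sum_(j < k) fine (Q (B i j)) =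
      fine (Q (\bigcup_(j in `I_k) B i j)).
    rewrite bigcup_mkord; elim: k => [|k IH]; first by rewrite !big_ord0 measure0.
    rewrite !big_ord_recr/= IH prU//; first exact: bigsetU_measurable.
    apply/seteqP; split=> // x [+ Bk]; rewrite -bigcup_mkord => -[j /= jk Bj].
    have [_ jE] := trivB i j i k (ex_intro _ x (conj Bj Bk)).
    by move: jk; rewrite jE ltnn.
  have sum_le k : \sum_(j < k) fine (Q (B i j)) <= fine (P (A i)).
    rewrite sumB ab//; apply: pr_le => //.
    - by apply: bigcup_measurable => j _.
    - by rewrite -[X in measurable X]setTI; exact: mb.
    - by move=> x [j _ []].
  have step k (C : {C | [/\ measurable C, C `<=` A i &
        fine (P C) = \sum_(j < k) fine (Q (B i j))]}) :
      {C' | [/\ measurable C', C' `<=` A i &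
        fine (P C') = \sum_(j < k.+1) fine (Q (B i j))] /\ sval C `<=` C'}.
    apply: cid; case: C => C [mC CA pC] /=.
    have [D [mD DA pD]] : exists D, [/\ measurable D, D `<=` A i `\` C &
        fine (P D) = fine (Q (B i k))].
      apply: atomless_subset => //; first exact: measurableD.
      rewrite pr_ge0/= prD// pC lerBrDr addrC.
      by have := sum_le k.+1; rewrite big_ord_recr.
    exists (C `|` D); split; last exact: subsetUl.
    split; first exact: measurableU.
      by move=> x [/CA//|/DA[]].
    rewrite prU//; first by rewrite pC pD big_ord_recr.
    by apply/seteqP; split=> // x [Cx /DA[]].
  have C0 : [/\ measurable (@set0 T), set0 `<=` A i &
        fine (P set0) = \sum_(j < 0) fine (Q (B i j))].
    by split => //; rewrite big_ord0 measure0.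
  pose F := fix F k : {C | [/\ measurable C, C `<=` A i &
        fine (P C) = \sum_(j < k) fine (Q (B i j))]} :=
    if k is k'.+1 then let C := step k' (F k') in exist _ (sval C) (svalP C).1
    else exist _ _ C0.
  exists (fun k => sval (F k)) => k; have [? ? ?] := svalP (F k); split => //.
  exact: (svalP (step k (F k))).2.
have {next} [C hC] := choice next.
have mC i k : measurable (C i k) by have [] := hC i k.
have CA i k : C i k `<=` A i by have [] := hC i k.
have pC i k : fine (P (C i k)) = \sum_(j < k) fine (Q (B i j)) by have [] := hC i k.
have ndC i k l : (k <= l)%N -> C i k `<=` C i l.
  elim: l => [|l IH]; first by rewrite leqn0 => /eqP ->.
  rewrite leq_eqVlt => /predU1P[->//|/IH /subset_trans]; apply.
  by have [] := hC i l.
pose E i j := C i j.+1 `\` C i j.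
have mE i j : measurable (E i j) by exact: measurableD.
have pE i j : P (E i j) = Q (B i j).
  rewrite prob_fin// [RHS]prob_fin// prD//; last exact: ndC.
  by rewrite !pC big_ord_recr/= addrAC subrr add0r.
have EA i j : E i j `<=` A i by move=> x [/CA].
have trivE i j j' x : E i j x -> E i j' x -> j = j'.
  move=> [Ej nEj] [Ej' nEj']; apply/eqP; rewrite eqn_leq; apply/andP; split.
    by rewrite leqNgt; apply/negP => lt; apply: nEj; exact: ndC Ej'.
  by rewrite leqNgt; apply/negP => lt; apply: nEj'; exact: ndC Ej.
pose W x := xget 0%N [set j | E (a x) j x].
have WE i j x : E i j x -> a x = i /\ W x = j.
  move=> Ex; have ax : a x = i by exact: (EA _ _ _ Ex).
  split=> //; rewrite /W ax; case: xgetP => [k _ /= Ek|/(_ j)//].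
  exact: trivE Ek Ex.
have mW : measurable_fun setT W.
  (* The label 0 is also the default value off all pieces, so only positive labels have this
     description; the level set of 0 is the complement of the others. *)
  have mWS j : W @^-1` [set j.+1] = \bigcup_i E i j.+1.
    apply/seteqP; split => [x /= Wj|x [i _ /WE[]//]].
    exists (a x) => //; move: Wj; rewrite /W; case: xgetP => [k _ Ek <-//|//].
  have mS j : measurable (W @^-1` [set j.+1]).
    by rewrite mWS; exact: bigcupT_measurable.
  apply: measurable_to_nat => -[|j]//.
  rewrite (_ : _ @^-1` _ = ~` \bigcup_j W @^-1` [set j.+1]).
    by apply: measurableC; exact: bigcupT_measurable.
  apply/seteqP; split=> [x /= Wx [j _ /=]|x /= h]; first by rewrite Wx.
  by case Wx : (W x) => [//|j]; exfalso; apply: h; exists j.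
exists W => // d V phi.
split; [exact: measurable_fun_nat2|exact: measurable_fun_nat2|].
pose code (k : nat) : nat * nat := odflt (0, 0)%N (unpickle k).
have codeK p : code (pickle p) = p by rewrite /code pickleK.
(* The pieces fill [T] up to a null set only, where [W] takes its default value. An inequality is
   thus what comes out directly; applied to the complement as well, it gives equality because both
   total masses are 1. *)
have le_law (D : set (nat * nat)) :
    (Q [set y | D (b y, w y)] <= P [set x | D (a x, W x)])%E.
  (* [code] sends every invalid index to (0, 0); the first condition keeps one index per pair, so
     that the cells are disjoint. *)
  pose K := [set k | pickle (code k) = k /\ D (code k)].
  have -> : [set y | D (b y, w y)] = \bigcup_(k in K) B (code k).1 (code k).2.
    apply/seteqP; split => [y /= Dy|y [k [_ Dk]] [/= -> ->]].
      by exists (pickle (b y, w y)); rewrite /K /= codeK.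
    by rewrite -surjective_pairing.
  rewrite measure_bigcup//; last first.
    move=> k l [kE _] [lE _] /trivB[e1 e2].
    by rewrite -kE -lE [code k]surjective_pairing [code l]surjective_pairing e1 e2.
  have -> : (\sum_(k <oo | k \in K) Q (B (code k).1 (code k).2) =
      \sum_(k <oo | k \in K) P (E (code k).1 (code k).2))%E.
    by apply: eq_eseriesr => k _; rewrite pE.
  rewrite -measure_bigcup//; last first.
    move=> k l [kE _] [lE _] [x [/WE[e1 e2] /WE[e3 e4]]].
    rewrite -kE -lE [code k]surjective_pairing [code l]surjective_pairing.
    by rewrite -e1 -e2 -e3 -e4.
  apply: le_measure; rewrite ?inE.
  - by apply: bigcup_measurable => k _.
  - have mD : measurable_fun setT (fun x => `[< D (a x, W x) >]).
      exact: (@measurable_fun_nat2 _ _ _ bool a W (fun i j => `[< D (i, j) >])).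
    rewrite (_ : mkset _ = setT `&` (fun x => `[< D (a x, W x) >]) @^-1` [set true]).
      exact: mD.
    by rewrite setTI; apply/seteqP; split=> x /= /asboolP.
  - by move=> x [k [_ Dk] /WE[/= -> ->]]; rewrite -surjective_pairing.
move=> Y mY; apply/eqP; rewrite eq_le; apply/andP; split; last first.
  exact: (le_law [set p | Y (phi p.1 p.2)]).
have mP : measurable ((fun x => phi (a x) (W x)) @^-1` Y).
  by rewrite -[X in measurable X]setTI; exact: measurable_fun_nat2.
have mQ : measurable ((fun x => phi (b x) (w x)) @^-1` Y).
  by rewrite -[X in measurable X]setTI; exact: measurable_fun_nat2.
have := le_law [set p | ~ Y (phi p.1 p.2)].
rewrite -[X in Q X]/(~` (_ @^-1` Y)) -[X in P X]/(~` (_ @^-1` Y)).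
rewrite (probability_setC P mP) (probability_setC Q mQ) (prob_fin P mP).
by rewrite (prob_fin Q mQ) -!EFinB !lee_fin lerD2l lerN2.
Qed.

(** * Measurability and rounding *)

Section borel_matrices.
Context {R : realType}.

(** The open sets are those of the sup norm, and [p * q] bounds the ratio of the Euclidean norm to
    it. *)
Lemma lipschitz_measurable_mx {p q} (f : 'M[R]_(p, q) -> R) (K : R) :
  (forall A B, `|f A - f B| <= K * enorm (A - B)) -> measurable_fun setT f.
Proof.
move=> lf; apply: (measurability _ (RGenOpens.measurableE R)).
move=> _ [_ [a [b ->] <-]]; rewrite setTI; apply: sub_sigma_algebra => /=.
rewrite openE => A /= fA.
have /nbhs_ballP[r /= r0 rU] : nbhs (f A) `]a, b[%classic.
  by apply: open_nbhs_nbhs; split => //; exact: interval_open.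
have K0 : 0 < `|K| * (p * q)%:R + 1 by rewrite ltr_wpDl// mulr_ge0.
apply/nbhs_ballP; exists (r / (`|K| * (p * q)%:R + 1)) => /=.
  by rewrite divr_gt0.
move=> B [_ AB]; apply: rU; rewrite -ball_normE /=.
apply: (le_lt_trans (lf A B)).
have eAB : enorm (A - B) <= (p * q)%:R * (r / (`|K| * (p * q)%:R + 1)).
  rewrite (le_trans (enorm_le_sum _))//.
  rewrite (@le_trans _ _ (\sum_(i < p) \sum_(j < q) (r / (`|K| * (p * q)%:R + 1))))//.
    apply: ler_sum => i _; apply: ler_sum => j _.
    by have := AB i j; rewrite -ball_normE /= !mxE => /ltW.
  by rewrite !sumr_const !card_ord -mulrnA mulnC mulr_natl.
have := ler_norm K => Kn.
rewrite (@le_lt_trans _ _ (`|K| * ((p * q)%:R * (r / (`|K| * (p * q)%:R + 1)))))//.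
  by rewrite (le_trans (ler_wpM2r (enorm_ge0 _) Kn))// ler_wpM2l.
by rewrite !mulrA ltr_pdivrMr// mulrDr mulr1 [ltLHS]mulrC ltrDl.
Qed.

Lemma lipschitz_enorm {p q} (A B : 'M[R]_(p, q)) :
  `|enorm A - enorm B| <= enorm (A - B).
Proof.
have h (C D : 'M[R]_(p, q)) : enorm C <= enorm (C - D) + enorm D.
  by rewrite -{1}(subrK D C) enormD.
rewrite ler_norml lerBlDr h andbT lerNl opprB lerBlDr enormB; exact: h.
Qed.

Lemma measurable_enorm {d} {T : measurableType d} {p q} (X : T -> 'M[R]_(p, q)) :
  measurable_fun setT X -> measurable_fun setT (fun w => enorm (X w)).
Proof.
move=> mX; apply: (@measurableT_comp _ _ _ _ _ _ enorm) => //.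
apply: (@lipschitz_measurable_mx _ _ _ 1) => A B; rewrite mul1r.
exact: lipschitz_enorm.
Qed.

Lemma measurable_submx {d} {T : measurableType d} {p q} (X Y : T -> 'M[R]_(p, q)) :
  measurable_fun setT X -> measurable_fun setT Y ->
  measurable_fun setT (fun w => X w - Y w).
Proof.
move=> mX mY; under eq_fun do rewrite -scaleN1r.
by apply: measurable_addmx => //; exact: measurable_scalemx.
Qed.

(** The pair (real, tuple) is encoded as a matrix, where Lipschitz functions are
  known to be Borel. *)
Lemma lipschitz_measurable_tuple {d} {T : measurableType d} {e m : nat}
    (H : R -> m.-tuple 'rV[R]_e -> R) (K : R) (s : T -> R)
    (X : 'I_m -> T -> 'rV[R]_e) :
  (forall r r' x x', `|H r x - H r' x'| <=
     K * (`|r - r'| + \sum_(i < m) enorm (tnth x i - tnth x' i))) ->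
  measurable_fun setT s -> (forall i, measurable_fun setT (X i)) ->
  measurable_fun setT (fun w => H (s w) [tuple X i w | i < m]).
Proof.
move=> lH ms mX.
pose enc w : 'M[R]_(m.+1, e.+1) := \matrix_(i, j)
  if unlift ord0 i is Some i' then
    if unlift ord0 j is Some j' then X i' w 0 j' else 0
  else s w.
pose dec (M : 'M[R]_(m.+1, e.+1)) (i : 'I_m) : 'rV[R]_e := \row_j M (lift ord0 i) (lift ord0 j).
pose G (M : 'M[R]_(m.+1, e.+1)) := H (M 0 0) [tuple dec M i | i < m].
have -> : (fun w => H (s w) [tuple X i w | i < m]) = G \o enc.
  apply/funext => w /=; rewrite /G; congr H; first by rewrite mxE unlift_none.
  apply: eq_from_tnth => i; rewrite !tnth_mktuple; apply/rowP => j.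
  by rewrite !mxE !liftK.
apply: measurableT_comp; last first.
  apply/measurable_fun_mxP => i j; under eq_fun do rewrite mxE.
  case: unliftP => [i' _|_]; last exact: ms.
  case: unliftP => [j' _|_]; last exact: measurable_cst.
  by move/measurable_fun_mxP : (mX i'); exact.
apply: (@lipschitz_measurable_mx _ _ _ (`|K| * m.+1%:R)) => A B.
rewrite (le_trans (lH _ _ _ _))//.
rewrite (@le_trans _ _ (`|K| * (`|A 0 0 - B 0 0| +
    \sum_(i < m) enorm (dec A i - dec B i))))//.
  rewrite [leRHS](_ : _ = `|K| * (`|A 0 0 - B 0 0| + \sum_(i < m) enorm
    (tnth [tuple dec A i | i < m] i - tnth [tuple dec B i | i < m] i))).
    by rewrite ler_wpM2r ?ler_norm// addr_ge0// sumr_ge0// => i _; exact: enorm_ge0.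
  by congr (_ * (_ + _)); apply: eq_bigr => i _; rewrite !tnth_mktuple.
rewrite -mulrA ler_wpM2l// -natr1 mulrDl mul1r addrC lerD//; last first.
  by have := entry_le_enorm (A - B) 0 0; rewrite !mxE.
rewrite mulr_natl -[X in _ <= _ *+ X]card_ord -sumr_const; apply: ler_sum => i _.
apply: enorm_le; first exact: enorm_ge0.
rewrite sqr_enorm big_ord1 (bigD1 (lift ord0 i))//= ler_wpDr//.
  by do 2!apply: sumr_ge0 => ? _; exact: sqr_ge0.
rewrite big_ord_recl/= ler_wpDl ?sqr_ge0//.
by apply: ler_sum => j _; rewrite !mxE.
Qed.

(** Coordinates are rounded down to a grid of mesh [eta / e.+1], which makes the [e] errors add up
    to at most [eta] and is meaningful for [e = 0]. Integer vectors are countable, hence coded by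
    natural numbers. *)
Lemma rounding {e} (eta : R) : 0 < eta ->
  exists (code : 'rV[R]_e -> nat) (dec : nat -> 'rV[R]_e),
    measurable_fun setT code /\ forall x, enorm (x - dec (code x)) <= eta.
Proof.
move=> eta0; pose h := eta / e.+1%:R.
have h0 : 0 < h by rewrite divr_gt0.
pose rnd (x : 'rV[R]_e) : 'rV[int]_e := \row_j Num.floor (x 0 j / h).
pose dec k : 'rV[R]_e :=
  if unpickle k is Some c then \row_j (((c : 'rV[int]_e) 0 j)%:~R * h) else 0.
exists (fun x => pickle (rnd x)), dec; split.
  apply: measurable_to_nat => k.
  have [[x xk]|nk] := pselect (exists x, pickle (rnd x) = k); last first.
    rewrite (_ : _ @^-1` _ = set0)//; apply/seteqP; split => // x /= xk.
    by apply: nk; exists x.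
  rewrite (_ : _ @^-1` _ = \bigcap_(j in [set: 'I_e])
    ((fun y : 'rV[R]_e => y 0 j) @^-1` `[(rnd x 0 j)%:~R * h, ((rnd x 0 j) + 1)%:~R * h[)).
    apply: fin_bigcap_measurable => // j _; rewrite -[X in measurable X]setTI.
    exact: measurable_entry.
  have E (y : 'rV[R]_e) j (z : int) :
      (y 0 j \in `[z%:~R * h, (z + 1)%:~R * h[) = (rnd y 0 j == z).
    by rewrite in_itv/= -ler_pdivlMr// -ltr_pdivrMr// mxE -floor_eq.
  apply/seteqP; split => [y /= yk j _ /=|y /= hy].
    rewrite E; apply/eqP; congr (fun_of_matrix _ 0 j).
    by apply: (pcan_inj pickleK); rewrite yk.
  rewrite -xk; congr pickle; apply/rowP => j; apply/eqP.
  by rewrite -E; exact: hy.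
move=> x; rewrite /dec pickleK (le_trans (enorm_le_sum _))// big_ord1.
rewrite (@le_trans _ _ (\sum_(j < e) h))//.
  apply: ler_sum => j _; rewrite !mxE.
  have := floor_itv (x 0 j / h) => /andP[h1 h2].
  rewrite ler_pdivlMr// in h1; rewrite ltr_pdivrMr// in h2.
  rewrite ger0_norm ?subr_ge0// lerBlDl -[X in _ + X]mul1r -mulrDl.
  by rewrite -(intrD _ _ 1) ltW.
rewrite sumr_const card_ord -mulr_natl /h mulrCA ler_piMr ?(ltW eta0)//.
by rewrite ler_pdivrMr// mul1r ler_nat.
Qed.

End borel_matrices.

(** * The Lions derivative along a coupling *)

Section same_law_relation.
Context {d1} {T1 : measurableType d1} {d2} {T2 : measurableType d2}
  {d3} {T3 : measurableType d3} {R : realType}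
  (P : probability T1 R) (Q : probability T2 R) (M : probability T3 R)
  {d} {V : measurableType d}.

Lemma eq_same_law (X X' : T1 -> V) (Y : T2 -> V) :
  X =1 X' -> same_law P Q X' Y -> same_law P Q X Y.
Proof. by move/funext => ->. Qed.

Lemma same_law_sym (X : T1 -> V) (Y : T2 -> V) :
  same_law P Q X Y -> same_law Q P Y X.
Proof. by case=> mX mY h; split => // A mA; rewrite h. Qed.

Lemma same_law_trans (X : T1 -> V) (Y : T2 -> V) (Z : T3 -> V) :
  same_law P Q X Y -> same_law Q M Y Z -> same_law P M X Z.
Proof.
by case=> mX mY h [_ mZ h']; split => // A mA; rewrite h// h'.
Qed.

End same_law_relation.

Lemma same_law_distribution {d1} {T1 : measurableType d1} {d} {V : measurableType d}
    {R : realType} (P : probability T1 R) (X : {mfun T1 >-> V}) :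
  same_law (distribution P X) P id X.
Proof. by split => //; exact: measurable_funPT. Qed.

Lemma same_law_measure_eq {d} {V : measurableType d} {d1} {T : measurableType d1}
    {R : realType} (Q : probability T R) (mu nu : probability V R) (u : T -> V) :
  same_law mu Q id u -> same_law nu Q id u -> mu ≡μ nu.
Proof. case=> _ _ h [_ _ h'] A mA; exact: (etrans (h A mA) (esym (h' A mA))). Qed.

(** * Moments and square integrability *)

Section square_integrable.
Context {disp} {T : measurableType disp} {R : realType} (P : probability T R).
Context {e : nat}.
Local Notation E := 'rV[R]_e.

Lemma rintegrable_cst c : rintegrable P setT (fun _ => c : R).
Proof. exact: finite_measure_integrable_cst. Qed.

Lemma Rintegral_prob_cst c : \int[P]_x (c : R) = c.
Proof.
rewrite (Rintegral_cst P measurableT c) -[RHS]mulr1; congr (_ * _).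
exact: (congr1 fine (probability_setT P)).
Qed.

Lemma le_Rintegral_prob (f h : T -> R) : rintegrable P setT f ->
  rintegrable P setT h -> (forall x, f x <= h x) ->
  \int[P]_x f x <= \int[P]_x h x.
Proof. by move=> iF ih fh; apply: le_Rintegral. Qed.

Lemma finite_moment_law q (mu : probability E R) (u : T -> E) :
  same_law mu P id u ->
  finite_moment q mu <-> rintegrable P setT (fun y => enorm (u y) ^+ q).
Proof.
move=> hu; have [_ mu_ _] := hu.
have mq : measurable_fun setT (fun x : E => (enorm x ^+ q)%:E).
  by apply/measurable_EFinP; apply: measurable_funX; exact: measurable_enorm.
have e0 (x : E) : (0 <= (enorm x ^+ q)%:E)%E by rewrite lee_fin exprn_ge0// enorm_ge0.
rewrite /finite_moment (same_law_ge0_integral mq e0 hu); split.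
  move=> h; apply/integrableP; split; first exact: (measurableT_comp mq).
  rewrite (eq_integral (fun y => (enorm (u y) ^+ q)%:E))// => y _ /=.
  by rewrite ger0_norm// exprn_ge0// enorm_ge0.
move=> /integrableP[_]; rewrite (eq_integral (fun y => (enorm (u y) ^+ q)%:E))//.
by move=> y _ /=; rewrite ger0_norm// exprn_ge0// enorm_ge0.
Qed.

Lemma L2norm_sqr (X : {mfun T >-> E}) :
  (L2norm P X `^ 2 = \int[P]_x (enorm (X x) ^+ 2)%:E)%E.
Proof.
rewrite /L2norm powR_Lnorm ?pnatr_eq0//; apply: eq_integral => x _ /=.
by rewrite powR_mulrn ?normr_ge0// ger0_norm// enorm_ge0.
Qed.

Lemma L2_rintegrable (X : {mfun T >-> E}) :
  L2 P X <-> rintegrable P setT (fun x => enorm (X x) ^+ 2).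
Proof.
rewrite -(finite_moment_law 2 (same_law_distribution P X)) /finite_moment.
have mq : measurable_fun setT (fun x : E => (enorm x ^+ 2)%:E).
  by apply/measurable_EFinP; apply: measurable_funX; exact: measurable_enorm.
rewrite (same_law_ge0_integral mq _ (same_law_distribution P X)); last first.
  by move=> x; rewrite lee_fin sqr_ge0.
rewrite -L2norm_sqr /L2; split=> [h|].
  by rewrite poweR_lty.
by apply: lty_poweRy; rewrite pnatr_eq0.
Qed.

Lemma L2norm_le (X : {mfun T >-> E}) c : 0 <= c ->
  rintegrable P setT (fun x => enorm (X x) ^+ 2) ->
  \int[P]_x (enorm (X x) ^+ 2) <= c ^+ 2 -> fine (L2norm P X) <= c.
Proof.
move=> c0 /L2_rintegrable XL; rewrite /Rintegral -L2norm_sqr.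
have N0 := Lnorm_ge0 P 2%:E (EFin \o (enorm \o X)).
move: XL N0; rewrite /L2 -/(L2norm P X).
case: (L2norm P X) => // r _; rewrite lee_fin => r0 /=.
by rewrite powR_mulrn// ler_sqr.
Qed.

Lemma rintegrable_sqr_le (X : T -> E) : measurable_fun setT X ->
  rintegrable P setT (fun x => enorm (X x) ^+ 2) ->
  rintegrable P setT (fun x => enorm (X x)).
Proof.
move=> mX iX; apply: (@rintegrable_dom _ _ _ _ _ _ _ (fun x => 1 + enorm (X x) ^+ 2)) => //.
- exact: measurable_enorm.
- by apply: rintegrableD => //; exact: rintegrable_cst.
- move=> x _; rewrite ger0_norm ?enorm_ge0//; have := sqr_ge0 (enorm (X x) - 1).
  by have := sqr_ge0 (enorm (X x)); nra.
Qed.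

Lemma rintegrable_close (X Y : T -> E) (c : R) : measurable_fun setT Y ->
  (forall x, enorm (X x - Y x) <= c) ->
  rintegrable P setT (fun x => enorm (X x) ^+ 2) ->
  rintegrable P setT (fun x => enorm (Y x) ^+ 2).
Proof.
move=> mY XY iX.
apply: (@rintegrable_dom _ _ _ _ _ _ _ (fun x => 2 * c ^+ 2 + 2 * enorm (X x) ^+ 2)) => //.
- by apply: measurable_funX; exact: measurable_enorm.
- apply: rintegrableD => //; first exact: rintegrable_cst.
  exact: rintegrableZ.
- move=> x _; rewrite ger0_norm ?sqr_ge0//.
  have : enorm (Y x) <= enorm (X x) + c.
    rewrite -{1}(subrK (X x) (Y x)) addrC (le_trans (enormD _ _))// lerD2l.
    by rewrite enormB.
  have := enorm_ge0 (Y x); have := enorm_ge0 (X x).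
  by have := sqr_ge0 (enorm (X x) - c); nra.
Qed.

End square_integrable.

Definition mkmfun {d1} {T : measurableType d1} {d2} {V : measurableType d2}
  (X : T -> V) (mX : measurable_fun setT X) : {mfun T >-> V} :=
  mfun_Sub (mem_set mX).

Lemma mkmfunE {d1} {T : measurableType d1} {d2} {V : measurableType d2}
  (X : T -> V) (mX : measurable_fun setT X) : mkmfun mX = X :> (T -> V).
Proof. by []. Qed.

Section lions_calculus.
Context {d1} {T : measurableType d1} {d2} {S : measurableType d2} {R : realType}.
Context (P : probability T R) (Q : probability S R) {e p d : nat}.
Local Notation E := 'rV[R]_e.
Hypothesis atomP : atomless P.
Variable g : probability E R -> 'M[R]_(p, d).
Hypothesis g_ext : forall mu nu : probability E R, finite_moment 2 mu ->
  mu ≡μ nu -> g mu = g nu.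

(** The codes of [X] and [u] have the same law, so [atomless_joint_law] finds a partner on the space
    of [X] for every discrete variable [w] that lives next to [u]. *)
Lemma coupled_rounding (X : {mfun T >-> E}) (u : S -> E) (eta : R) :
  same_law P Q X u -> 0 < eta ->
  exists (code : E -> nat) (dec : nat -> E),
    [/\ measurable_fun setT code, forall x, enorm (x - dec (code x)) <= eta &
    forall w : S -> nat, measurable_fun setT w ->
    exists2 W : T -> nat, measurable_fun setT W &
      forall d' (V : measurableType d') (phi : nat -> nat -> V),
        same_law P Q (fun x => phi (code (X x)) (W x))
                     (fun y => phi (code (u y)) (w y))].
Proof.
move=> Xu eta0; have [code [dec [mcode hdec]]] := rounding (e := e) eta0.
exists code, dec; split => // w mw.
have ab : same_law P Q (code \o X) (code \o u) by exact: same_law_comp.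
exact: (atomless_joint_law atomP mw ab).
Qed.

(** Differentiability at one [X] of law [mu] yields continuity at [mu] along discrete approximations
    of [u]: the partner [W] of [w] makes [c (W x)] a variable of law [nu] that is close to [X] in
    L2, and the derivative is a bounded map. *)
Lemma lions_continuous (u : S -> E) (mu : probability E R) D :
  same_law mu Q id u -> rintegrable Q setT (fun y => enorm (u y) ^+ 2) ->
  lions_derivative P g mu D ->
  forall eps, 0 < eps -> exists2 eta, 0 < eta &
    forall (w : S -> nat) (c : nat -> E) (nu : probability E R),
      measurable_fun setT w -> (forall y, enorm (u y - c (w y)) <= eta) ->
      same_law nu Q id (c \o w) -> enorm (g nu - g mu) <= eps.
Proof.
move=> muu iu [_ [X [XL Xmu _ [_ [K hK] hF]]]] eps eps0.
have [delta delta0 {}hF] := hF 1 ltr01.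
have Xu : same_law P Q X u.
  apply: (same_law_trans _ muu); apply: same_law_sym.
  have [mX _ h] := same_law_distribution P X.
  by split => // A mA; rewrite -(Xmu A mA).
have fmu : finite_moment 2 mu by apply/(finite_moment_law 2 muu).
have K1 : 0 < `|K| + 1 by rewrite ltr_wpDl.
(* [4 * eta] will bound the L2 norm of the increment [h], whose mean square is at most 2 eta^2 + 2 *
   4 eta^2. As [K] may be negative, its absolute value is used. *)
have [eta [eta0 eta_d eta_e]] : exists eta, [/\ 0 < eta, 4 * eta <= delta &
    (`|K| + 1) * (4 * eta) <= eps].
  exists (Num.min (delta / 4) (eps / (4 * (`|K| + 1)))); split.
  - by rewrite lt_min !divr_gt0// mulr_gt0.
  - by rewrite mulrC -ler_pdivlMr// ge_min lexx.
  - rewrite mulrA [_ * 4]mulrC [leLHS]mulrC -ler_pdivlMr ?mulr_gt0//.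
    by rewrite ge_min lexx orbT.
exists eta => // w c nu mw uc nuc.
have [code [dec [mcode hdec hW]]] := coupled_rounding Xu eta0.
have {hW} [W mW hW] := hW w mw.
have mX : measurable_fun setT X by exact: measurable_funPT.
have mcW : measurable_fun setT (fun x => c (W x)).
  exact: (@measurable_fun_nat2 _ _ _ _ W W (fun _ i => c i)).
have mh : measurable_fun setT (fun x => c (W x) - X x) by exact: measurable_submx.
pose h := mkmfun mh.
have law_diff : same_law P Q (fun x => enorm (dec (code (X x)) - c (W x)) ^+ 2)
    (fun y => enorm (dec (code (u y)) - c (w y)) ^+ 2).
  exact: (hW _ _ (fun i j => enorm (dec i - c j) ^+ 2 : R)).
have close y : enorm (dec (code (u y)) - c (w y)) ^+ 2 <= 4 * eta ^+ 2.
  have : enorm (dec (code (u y)) - c (w y)) <= eta + eta.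
    by rewrite (le_trans (enorm_dist _ (u y) _))// lerD// enormB.
  have := enorm_ge0 (dec (code (u y)) - c (w y)); nra.
have mdiffQ : measurable_fun setT (fun y => enorm (dec (code (u y)) - c (w y)) ^+ 2).
  by case: law_diff.
have iQ : rintegrable Q setT (fun y => enorm (dec (code (u y)) - c (w y)) ^+ 2).
  apply: (rintegrable_dom _ mdiffQ (rintegrable_cst Q (4 * eta ^+ 2))) => // y _.
  by rewrite ger0_norm ?sqr_ge0.
have iP : rintegrable P setT (fun x => enorm (dec (code (X x)) - c (W x)) ^+ 2).
  exact: (@same_law_rintegrable _ _ _ _ _ Q P _ _ _ _ id _ (same_law_sym law_diff)).
have eP : \int[P]_x (enorm (dec (code (X x)) - c (W x)) ^+ 2) <= 4 * eta ^+ 2.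
  rewrite (@same_law_Rintegral _ _ _ _ _ P Q _ _ _ _ id _ law_diff)//.
  rewrite -[leRHS](Rintegral_prob_cst Q).
  by apply: le_Rintegral_prob => //; exact: rintegrable_cst.
have hle x : enorm (h x) ^+ 2 <=
    2 * eta ^+ 2 + 2 * enorm (dec (code (X x)) - c (W x)) ^+ 2.
  have : enorm (h x) <= eta + enorm (dec (code (X x)) - c (W x)).
    rewrite /h mkmfunE enormB (le_trans (enorm_dist _ (dec (code (X x))) _))//.
    by rewrite lerD2r.
  have := enorm_ge0 (h x); have := enorm_ge0 (dec (code (X x)) - c (W x)).
  have := sqr_ge0 (eta - enorm (dec (code (X x)) - c (W x))); nra.
have ib : rintegrable P setT
    (fun x => 2 * eta ^+ 2 + 2 * enorm (dec (code (X x)) - c (W x)) ^+ 2).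
  by apply: rintegrableD => //; [exact: rintegrable_cst|exact: rintegrableZ].
have ih : rintegrable P setT (fun x => enorm (h x) ^+ 2).
  apply: (rintegrable_dom _ _ ib) => //.
    by apply: measurable_funX; exact: measurable_enorm.
  by move=> x _; rewrite ger0_norm ?sqr_ge0.
have hL : L2 P h by apply/L2_rintegrable.
have hN : fine (L2norm P h) <= 4 * eta.
  apply: L2norm_le => //; first by rewrite mulr_ge0// ltW.
  rewrite (le_trans (le_Rintegral_prob ih ib hle))//.
  rewrite RintegralD//; [|exact: rintegrable_cst|exact: rintegrableZ].
  rewrite Rintegral_prob_cst RintegralZl//.
  by have := sqr_ge0 eta; nra.
have nuX : g (distribution P (addRV X h)) = g nu.
  have lawXh : same_law (distribution P (addRV X h)) Q id (c \o w).
    apply: (same_law_trans (same_law_distribution _ _)).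
    apply: (@eq_same_law _ _ _ _ _ _ _ _ _ _ (fun x => c (W x))).
      by move=> x; rewrite /= /addRV mkmfunE addrC subrK.
    exact: (hW _ _ (fun i j => c j)).
  apply: g_ext; last exact: same_law_measure_eq lawXh nuc.
  apply/(finite_moment_law 2 lawXh); apply: (rintegrable_close _ uc) => //.
  by apply: (@measurable_fun_nat2 _ _ _ _ w w (fun _ i => c i)).
have gX : g (distribution P X) = g mu.
  by apply/esym/g_ext => // A mA; rewrite (Xmu A mA).
have := hF h hL (le_trans hN eta_d); rewrite nuX gX mul1r => hF'.
have L0 : 0 <= fine (L2norm P h) by rewrite fine_ge0// Lnorm_ge0.
rewrite -(subrK (mint P setT (fun w0 => contr (D (X w0)) (h w0))) (g nu - g mu)).
apply: (le_trans (enormD _ _)).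
have hK' := hK h hL.
have hK2 : K * fine (L2norm P h) <= `|K| * fine (L2norm P h).
  by rewrite ler_wpM2r// ler_norm.
apply: le_trans eta_e; rewrite (@le_trans _ _ ((`|K| + 1) * fine (L2norm P h)))//.
  by rewrite mulrDl mul1r; lra.
by rewrite ler_wpM2l// ltW.
Qed.

End lions_calculus.

Section mint_theory.
Context {disp} {T : measurableType disp} {R : realType} {p q : nat}.
Variables (mu : {measure set T -> \bar R}) (D : set T).
Hypothesis mD : measurable D.
Implicit Types F G : T -> 'M[R]_(p, q).

Lemma mintB F G : (forall i j, rintegrable mu D (fun x => F x i j)) ->
  (forall i j, rintegrable mu D (fun x => G x i j)) ->
  mint mu D (fun x => F x - G x) = mint mu D F - mint mu D G.
Proof.
move=> iF iG; apply/matrixP => i j; rewrite !mxE.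
by under eq_Rintegral do rewrite !mxE; rewrite RintegralB.
Qed.

Lemma mintZ c F : (forall i j, rintegrable mu D (fun x => F x i j)) ->
  mint mu D (fun x => c *: F x) = c *: mint mu D F.
Proof.
move=> iF; apply/matrixP => i j; rewrite !mxE.
by under eq_Rintegral do rewrite !mxE; rewrite RintegralZl.
Qed.

End mint_theory.

Lemma measurable_contr {d1} {T : measurableType d1} {R : realType} {p e d : nat}
    (F : T -> 'M[R]_(p * e, d)) (h : T -> 'rV[R]_e) i j :
  measurable_fun setT F -> measurable_fun setT h ->
  measurable_fun setT (fun x => contr (F x) (h x) i j).
Proof.
move=> /measurable_fun_mxP mF /measurable_fun_mxP mh.
under eq_fun do rewrite contrE.
apply: measurable_sum => l.
by apply: measurable_funM; [exact: mh|exact: mF].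
Qed.

Lemma rintegrable_contr {d1} {T : measurableType d1} {R : realType} {p e d : nat}
    (P : probability T R) (F : T -> 'M[R]_(p * e, d)) (h : T -> 'rV[R]_e) B i j :
  measurable_fun setT F -> measurable_fun setT h ->
  (forall x, enorm (F x) <= B) -> rintegrable P setT (fun x => enorm (h x)) ->
  rintegrable P setT (fun x => contr (F x) (h x) i j).
Proof.
move=> mF mh FB ih.
apply: (rintegrable_dom _ _ (rintegrableZ _ B ih)) => //; first exact: measurable_contr.
move=> x _; rewrite (le_trans (entry_le_enorm _ _ _))//.
by rewrite (le_trans (enorm_contr _ _))// ler_wpM2r ?enorm_ge0.
Qed.

(** * The chain rule in the measure *)

Section lions_chain_rule.
Context {d1} {T : measurableType d1} {d2} {S : measurableType d2} {R : realType}.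
Context (P : probability T R) (Q : probability S R) {e p d : nat}.
Local Notation E := 'rV[R]_e.
Hypothesis atomP : atomless P.
Variable g : probability E R -> 'M[R]_(p, d).
Hypothesis g_ext : forall mu nu : probability E R, finite_moment 2 mu ->
  mu ≡μ nu -> g mu = g nu.

(** [Xr + t *: Z] below has a law close to [mu_ t] only. The scale of the rounding
  is chosen after [t], so that [lions_continuous] at [mu_ t] absorbs the error:
  no Lipschitz bound on [g] is needed, and none is available for [g = f]. *)
Lemma lions_chain_rule (u v : S -> E) (mu_ : R -> probability E R) D (B L : R) :
  measurable_fun setT u -> measurable_fun setT v ->
  rintegrable Q setT (fun y => enorm (u y) ^+ 2) ->
  rintegrable Q setT (fun y => enorm (v y) ^+ 2) ->
  (forall t, same_law (mu_ t) Q id (fun y => u y + t *: v y)) ->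
  (forall t, exists D, lions_derivative P g (mu_ t) D) ->
  lions_derivative P g (mu_ 0) D -> 0 <= L ->
  (forall x, enorm (D x) <= B) ->
  (forall x y, enorm (D x - D y) <= L * enorm (x - y)) ->
  forall eps, 0 < eps -> exists2 delta, 0 < delta & forall t, `|t| <= delta ->
    enorm (g (mu_ t) - g (mu_ 0) -
           t *: mint Q setT (fun y => contr (D (u y)) (v y))) <= eps * `|t|.
Proof.
move=> mu mv iu iv law_ lions_ [mD [X [XL Xmu integr [_ _ hF]]]] L0 DB DL eps eps0.
have B0 : 0 <= B by rewrite (le_trans _ (DB 0))// enorm_ge0.
have law0 : same_law (mu_ 0) Q id u.
  apply: same_law_sym; apply: (@eq_same_law _ _ _ _ _ _ _ _ _ _
    (fun y => u y + 0 *: v y)); first by move=> y; rewrite scale0r addr0.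
  exact: same_law_sym.
have iv1 := rintegrable_sqr_le mv iv.
pose V1 := \int[Q]_y enorm (v y); pose V := \int[Q]_y (enorm (v y) ^+ 2).
have V10 : 0 <= V1 by apply: Rintegral_ge0 => y _; exact: enorm_ge0.
have V0 : 0 <= V by apply: Rintegral_ge0 => y _; exact: sqr_ge0.
(* The two groups are the errors, in units of [eta], of [DG - t *: J] and of [J - I] below. *)
pose C := B + L * (V1 + 1) + (L * V1 + B).
have C0 : 0 <= C by rewrite !addr_ge0// mulr_ge0// addr_ge0.
(* Bounds the L2 norm of [h] in units of |t|: for eta <= |t| <= 1 the mean square of [h] is at most
   (6 + 4 V) t^2, which is below K0^2 t^2. *)
pose K0 := 3 + 2 * V.
have K00 : 0 < K0 by rewrite ltr_wpDr// mulr_ge0.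
(* The summands are the shares of three errors: replacing [mu_ t] by the law of X + h, the Fréchet
   remainder at [h], and the rounding inside the linear term. *)
have [eps' eps'0 eps'E] : exists2 eps', 0 < eps' & eps' + eps' * K0 + C * eps' = eps.
  have D0 : 0 < 1 + K0 + C by rewrite ltr_wpDr// addr_gt0.
  exists (eps / (1 + K0 + C)); first by rewrite divr_gt0.
  by field; rewrite gt_eqF.
have [deltaF deltaF0 {}hF] := hF eps' eps'0.
exists (Num.min 1 (deltaF / K0)); first by rewrite lt_min ltr01 divr_gt0.
move=> t; rewrite le_min ler_pdivlMr// => /andP[t1 tF].
have [->|t0] := eqVneq t 0.
  by rewrite scale0r subr0 subrr enorm0 normr0 mulr0.
have t_gt0 : 0 < `|t| by rewrite normr_gt0.
have iut : rintegrable Q setT (fun y => enorm (u y + t *: v y) ^+ 2).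
  have [_ mut _] := law_ t.
  apply: (rintegrable_dom _ _ (rintegrableD _ (rintegrableZ _ 2 iu)
    (rintegrableZ _ (2 * t ^+ 2) iv))) => //.
    by apply: measurable_funX; exact: measurable_enorm.
  move=> y _; rewrite ger0_norm ?sqr_ge0//.
  have := enormD (u y) (t *: v y); rewrite enormZ.
  have := enorm_ge0 (u y + t *: v y).
  have := sqr_ge0 (enorm (u y) - `|t| * enorm (v y)).
  by rewrite -[t ^+ 2]real_normK ?num_real//; nra.
have [Dt hDt] := lions_ t.
have [eta1 eta10 hcont] :=
  lions_continuous atomP g_ext (law_ t) iut hDt (mulr_gt0 eps'0 t_gt0).
(* [eta <= |t|] serves the bound on [h], [eta <= eps' * |t|] makes the rounding error of the linear
   term small compared with t, and [2 * eta <= eta1] holds because rounding [u] and [v] moves u + t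
   v by at most (1 + |t|) eta. *)
have [eta [eta0 eta_t eta_e eta_1]] : exists eta,
    [/\ 0 < eta, eta <= `|t|, eta <= eps' * `|t| & 2 * eta <= eta1].
  exists (Num.min `|t| (Num.min (eps' * `|t|) (eta1 / 2))); split.
  - by rewrite !lt_min t_gt0 mulr_gt0//= divr_gt0.
  - by rewrite ge_min lexx.
  - by rewrite !ge_min lexx orbT.
  - by rewrite mulrC -ler_pdivlMr// !ge_min lexx !orbT.
have mX : measurable_fun setT X by exact: measurable_funPT.
have Xu : same_law P Q X u.
  apply: (same_law_trans _ law0); apply: same_law_sym.
  have [_ _ h] := same_law_distribution P X.
  by split => // A mA; rewrite -(Xmu A mA).
have [code [dec [mcode hdec hW]]] := coupled_rounding atomP Xu eta0.
have mw : measurable_fun setT (code \o v) by exact: measurableT_comp.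
have mb : measurable_fun setT (code \o u) by exact: measurableT_comp.
have ma : measurable_fun setT (code \o X) by exact: measurableT_comp.
have {hW} [W mW hW] := hW _ mw.
pose Xr x := dec (code (X x)); pose Z x := dec (W x).
pose ur y := dec (code (u y)); pose vr y := dec (code (v y)).
have mXr : measurable_fun setT Xr.
  exact: (@measurable_fun_nat2 _ _ _ _ (code \o X) W (fun i _ => dec i)).
have mZ : measurable_fun setT Z.
  exact: (@measurable_fun_nat2 _ _ _ _ W W (fun i _ => dec i)).
have mur : measurable_fun setT ur.
  exact: (@measurable_fun_nat2 _ _ _ _ (code \o u) (code \o u) (fun i _ => dec i)).
have mvr : measurable_fun setT vr.
  exact: (@measurable_fun_nat2 _ _ _ _ (code \o v) (code \o v) (fun i _ => dec i)).
have mh : measurable_fun setT (fun x => Xr x + t *: Z x - X x).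
  apply: measurable_submx => //; apply: measurable_addmx => //.
  exact: measurable_scalemx.
pose h := mkmfun mh.
have ivr : rintegrable Q setT (fun y => enorm (vr y) ^+ 2).
  by apply: (rintegrable_close mvr _ iv) => y; exact: hdec.
have ivr1 := rintegrable_sqr_le mvr ivr.
have lawZ : same_law P Q (fun x => enorm (Z x)) (fun y => enorm (vr y)).
  exact: (hW _ _ (fun _ j => enorm (dec j) : R)).
have msq : measurable_fun setT (fun r : R => r ^+ 2) by exact: measurable_funX.
have iZ : rintegrable P setT (fun x => enorm (Z x) ^+ 2).
  exact: (same_law_rintegrable msq (same_law_sym lawZ)).
have iZ1 := rintegrable_sqr_le mZ iZ.
have vr_le y : enorm (vr y) <= enorm (v y) + eta.
  rewrite -[vr y](subrK (v y)) addrC (le_trans (enormD _ _))// lerD2l enormB.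
  exact: hdec.
have EZ : \int[P]_x enorm (Z x) <= V1 + eta.
  rewrite (@same_law_Rintegral _ _ _ _ _ P Q _ _ _ _ id _ lawZ)//.
  rewrite -[X in _ <= _ + X](Rintegral_prob_cst Q) -RintegralD//; last first.
    exact: rintegrable_cst.
  apply: le_Rintegral_prob => //.
  by apply: rintegrableD => //; exact: rintegrable_cst.
have EZ2 : \int[P]_x (enorm (Z x) ^+ 2) <= 2 * V + 2 * eta ^+ 2.
  rewrite (@same_law_Rintegral _ _ _ _ _ P Q _ _ _ _ _ msq lawZ)//.
  rewrite -[X in _ <= _ + X](Rintegral_prob_cst Q) -RintegralZl// -RintegralD//;
    [|exact: rintegrableZ|exact: rintegrable_cst].
  apply: le_Rintegral_prob => //.
    apply: rintegrableD => //; [exact: rintegrableZ|exact: rintegrable_cst].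
  move=> y; have := vr_le y; have := enorm_ge0 (vr y).
  by have := sqr_ge0 (enorm (v y) - eta); nra.
have hle x : enorm (h x) ^+ 2 <= 2 * eta ^+ 2 + 2 * t ^+ 2 * enorm (Z x) ^+ 2.
  have : enorm (h x) <= eta + `|t| * enorm (Z x).
    rewrite /h mkmfunE addrAC -enormZ (le_trans (enormD _ _))// lerD2r enormB.
    exact: hdec.
  have := enorm_ge0 (h x); have := sqr_ge0 (eta - `|t| * enorm (Z x)).
  by rewrite -[t ^+ 2]real_normK ?num_real//; nra.
have ib : rintegrable P setT (fun x => 2 * eta ^+ 2 + 2 * t ^+ 2 * enorm (Z x) ^+ 2).
  by apply: rintegrableD => //; [exact: rintegrable_cst|exact: rintegrableZ].
have ih : rintegrable P setT (fun x => enorm (h x) ^+ 2).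
  apply: (rintegrable_dom _ _ ib) => //.
    by apply: measurable_funX; exact: measurable_enorm.
  by move=> x _; rewrite ger0_norm ?sqr_ge0.
have hL : L2 P h by apply/L2_rintegrable.
have hN : fine (L2norm P h) <= K0 * `|t|.
  apply: L2norm_le => //; first by rewrite mulr_ge0// ltW.
  rewrite (le_trans (le_Rintegral_prob ih ib hle))//.
  rewrite RintegralD//; [|exact: rintegrable_cst|exact: rintegrableZ].
  rewrite Rintegral_prob_cst RintegralZl//.
  have e2 : eta ^+ 2 <= t ^+ 2.
    by rewrite -[t ^+ 2]real_normK ?num_real// ler_sqr ?nnegrE// ltW.
  have t2 : t ^+ 2 <= 1.
    by rewrite -[t ^+ 2]real_normK ?num_real// -[leRHS](expr1n _ 2) ler_sqr ?nnegrE.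
  have t20 := sqr_ge0 t.
  rewrite exprMn real_normK ?num_real// /K0.
  have : 2 * t ^+ 2 * \int[P]_x (enorm (Z x) ^+ 2) <=
      2 * t ^+ 2 * (2 * V + 2 * t ^+ 2).
    apply: ler_wpM2l; first by rewrite mulr_ge0.
    by apply: (le_trans EZ2); rewrite lerD2l ler_wpM2l.
  have : t ^+ 2 * t ^+ 2 <= t ^+ 2 by rewrite ler_piMr.
  have : 0 <= t ^+ 2 * V by rewrite mulr_ge0.
  have : 0 <= t ^+ 2 * (V * V) by apply: mulr_ge0 => //; apply: mulr_ge0.
  by move: (\int[P]_x _) => I; nra.
(* [hcont] expects a function of one natural number, so the two codes are packed into one. *)
pose cw (k : nat) : E :=
  if unpickle k is Some ij then dec (ij : nat * nat).1 + t *: dec ij.2 else 0.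
pose w' y := pickle (code (u y), code (v y)).
have cw' y : cw (w' y) = ur y + t *: vr y by rewrite /cw pickleK.
have mw' : measurable_fun setT w'.
  exact: (@measurable_fun_nat2 _ _ _ _ (code \o u) (code \o v) (fun i j => pickle (i, j))).
have lawXh : same_law (distribution P (addRV X h)) Q id (cw \o w').
  apply: (same_law_trans (same_law_distribution _ _)).
  apply: (@eq_same_law _ _ _ _ _ _ _ _ _ _ (fun x => Xr x + t *: Z x)).
    by move=> x; rewrite /= /addRV mkmfunE addrC subrK.
  apply: same_law_sym; apply: (@eq_same_law _ _ _ _ _ _ _ _ _ _
    (fun y => ur y + t *: vr y)) => //.
  apply: same_law_sym; exact: (hW _ _ (fun i j => dec i + t *: dec j)).
have near : enorm (g (distribution P (addRV X h)) - g (mu_ t)) <= eps' * `|t|.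
  apply: (hcont w' cw) => // y; apply: le_trans eta_1; rewrite cw' opprD addrACA -scalerBr.
  rewrite (le_trans (enormD _ _))// enormZ mulr_natl mulr2n lerD ?hdec//.
  by rewrite (le_trans _ (hdec (v y)))// ler_piMl// enorm_ge0.
have gX : g (distribution P X) = g (mu_ 0).
  have fmu : finite_moment 2 (mu_ 0) by apply/(finite_moment_law 2 law0).
  by apply/esym/g_ext => // A mA; rewrite (Xmu A mA).
have := hF h hL (le_trans hN _); rewrite mulrC gX => /(_ tF) hF'.
set DG := mint P _ _ in hF'.
(* [J] is the bridge between the two spaces: [X] and [Z] are not jointly distributed like [u] and
   [v], but the integrand of [J] depends on the codes alone, and those are. *)
set J := mint P setT (fun x => contr (D (Xr x)) (Z x)).
set I := mint Q setT (fun y => contr (D (u y)) (v y)).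
have mDX : measurable_fun setT (fun x => D (X x)) by exact: measurableT_comp.
have mDXr : measurable_fun setT (fun x => D (Xr x)) by exact: measurableT_comp.
have mDu : measurable_fun setT (fun x => D (u x)) by exact: measurableT_comp.
have mDur : measurable_fun setT (fun x => D (ur x)) by exact: measurableT_comp.
have iJ i j : rintegrable P setT (fun x => contr (D (Xr x)) (Z x) i j).
  exact: rintegrable_contr (fun x => DB _) iZ1.
have iI i j : rintegrable Q setT (fun x => contr (D (u x)) (v x) i j).
  exact: rintegrable_contr (fun x => DB _) iv1.
have iI' i j : rintegrable Q setT (fun x => contr (D (ur x)) (vr x) i j).
  exact: rintegrable_contr (fun x => DB _) ivr1.
have JE : J = mint Q setT (fun y => contr (D (ur y)) (vr y)).
  apply/matrixP => i j; rewrite !mxE.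
  have lawJ := hW _ _ (fun k l => contr (D (dec k)) (dec l) i j : R).
  exact: (@same_law_Rintegral _ _ _ _ _ P Q _ _ _ _ id _ lawJ).
have iDG i j : rintegrable P setT (fun x => contr (D (X x)) (h x) i j).
  exact: (integr h hL i j).
have iJt i j : rintegrable P setT (fun x => (t *: contr (D (Xr x)) (Z x)) i j).
  by apply: eq_rintegrable (rintegrableZ measurableT t (iJ i j)) => x; rewrite mxE.
have DGJ : enorm (DG - t *: J) <= eta * (B + L * (V1 + 1)).
  rewrite /J /DG -mintZ// -mintB//.
  have ibd : rintegrable P setT (fun x => eta * B + eta * (`|t| * L) * enorm (Z x)).
    by apply: rintegrableD => //; [exact: rintegrable_cst|exact: rintegrableZ].
  apply: le_trans (enorm_mint measurableT _ ibd _) _.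
  - move=> i j; apply: eq_rintegrable (rintegrableB measurableT (iDG i j) (iJt i j)).
    by move=> x; rewrite !mxE.
  - move=> x _; rewrite /h mkmfunE addrAC contrDr contrZr -addrA -scalerBr -contrBl.
    rewrite (le_trans (enormD _ _))// enormZ lerD//.
      rewrite (le_trans (enorm_contr _ _))// mulrC ler_pM ?enorm_ge0//.
      by rewrite enormB hdec.
    have -> : eta * (`|t| * L) * enorm (Z x) = `|t| * (L * eta * enorm (Z x)) by ring.
    rewrite ler_wpM2l// (le_trans (enorm_contr _ _))// ler_wpM2r ?enorm_ge0//.
    by rewrite (le_trans (DL _ _))// ler_wpM2l.
  - rewrite RintegralD//; [|exact: rintegrable_cst|exact: rintegrableZ].
    rewrite Rintegral_prob_cst RintegralZl// mulrDr lerD2l -mulrA.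
    apply: ler_wpM2l; first exact: ltW.
    have Z0 : 0 <= \int[P]_x enorm (Z x) by apply: Rintegral_ge0 => x _; exact: enorm_ge0.
    rewrite -mulrA -[leRHS]mul1r; apply: ler_pM => //; first exact: mulr_ge0.
    rewrite ler_wpM2l// (le_trans EZ)// lerD2l.
    exact: le_trans eta_t t1.
have JI : enorm (J - I) <= eta * (L * V1 + B).
  rewrite JE /I -mintB//.
  have ibd : rintegrable Q setT (fun y => eta * L * enorm (v y) + eta * B).
    by apply: rintegrableD => //; [exact: rintegrableZ|exact: rintegrable_cst].
  apply: le_trans (enorm_mint measurableT _ ibd _) _.
  - move=> i j; apply: eq_rintegrable (rintegrableB measurableT (iI' i j) (iI i j)).
    by move=> x; rewrite !mxE.
  - move=> y _.
    have -> : contr (D (ur y)) (vr y) - contr (D (u y)) (v y) =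
        contr (D (ur y) - D (u y)) (v y) + contr (D (ur y)) (vr y - v y).
      by rewrite contrBl contrBr [RHS]addrC addrA subrK.
    rewrite (le_trans (enormD _ _))// lerD//.
      rewrite (le_trans (enorm_contr _ _))// ler_wpM2r ?enorm_ge0//.
      by rewrite (le_trans (DL _ _))// mulrC ler_wpM2r// enormB hdec.
    rewrite (le_trans (enorm_contr _ _))// mulrC ler_pM ?enorm_ge0//.
    by rewrite enormB hdec.
  - rewrite RintegralD//; [|exact: rintegrableZ|exact: rintegrable_cst].
    by rewrite Rintegral_prob_cst RintegralZl// mulrDr mulrA.
have -> : g (mu_ t) - g (mu_ 0) - t *: I =
    (g (mu_ t) - g (distribution P (addRV X h))) +
    (g (distribution P (addRV X h)) - g (mu_ 0) - DG) +
    ((DG - t *: J) + t *: (J - I)).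
  by rewrite scalerBr; apply/matrixP => i j; rewrite !mxE; ring.
rewrite (le_trans (enormD _ _))// -eps'E 2!mulrDl; apply: lerD.
  rewrite (le_trans (enormD _ _))// lerD//; first by rewrite enormB.
  by rewrite (le_trans hF')// -mulrA ler_wpM2l// ltW.
rewrite (le_trans (enormD _ _))// enormZ.
apply: (@le_trans _ _ (eta * C)).
  rewrite /C [leRHS]mulrDr; apply: lerD; first exact: DGJ.
  by apply: le_trans JI; rewrite ler_piMl// enorm_ge0.
by rewrite mulrC -mulrA ler_wpM2l.
Qed.

End lions_chain_rule.

(** * Iterated integrals *)

Section sum_power.
Context {R : realType}.

Lemma exprD_le (x y : R) q : 0 <= x -> 0 <= y ->
  (x + y) ^+ q <= 2 ^+ q * (x ^+ q + y ^+ q).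
Proof.
move=> x0 y0.
wlog xy : x y x0 y0 / x <= y.
  move=> h; have [xy|/ltW yx] := leP x y; first exact: h.
  by rewrite addrC [in leRHS]addrC; exact: h.
rewrite (@le_trans _ _ ((2 * y) ^+ q))//.
  by rewrite lerXn2r ?nnegrE ?addr_ge0 ?mulr_ge0//; lra.
by rewrite exprMn ler_wpM2l ?exprn_ge0// lerDr exprn_ge0.
Qed.

(** The summand [0 ^+ q] vanishes unless q = 0, when it is 1; it keeps the bound true for m = q = 0,
    where the left side is 0 ^+ 0 = 1. *)
Lemma exprn_sum_le {m} (x : 'I_m -> R) q : (forall i, 0 <= x i) ->
  (\sum_i x i) ^+ q <= m%:R ^+ q * (0 ^+ q + \sum_i x i ^+ q).
Proof.
move=> x0; case: m x x0 => [|m] x x0.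
  by rewrite !big_ord0 addr0; case: q => [|q]; rewrite ?expr0 ?mulr1// !expr0n mul0r.
have [k /= hk] : exists k, forall i, x i <= x k.
  by exists [arg max_(i > ord0) x i]%O; case: arg_maxP => // i _ h j; exact: h.
rewrite (@le_trans _ _ ((m.+1%:R * x k) ^+ q))//.
  rewrite lerXn2r ?nnegrE ?sumr_ge0 ?mulr_ge0// mulr_natl.
  by rewrite -[X in _ *+ X]card_ord -sumr_const; apply: ler_sum => i _; exact: hk.
rewrite exprMn ler_wpM2l ?exprn_ge0// ler_wpDl ?exprn_ge0//.
rewrite (bigD1 k)//= lerDl; apply: sumr_ge0 => i _; exact: exprn_ge0.
Qed.

End sum_power.

Section tuples.
Context {T : Type}.

Lemma tnth_rcons_widen {m} (x : m.-tuple T) v (i : 'I_m) :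
  tnth (rcons_tuple x v) (widen_ord (leqnSn m) i) = tnth x i.
Proof. by rewrite !(tnth_nth v) /= nth_rcons size_tuple ltn_ord. Qed.

Lemma tnth_rcons_max {m} (x : m.-tuple T) v : tnth (rcons_tuple x v) ord_max = v.
Proof. by rewrite (tnth_nth v) /= nth_rcons size_tuple ltnn eqxx. Qed.

End tuples.

(** * Independent copies of the coupling and Fubini's theorem *)

Section power_measure.
Context {dz} {Z : measurableType dz} {R : realType} (Pi : probability Z R).

Definition rcons_pair {m} (y : m.-tuple Z * Z) : m.+1.-tuple Z :=
  rcons_tuple y.1 y.2.

Lemma measurable_rcons {d} {T : measurableType d} {m} (f : T -> m.-tuple Z)
    (h : T -> Z) : measurable_fun setT f -> measurable_fun setT h ->
  measurable_fun setT (fun x => rcons_tuple (f x) (h x)).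
Proof.
move=> mf mh; apply/measurable_fun_tnthP => i /=.
case: (unliftP ord_max i) => [j ->|->].
  rewrite (_ : _ \o _ = fun x => tnth (f x) j); last first.
    apply/funext => x /=; rewrite -(tnth_rcons_widen (f x) (h x)); congr tnth.
    by apply/val_inj => /=; rewrite /bump leqNgt ltn_ord.
  exact: (measurableT_comp (measurable_tnth j) mf).
rewrite (_ : _ \o _ = h)//.
by apply/funext => x /=; rewrite tnth_rcons_max.
Qed.

Lemma measurable_rcons_pair {m} : measurable_fun setT (@rcons_pair m).
Proof. by apply: measurable_rcons. Qed.

HB.instance Definition _ m := isMeasurableFun.Build _ _ _ _ (@rcons_pair m)
  (@measurable_rcons_pair m).

(** The last coordinate is split off, as in [iint], so that one use of Fubini's theorem matches one
    step of either recursion. *)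
Fixpoint powm (m : nat) : probability (m.-tuple Z) R :=
  if m is m'.+1 return probability (m.-tuple Z) R
  then distribution (powm m' \x Pi)%E (@rcons_pair m')
  else \d_[tuple].

Lemma same_law_powmS m :
  same_law (powm m.+1) (powm m \x Pi)%E id (@rcons_pair m).
Proof. exact: same_law_distribution. Qed.

Lemma same_law_tnth m (i : 'I_m) : same_law (powm m) Pi (fun x => tnth x i) id.
Proof.
elim: m i => [[]//|m IH] i; split => //; first exact: measurable_tnth.
move=> A mA; have mi : measurable ((fun x : m.+1.-tuple Z => tnth x i) @^-1` A).
  by rewrite -[X in measurable X]setTI; exact: measurable_tnth.
have [_ _ h] := same_law_powmS m; apply: (etrans (h _ mi)) => {h}.
case: (unliftP ord_max i) mi => [j ->|->] _.
  rewrite (_ : _ @^-1` _ = ((fun x : m.-tuple Z => tnth x j) @^-1` A) `*` setT).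
    have mj : measurable ((fun x : m.-tuple Z => tnth x j) @^-1` A).
      by rewrite -[X in measurable X]setTI; exact: measurable_tnth.
    rewrite /= product_measure1E//= probability_setT mule1.
    by have [_ _ ->] := IH j.
  apply/seteqP; rewrite /rcons_pair; split => -[x z] /=.
    rewrite -(tnth_rcons_widen x z) => h; split => //; move: h; congr A.
    by congr tnth; apply/val_inj; rewrite /= /bump leqNgt ltn_ord.
  rewrite -(tnth_rcons_widen x z) => -[h _]; move: h; congr A.
  by congr tnth; apply/val_inj; rewrite /= /bump leqNgt ltn_ord.
rewrite (_ : _ @^-1` _ = setT `*` A).
  by rewrite /= product_measure1E//= probability_setT mul1e.
apply/seteqP; rewrite /rcons_pair; split => -[x z] /=; rewrite tnth_rcons_max => //.
by case.
Qed.

Variables (w : Z -> R) (q : nat).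
Hypotheses (w_ge0 : forall z, 0 <= w z) (mw : measurable_fun setT w).
Hypothesis iw : rintegrable Pi setT (fun z => w z ^+ q).

Definition wsum {m} (x : m.-tuple Z) : R := \sum_(i < m) w (tnth x i).

Lemma wsum_ge0 {m} (x : m.-tuple Z) : 0 <= wsum x.
Proof. exact: sumr_ge0. Qed.

Lemma wsum_rcons {m} (x : m.-tuple Z) z : wsum (rcons_tuple x z) = wsum x + w z.
Proof.
rewrite /wsum big_ord_recr/= tnth_rcons_max; congr (_ + _).
by apply: eq_bigr => i _; rewrite tnth_rcons_widen.
Qed.

Lemma measurable_wsum {m} : measurable_fun setT (@wsum m).
Proof.
apply: measurable_sum => i.
exact: (measurableT_comp mw (measurable_tnth i)).
Qed.

(** The offset [c] makes the notion stable under freezing a variable, whose weight is simply added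
    to [c]. *)
Definition tame {m} (F : m.-tuple Z -> R) : Prop :=
  measurable_fun setT F /\
  exists C c : R, [/\ 0 <= C, 0 <= c & forall x, `|F x| <= C * (c + wsum x) ^+ q].

Lemma rintegrable_wpow m (i : 'I_m) :
  rintegrable (powm m) setT (fun x => w (tnth x i) ^+ q).
Proof.
have mq : measurable_fun setT (fun z => w z ^+ q) by exact: measurable_funX.
exact: (same_law_rintegrable mq (same_law_sym (same_law_tnth i))).
Qed.

Lemma Rintegral_wpow m (i : 'I_m) :
  \int[powm m]_x (w (tnth x i) ^+ q) = \int[Pi]_z (w z ^+ q).
Proof.
have mq : measurable_fun setT (fun z => w z ^+ q) by exact: measurable_funX.
exact: (same_law_Rintegral mq (same_law_tnth i)).
Qed.

Lemma tame_rintegrable {m} (F : m.-tuple Z -> R) :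
  tame F -> rintegrable (powm m) setT F.
Proof.
move=> [mF [C [c [C0 c0 hF]]]].
apply: (@rintegrable_dom _ _ _ _ _ _ _ (fun x =>
  C * (2 ^+ q * (c ^+ q + m%:R ^+ q * (0 ^+ q + \sum_(i < m) w (tnth x i) ^+ q))))) => //.
  do 2!apply: rintegrableZ => //; apply: rintegrableD => //.
    exact: rintegrable_cst.
  apply: rintegrableZ => //; apply: rintegrableD => //; first exact: rintegrable_cst.
  by apply: rintegrable_sum => // i; exact: rintegrable_wpow.
move=> x _; rewrite (le_trans (hF x))// ler_wpM2l//.
rewrite (le_trans (exprD_le q c0 (wsum_ge0 x)))// ler_wpM2l ?exprn_ge0// lerD2l.
exact: exprn_sum_le.
Qed.

Lemma tame_slice {m} (F : m.+1.-tuple Z -> R) z :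
  tame F -> tame (fun x => F (rcons_tuple x z)).
Proof.
move=> [mF [C [c [C0 c0 hF]]]]; split.
  apply: (measurableT_comp mF); exact: measurable_rcons.
exists C, (c + w z); split => //; first exact: addr_ge0.
by move=> x; rewrite -addrA [w z + _]addrC -wsum_rcons.
Qed.

Lemma tame_rintegrable_last {m} (F : m.+1.-tuple Z -> R) x :
  tame F -> rintegrable Pi setT (fun z => F (rcons_tuple x z)).
Proof.
move=> [mF [C [c [C0 c0 hF]]]].
apply: (@rintegrable_dom _ _ _ _ _ _ _ (fun z =>
  C * (2 ^+ q * ((c + wsum x) ^+ q + w z ^+ q)))) => //.
- apply: (measurableT_comp mF); exact: measurable_rcons.
- do 2!apply: rintegrableZ => //; apply: rintegrableD => //.
  exact: rintegrable_cst.
move=> z _; rewrite (le_trans (hF _))// ler_wpM2l// wsum_rcons addrA.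
by apply: exprD_le => //; rewrite addr_ge0// wsum_ge0.
Qed.

Lemma tame_product {m} (F : m.+1.-tuple Z -> R) : tame F ->
  rintegrable (powm m \x Pi)%E setT (fun y => F (rcons_tuple y.1 y.2)).
Proof.
move=> tF; have [mF _] := tF.
exact: (same_law_rintegrable mF (same_law_powmS m) (tame_rintegrable tF)).
Qed.

(** Integrating the newest variable first is the order in which the Lions derivative creates it: a
    function of m variables, itself an integral over one more. *)
Lemma tame_fubini_in {m} (F : m.+1.-tuple Z -> R) : tame F ->
  \int[powm m.+1]_x F x = \int[powm m]_x (\int[Pi]_z F (rcons_tuple x z)).
Proof.
move=> tF; have [mF _] := tF; have iF := tame_product tF.
rewrite (same_law_Rintegral mF (same_law_powmS m)) /Rintegral.
have := integral12_prod_meas1 iF; rewrite /= => <-; congr fine.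
apply: eq_integral => x _; rewrite fineK//.
exact: (integrable_fin_num measurableT (tame_rintegrable_last x tF)).
Qed.

(** This is the order of integration in [iint]. *)
Lemma tame_fubini_out {m} (F : m.+1.-tuple Z -> R) : tame F ->
  \int[powm m.+1]_x F x = \int[Pi]_z (\int[powm m]_x F (rcons_tuple x z)).
Proof.
move=> tF; have [mF _] := tF; have iF := tame_product tF.
rewrite (same_law_Rintegral mF (same_law_powmS m)) /Rintegral.
have := integral21_prod_meas1 iF; rewrite /= => <-; congr fine.
apply: eq_integral => z _; rewrite fineK//.
exact: (integrable_fin_num measurableT (tame_rintegrable (tame_slice z tF))).
Qed.

Lemma rintegrable_fubini_in {m} (F : m.+1.-tuple Z -> R) : tame F ->
  rintegrable (powm m) setT (fun x => \int[Pi]_z F (rcons_tuple x z)).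
Proof.
move=> tF; have iF := tame_product tF.
have := integrable_fubini_F iF; congr (integrable _ _ _).
apply/funext => x /=; rewrite /Rintegral fineK//.
exact: (integrable_fin_num measurableT (tame_rintegrable_last x tF)).
Qed.

End power_measure.

Lemma iint_powm {R : realType} {e : nat}
    (Pi : probability ('rV[R]_e * 'rV[R]_e)%type R) (w : 'rV[R]_e * 'rV[R]_e -> R)
    (r : nat) : (forall z, 0 <= w z) -> measurable_fun setT w ->
  rintegrable Pi setT (fun z => w z ^+ r) ->
  forall p q m (F : m.-tuple ('rV[R]_e * 'rV[R]_e) -> 'M[R]_(p, q)),
    (forall i j, tame w r (fun x => F x i j)) ->
    iint Pi F = mint (powm Pi m) setT F.
Proof.
move=> w0 mw iw p q; elim=> [|m IH] F tF.
  apply/matrixP => i j; rewrite mxE /Rintegral /=.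
  have [mF _] := tF i j.
  rewrite integral_dirac//=; last exact/measurable_EFinP.
  by rewrite indicT mul1r.
apply/matrixP => i j; rewrite [LHS]/= !mxE (tame_fubini_out w0 mw iw (tF i j)).
apply: eq_Rintegral => z _; rewrite IH ?mxE// => k l.
exact: tame_slice (tF k l).
Qed.

(** * Real functions of several variables with Lipschitz partial derivatives *)

Section real_taylor.
Context {R : realType}.

Lemma mean_value (f f' : R -> R) (a b : R) : (forall x : R, is_derive x 1 f (f' x)) ->
  exists2 c, `|c - a| <= `|b - a| & f b - f a = f' c * (b - a).
Proof.
move=> df; have cf x y : {within `[x, y], continuous f}.
  by apply: derivable_within_continuous => z _; case: (df z).
have [ab|ba] := leP a b.
  have [c] := MVT_segment ab (fun x _ => df x) (cf a b).
  rewrite in_itv/= => /andP[ac cb] E; exists c => //.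
  by rewrite !ger0_norm ?subr_ge0// lerD2r.
have [c] := MVT_segment (ltW ba) (fun x _ => df x) (cf b a).
rewrite in_itv/= => /andP[bc ca] E; exists c.
  by rewrite !ler0_norm ?subr_le0 ?(ltW ba)// lerN2 lerD2r.
by rewrite -opprB E -mulrN opprB.
Qed.

Definition upd {I : eqType} (s : I -> R) (i : I) (r : R) : I -> R :=
  fun j => if j == i then r else s j.

(** The coordinates are moved one at a time. The mean value theorem evaluates each partial
    derivative at a point whose coordinates differ from [x] by at most |t|, an error of K N |t| for
    each of the N moves of length |t|. *)
Lemma lipschitz_partials_expansion (N : nat) (H : ('I_N -> R) -> R)
    (DH : 'I_N -> ('I_N -> R) -> R) (K x t : R) : 0 <= K ->
  (forall i s (r : R), is_derive r 1 (fun r => H (upd s i r)) (DH i (upd s i r))) ->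
  (forall i s s', `|DH i s - DH i s'| <= K * \sum_j `|s j - s' j|) ->
  `|H (fun _ => x + t) - H (fun _ => x) - t * \sum_i DH i (fun _ => x)| <=
    K * N%:R ^+ 2 * t ^+ 2.
Proof.
(* [p k] has its first [k] coordinates moved already. *)
move=> K0 dH lH; pose p (k : nat) (i : 'I_N) := if (i < k)%N then x + t else x.
have pN : p N = fun _ => x + t by apply/funext => i; rewrite /p ltn_ord.
have p0 : p 0 = fun _ => x by apply/funext => i.
have pS (k : 'I_N) : p k.+1 = upd (p k) k (x + t).
  apply/funext => i; rewrite /p /upd ltnS leq_eqVlt.
  by rewrite (inj_eq val_inj); case: eqP.
have pk (k : 'I_N) : p k = upd (p k) k x.
  apply/funext => i; rewrite /p /upd; case: eqP => // ->.
  by rewrite ltnn.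
have -> : H (fun _ => x + t) - H (fun _ => x) =
    \sum_(k < N) (H (p k.+1) - H (p k)).
  rewrite -pN -p0 -(telescope_sumr (fun k => H (p k)))// big_mkord.
  by [].
rewrite mulr_sumr -sumrB (le_trans (ler_norm_sum _ _ _))//.
rewrite (@le_trans _ _ (\sum_(k < N) (K * N%:R * t ^+ 2)))//; last first.
  rewrite sumr_const card_ord (_ : K * N%:R * t ^+ 2 *+ N = K * N%:R ^+ 2 * t ^+ 2)//.
  by rewrite -[LHS]mulr_natr; ring.
apply: ler_sum => k _.
have [c] := @mean_value (fun r => H (upd (p k) k r))
  (fun r => DH k (upd (p k) k r)) x (x + t) (fun r => dH k (p k) r).
rewrite -pS -pk [x + t - x]addrAC subrr add0r => ct ->.
rewrite [_ * t]mulrC -mulrBr normrM -[t ^+ 2]real_normK ?num_real//.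
have -> : K * N%:R * `|t| ^+ 2 = `|t| * (K * (N%:R * `|t|)) by ring.
rewrite ler_wpM2l// (le_trans (lH _ _ _))// ler_wpM2l// mulr_natl.
rewrite -[X in _ <= _ *+ X]card_ord -sumr_const.
apply: ler_sum => i _; rewrite /upd /p; case: eqP => // _.
by case: ifP => _; [rewrite addrAC subrr add0r|rewrite subrr normr0].
Qed.

Lemma is_derive_expansion (f : R -> R) (x l : R) :
  (forall eps, 0 < eps -> exists2 delta, 0 < delta & forall t, `|t| <= delta ->
    `|f (x + t) - f x - t * l| <= eps * `|t|) -> is_derive x 1 f l.
Proof.
move=> hf; suff cvg_f : h^-1 *: ((f \o shift x) (h *: 1) - f x) @[h --> 0^'] --> l.
  by apply: DeriveDef; [apply/cvg_ex; exists l|exact: cvg_lim cvg_f].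
apply/cvgrPdist_le => eps eps0; have [delta delta0 {}hf] := hf eps eps0.
near=> h; have h0 : h != 0 by near: h; exact: nbhs_dnbhs_neq.
have hd : `|h| <= delta.
  by near: h; apply: dnbhs0_le.
have /= := hf h hd; rewrite [h *: 1]mulr1 -[h + x]addrC => E.
rewrite -(ler_pM2r (_ : 0 < `|h|)) ?normr_gt0// (le_trans _ E)//.
rewrite -normrM distrC mulrBl -[_ *: _ * h]mulrAC mulVf// mul1r.
by rewrite [l * h]mulrC.
Unshelve. all: by end_near. Qed.

Lemma is_derive_line {p q p' q'} (F : 'M[R]_(p, q) -> 'M[R]_(p', q'))
    (a v : 'M[R]_(p, q)) (r : R) (L : 'M[R]_(p, q) -> 'M[R]_(p', q')) i j :
  is_diff (a + r *: v) F L ->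
  is_derive r 1 (fun s => F (a + s *: v) i j) (L v i j).
Proof.
move=> [dF dFL].
have dl : is_diff r (fun s : R => a + s *: v) (fun s => s *: v).
  have := is_diffD (is_diff_cst a r) (is_diff_scalel r v).
  by rewrite add0r.
have dl' : differentiable (fun s : R => a + s *: v) r by case: dl.
have dc : differentiable (F \o (fun s : R => a + s *: v)) r.
  exact: differentiable_comp.
have dd : derivable (F \o (fun s : R => a + s *: v)) r 1 by exact/derivable1_diffP.
apply: DeriveDef; first exact: (derivable_mxP _ _ _).1 dd i j.
have := derive_mx dd; rewrite deriveE// diff_comp// => /matrixP/(_ i j).
rewrite [RHS]mxE => <- /=.
by rewrite dFL; have [_ ->] := dl; rewrite scale1r.
Qed.

End real_taylor.

(** * The Wasserstein distance and the interpolated measures *)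

Section wasserstein.
Context {R : realType} {e : nat}.
Local Notation E := 'rV[R]_e.
Context {d} {S : measurableType d} (Q : probability S R).

(** Two random variables on a common space give a competitor in the infimum, namely their joint
    law. *)
Lemma W1_le (M N : probability E R) (u u' : S -> E) :
  same_law M Q id u -> same_law N Q id u' ->
  rintegrable Q setT (fun y => enorm (u' y - u y)) ->
  (W1 M N <= (\int[Q]_y enorm (u' y - u y))%:E)%E.
Proof.
move=> [_ mu hM] [_ mu' hN] iu.
have mp : measurable_fun setT (fun y => (u y, u' y)) by exact: measurable_fun_pair.
have law : same_law (distribution Q (mkmfun mp)) Q id (fun y => (u y, u' y)).
  exact: same_law_distribution.
have mdist : measurable_fun setT (fun z : E * E => (enorm (z.2 - z.1))%:E).
  apply/measurable_EFinP; apply: measurable_enorm; apply: measurable_submx.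
    exact: measurable_snd.
  exact: measurable_fst.
apply: ereal_inf_lbound; exists (distribution Q (mkmfun mp)) => /=.
  move=> A mA; have [_ _ h] := law; split.
    rewrite (h (A `*` setT) (measurableX mA measurableT)) (hM A mA).
    by congr (Q _); apply/seteqP; split => [y /= []|y /=].
  rewrite (h (setT `*` A) (measurableX measurableT mA)) (hN A mA).
  by congr (Q _); apply/seteqP; split => [y /= []|y /=].
rewrite (same_law_ge0_integral mdist _ law)//.
  by rewrite /Rintegral fineK//; exact: integrable_fin_num.
by move=> z; rewrite lee_fin enorm_ge0.
Qed.

End wasserstein.

Lemma W1_measure_eq {R : realType} {e : nat} (M N : probability 'rV[R]_e R) :
  M ≡μ N -> (W1 M N <= 0)%E.
Proof.
move=> MN; have lM : same_law M M id id by split.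
have lN : same_law N M id id by split => // A mA; rewrite (MN A mA).
have E0 : (fun y : 'rV[R]_e => enorm (id y - id y)) = cst 0.
  by apply/funext => y; rewrite subrr enorm0.
have := W1_le lM lN; rewrite E0 Rintegral_prob_cst; apply.
exact: rintegrable_cst.
Qed.

Section coupling.
Context {R : realType} {e : nat} (Pi : probability ('rV[R]_e * 'rV[R]_e)%type R).
Local Notation E := 'rV[R]_e.
Local Notation Z := (E * E)%type.

Definition incr (z : Z) : E := z.2 - z.1.
Definition dist (z : Z) : R := enorm (incr z).

Lemma measurable_incr : measurable_fun setT incr.
Proof.
by apply: measurable_submx; [exact: measurable_snd|exact: measurable_fst].
Qed.

Lemma measurable_dist : measurable_fun setT dist.
Proof. by apply: measurable_enorm; exact: measurable_incr. Qed.

Lemma dist_ge0 z : 0 <= dist z.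
Proof. exact: enorm_ge0. Qed.

Lemma interpD r t z : interp (r + t) z = interp r z + t *: incr z.
Proof. by rewrite /interp scalerDl addrA. Qed.

Lemma interp0 (z : Z) : interp 0 z = z.1.
Proof. by rewrite /interp scale0r addr0. Qed.

Lemma interp1 (z : Z) : interp 1 z = z.2.
Proof. by rewrite /interp scale1r addrC subrK. Qed.

Lemma enorm_interpB r t z : enorm (interp r z - interp t z) = `|r - t| * dist z.
Proof.
by rewrite -[r in LHS](subrK t) [r - t + t]addrC interpD addrAC subrr add0r enormZ.
Qed.

Lemma same_law_interp r : same_law (joint_interp Pi r) Pi id (interp r).
Proof. exact: same_law_distribution. Qed.

Context (n : nat) (n_gt0 : (0 < n)%N) (mu nu : probability E R).
Hypotheses (mom_mu : finite_moment n.+1 mu) (mom_nu : finite_moment n.+1 nu).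
Hypothesis joint_Pi : joint Pi mu nu.

Lemma same_law_fst : same_law mu Pi id fst.
Proof.
split; [exact: measurable_id|exact: measurable_fst|] => A mA.
rewrite -(joint_Pi mA).1; congr (Pi _).
by apply/seteqP; split => [z /= []|z /=].
Qed.

Lemma same_law_snd : same_law nu Pi id snd.
Proof.
split; [exact: measurable_id|exact: measurable_snd|] => A mA.
rewrite -(joint_Pi mA).2; congr (Pi _).
by apply/seteqP; split => [z /= []|z /=].
Qed.

Lemma expr_le_1D (x : R) p q : 0 <= x -> (p <= q)%N -> x ^+ p <= 1 + x ^+ q.
Proof.
move=> x0 pq; have [x1|/ltW x1] := leP x 1.
  by rewrite (le_trans (exprn_ile1 _ x0 x1))// lerDl exprn_ge0.
by rewrite (le_trans (ler_weXn2l x1 pq))// lerDr.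
Qed.

Lemma rintegrable_lower {d'} {T : measurableType d'} (P : probability T R)
    (h : T -> R) p q : measurable_fun setT h -> (forall x, 0 <= h x) ->
  (p <= q)%N -> rintegrable P setT (fun x => h x ^+ q) ->
  rintegrable P setT (fun x => h x ^+ p).
Proof.
move=> mh h0 pq iq.
apply: (rintegrable_dom _ _ (rintegrableD _ (rintegrable_cst P 1) iq)) => //.
  exact: measurable_funX.
by move=> x _; rewrite ger0_norm ?exprn_ge0// expr_le_1D.
Qed.

Lemma rintegrable_dist p : (p <= n.+1)%N -> rintegrable Pi setT (fun z => dist z ^+ p).
Proof.
move=> pn; apply: (rintegrable_lower measurable_dist dist_ge0 pn).
have i1 := (finite_moment_law n.+1 same_law_fst).1 mom_mu.
have i2 := (finite_moment_law n.+1 same_law_snd).1 mom_nu.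
apply: (rintegrable_dom _ _ (rintegrableZ _ (2 ^+ n.+1) (rintegrableD _ i2 i1))) => //.
  by apply: measurable_funX; exact: measurable_dist.
move=> z _; rewrite ger0_norm ?exprn_ge0 ?dist_ge0//.
rewrite (le_trans _ (exprD_le _ (enorm_ge0 _) (enorm_ge0 _)))//.
rewrite lerXn2r ?nnegrE ?addr_ge0 ?enorm_ge0//.
by rewrite /dist /incr (le_trans (enormD _ _))// enormN.
Qed.

Lemma rintegrable_dist1 : rintegrable Pi setT dist.
Proof. by have := rintegrable_dist (ltn0Sn n). Qed.

Lemma rintegrable_dist2 : rintegrable Pi setT (fun z => dist z ^+ 2).
Proof. exact: rintegrable_dist. Qed.

Definition mean_dist : R := \int[Pi]_z dist z.

Lemma mean_dist_ge0 : 0 <= mean_dist.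
Proof. by apply: Rintegral_ge0 => z _; exact: dist_ge0. Qed.

Lemma rintegrable_interp r : rintegrable Pi setT (fun z => enorm (interp r z) ^+ 2).
Proof.
have i1 := (finite_moment_law n.+1 same_law_fst).1 mom_mu.
have i2 : rintegrable Pi setT (fun z : Z => enorm z.1 ^+ 2).
  apply: rintegrable_lower i1 => //; last by move=> z; exact: enorm_ge0.
  by apply: measurable_enorm; exact: measurable_fst.
apply: (rintegrable_dom _ _ (rintegrableZ _ (2 ^+ 2) (rintegrableD _ i2
  (rintegrableZ _ (`|r| ^+ 2) rintegrable_dist2)))) => //.
  by apply: measurable_funX; apply: measurable_enorm; exact: measurable_interp.
move=> z _; rewrite ger0_norm ?sqr_ge0// -exprMn.
rewrite (le_trans _ (exprD_le _ (enorm_ge0 _) (mulr_ge0 _ (dist_ge0 _))))//.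
rewrite lerXn2r ?nnegrE ?addr_ge0 ?mulr_ge0 ?enorm_ge0//.
by rewrite /interp (le_trans (enormD _ _))// enormZ.
Qed.

Lemma moment_mu : finite_moment 2 mu.
Proof.
apply/(finite_moment_law 2 same_law_fst).
have := rintegrable_interp 0; congr (integrable _ _ _); apply/funext => z /=.
by rewrite interp0.
Qed.

Lemma moment_nu : finite_moment 2 nu.
Proof.
apply/(finite_moment_law 2 same_law_snd).
have := rintegrable_interp 1; congr (integrable _ _ _); apply/funext => z /=.
by rewrite interp1.
Qed.

Lemma interp0_law : mu ≡μ joint_interp Pi 0.
Proof.
apply: same_law_measure_eq same_law_fst _; apply: same_law_sym.
apply: (@eq_same_law _ _ _ _ _ _ _ _ _ _ (interp 0)).
  by move=> z; rewrite interp0.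
exact: same_law_sym (same_law_interp 0).
Qed.

Lemma interp1_law : nu ≡μ joint_interp Pi 1.
Proof.
apply: same_law_measure_eq same_law_snd _; apply: same_law_sym.
apply: (@eq_same_law _ _ _ _ _ _ _ _ _ _ (interp 1)).
  by move=> z; rewrite interp1.
exact: same_law_sym (same_law_interp 1).
Qed.

End coupling.

Lemma W1_ge0 {R : realType} {e : nat} (M N : probability 'rV[R]_e R) :
  (0 <= W1 M N)%E.
Proof.
apply: le_ereal_inf_tmp => _ [Q _ <-]; apply: integral_ge0 => z _.
by rewrite lee_fin enorm_ge0.
Qed.

(** * Partition sequences *)

Section partition_sequences.

Lemma maxseq_rcons (a : seq nat) i : maxseq (rcons a i) = maxn (maxseq a) i.
Proof. by rewrite /maxseq -cats1 big_cat/= big_seq1. Qed.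

Lemma maxseq_nth (a : seq nat) : maxseq a = (\max_(l < size a) nth 0 a l)%N.
Proof. by rewrite /maxseq (big_nth 0%N) big_mkord. Qed.

(** For empty [a] the range is 0 < i <= 1, which encodes the condition a_1 = 1. A sequence with
    maximum m thus has exactly m + 1 extensions. *)
Lemma pseq_rcons (a : seq nat) i :
  pseq (rcons a i) = pseq a && (0 < i <= (maxseq a).+1)%N.
Proof.
have nthr k : (k < size a)%N -> nth 0%N (rcons a i) k = nth 0%N a k.
  by move=> ka; rewrite nth_rcons ka.
have maxr k : (k <= size a)%N ->
    (\max_(l < k) nth 0 (rcons a i) l = \max_(l < k) nth 0 a l)%N.
  by move=> ka; apply: eq_bigr => l _; rewrite nthr// (leq_trans (ltn_ord l)).
rewrite /pseq all_rcons nth_rcons; apply/idP/idP.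
  move=> /and3P[/andP[i1 alla] a0 /forallP h].
  rewrite alla i1 /= -andbA; apply/and3P; split.
  - by case: a a0 {nthr maxr h alla} => //= ? ?; rewrite eqxx.
  - apply/forallP => k; apply/implyP => k0.
    have ks : (k < size (rcons a i))%N by rewrite size_rcons ltnS ltnW.
    have := implyP (h (Ordinal ks)) k0.
    by rewrite /= nthr// maxr// ltnW.
  - have [a0'|a_gt0] := posnP (size a).
      by move: a0; rewrite a0' /= => /eqP ->.
    have ks : (size a < size (rcons a i))%N by rewrite size_rcons.
    have := implyP (h (Ordinal ks)) a_gt0.
    by rewrite /= maxr// -maxseq_nth nth_rcons ltnn eqxx add1n.
move=> /andP[/and3P[alla a0 /forallP h] /andP[i1 im]].
rewrite alla i1 /=; apply/andP; split.
  case: a a0 im {nthr maxr h alla} => //= _; rewrite /maxseq big_nil => im.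
  by rewrite eqn_leq im i1.
apply/forallP => k; apply/implyP => k0.
have := ltn_ord k; rewrite {2}size_rcons ltnS leq_eqVlt => /predU1P[ke|ka].
  by rewrite ke maxr// -maxseq_nth nth_rcons ltnn eqxx add1n.
rewrite nthr// maxr; last exact: ltnW.
exact: (implyP (h (Ordinal ka)) k0).
Qed.

Lemma maxseq_rcons_le (a : seq nat) i : (i <= maxseq a)%N ->
  maxseq (rcons a i) = maxseq a.
Proof. by move=> im; rewrite maxseq_rcons; apply/maxn_idPl. Qed.

Lemma maxseq_rcons_new (a : seq nat) :
  maxseq (rcons a (maxseq a).+1) = (maxseq a).+1.
Proof. by rewrite maxseq_rcons; apply/maxn_idPr. Qed.

Lemma pseq_tuple0 (a : 0.-tuple nat) : pseq a.
Proof.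
by rewrite (tuple0 a) /pseq /=; apply/forallP => -[].
Qed.

Lemma maxseq_tuple0 (a : 0.-tuple nat) : maxseq a = 0%N.
Proof. by rewrite (tuple0 a) /maxseq big_nil. Qed.

Lemma pseqs0 : pseqs 0 = [:: [tuple]].
Proof.
have := pseqs_uniq 0; have : [tuple] \in pseqs 0 by rewrite mem_pseqs pseq_tuple0.
by case: (pseqs 0) => [//|a [|b s]]; rewrite (tuple0 a)// (tuple0 b)/= inE eqxx.
Qed.

(** Grouping by the prefix matches the derivative of a term of order k: m old letters from the space
    variables and the letter m + 1 from the measure. *)
Lemma sum_pseqsS (V : nmodType) k (G : k.+1.-tuple nat -> V) :
  \sum_(b <- pseqs k.+1) G b =
  \sum_(a <- pseqs k) \sum_(j < (maxseq a).+1) G (rcons_tuple a j.+1).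
Proof.
transitivity (\sum_(b <- [seq rcons_tuple a j.+1 | a <- pseqs k,
    j <- iota 0 (maxseq a).+1]) G b); last first.
  rewrite big_allpairs_dep; apply: eq_bigr => a _.
  by rewrite -(big_mkord xpredT (fun j => G (rcons_tuple a j.+1))) /index_iota subn0.
apply: perm_big; apply: uniq_perm; first exact: pseqs_uniq.
  apply: allpairs_uniq_dep; first exact: pseqs_uniq.
    by move=> a _; exact: iota_uniq.
  move=> [a i] [b j] _ _ /= /(congr1 val) /= /rcons_inj [ab ij].
  by have -> : a = b by [apply: val_inj]; rewrite ij.
move=> b; rewrite mem_pseqs; apply/idP/allpairsPdep => [|[a [j [+ + ->]]]].
  have := size_tuple b; case/lastP bE : (tval b) => [//|t x].
  rewrite size_rcons => -[/eqP tk]; rewrite pseq_rcons => /andP[pa /andP[x0 xm]].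
  exists (Tuple tk), x.-1; split; first by rewrite mem_pseqs.
    by rewrite mem_iota /= add0n prednK.
  by apply: val_inj; rewrite /= prednK.
rewrite mem_pseqs mem_iota /= add0n => pa jm.
by rewrite pseq_rcons pa.
Qed.

End partition_sequences.

(** * Derivatives along the interpolation *)

Section class_calculus.
Context {R : realType} {e d : nat} {disp} {T : measurableType disp}.
Context (P : probability T R) (n : nat) (B L : seq nat -> R).
Context (f : probability 'rV[R]_e R -> 'rV[R]_d) (df : derivs R e d).
Context (Pi : probability ('rV[R]_e * 'rV[R]_e)%type R).
Hypotheses (n_gt0 : (0 < n)%N) (atomP : atomless P) (hCb : Cb P n B L f df).
Hypothesis idist : forall p, (p <= n.+1)%N ->
  rintegrable Pi setT (fun z => dist z ^+ p).
Hypothesis iinterp : forall r,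
  rintegrable Pi setT (fun z => enorm (interp r z) ^+ 2).
Local Notation E := 'rV[R]_e.
Local Notation Z := (E * E)%type.
Local Notation Pi_ r := (joint_interp Pi r).
Local Notation M1 := (mean_dist Pi).
Local Notation M2 := (\int[Pi]_z (dist z ^+ 2)).

Lemma moment_Pi r : finite_moment 2 (Pi_ r).
Proof. by apply/(finite_moment_law 2 (same_law_interp Pi r)). Qed.

Lemma idist1 : rintegrable Pi setT (@dist R e).
Proof. by have := idist (ltn0Sn n). Qed.

Lemma idist2 : rintegrable Pi setT (fun z : Z => dist z ^+ 2).
Proof. exact: idist. Qed.

Section one_derivative.
Context (k m : nat) (a : k.-tuple nat) (pa : pseq a) (ma : maxseq a = m).

Lemma df_bound M (x : m.-tuple E) : (0 < k <= n)%N -> finite_moment 2 M ->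
  enorm (df a M x) <= B a.
Proof. by move=> kn fM; exact: (hCb.2 k m a kn pa ma).1. Qed.

(** The extended-real bound is made real by a finite majorant [c] of the distance; the absolute
    value is taken because nothing prescribes the sign of [L a]. *)
Lemma df_lipschitz M N (x y : m.-tuple E) (c : R) : (0 < k <= n)%N ->
  finite_moment 2 M -> finite_moment 2 N -> (W1 M N <= c%:E)%E -> 0 <= c ->
  enorm (df a M x - df a N y) <=
    `|L a| * (c + \sum_(i < m) enorm (tnth x i - tnth y i)).
Proof.
move=> kn fM fN Wc c0; rewrite -lee_fin.
have S0 : 0 <= \sum_(i < m) enorm (tnth x i - tnth y i).
  by apply: sumr_ge0 => i _; exact: enorm_ge0.
apply: le_trans ((hCb.2 k m a kn pa ma).2 M N x y fM fN) _.
rewrite (@le_trans _ _ (`|L a|%:E * (W1 M N + (\sum_(i < m)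
    enorm (tnth x i - tnth y i))%:E))%E)//.
  apply: lee_wpmul2r; last by rewrite lee_fin ler_norm.
  by rewrite adde_ge0 ?W1_ge0 ?lee_fin.
by rewrite EFinM EFinD; apply: lee_wpmul2l; rewrite ?lee_fin// leeD2r.
Qed.

(** The points [interp r z] and [interp t z] are |r - t| * dist z apart, so [Pi] itself couples the
    two laws at cost |r - t| * M1. *)
Lemma df_interp_lipschitz r t (x y : m.-tuple E) : (0 < k <= n)%N ->
  enorm (df a (Pi_ r) x - df a (Pi_ t) y) <=
    `|L a| * (`|r - t| * M1 + \sum_(i < m) enorm (tnth x i - tnth y i)).
Proof.
move=> kn; apply: df_lipschitz => //; [exact: moment_Pi|exact: moment_Pi| |].
  rewrite /mean_dist -RintegralZl//; last exact: idist1.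
  have E1 : (fun z : Z => enorm (interp t z - interp r z)) =
      (fun z => `|r - t| * dist z).
    by apply/funext => z; rewrite enorm_interpB distrC.
  have := W1_le (same_law_interp Pi r) (same_law_interp Pi t).
  by rewrite E1; apply; apply: rintegrableZ => //; exact: idist1.
by rewrite mulr_ge0// mean_dist_ge0.
Qed.

(** For k > 0 the Wasserstein distance of the two measures vanishes and the Lipschitz bound applies;
    for k = 0 the claim is the extensionality clause on [f]. *)
Lemma df_measure_eq (M N : probability E R) (x : m.-tuple E) : (k <= n)%N -> finite_moment 2 M ->
  M ≡μ N -> df a M x = df a N x.
Proof.
move=> kn fM MN; have fN : finite_moment 2 N.
  have lM : same_law N M id id.
    by split => // A mA; rewrite (MN A mA).
  by apply/(finite_moment_law 2 lM); apply/(finite_moment_law 2 (u := id)).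
have [k0|k0] := posnP k; last first.
  apply/eqP; rewrite -subr_eq0; apply/eqP.
  have kn' : (0 < k <= n)%N by rewrite k0.
  have := df_lipschitz x x kn' fM fN (W1_measure_eq MN) (lexx 0).
  rewrite add0r big1 ?mulr0 => [h|i _]; last by rewrite subrr enorm0.
  apply/matrixP => i j; rewrite [RHS]mxE; apply/eqP; rewrite -normr_le0.
  by rewrite (le_trans (entry_le_enorm _ i j)).
have [[fext f0 _ _] _] := hCb.
subst k; have m0 : m = 0%N by rewrite -ma maxseq_tuple0.
move: x; rewrite m0 => x; rewrite (tuple0 a) (tuple0 x) f0// f0//.
exact: fext.
Qed.

End one_derivative.

Section next_derivative.
Context (k m : nat) (a : k.-tuple nat) (pa : pseq a) (ma : maxseq a = m).
Hypothesis kn : (k < n)%N.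

Let psr i : (i <= m)%N -> pseq (rcons_tuple a i.+1).
Proof. by move=> im; rewrite pseq_rcons pa ma. Qed.

Let msr i : (i < m)%N -> maxseq (rcons_tuple a i.+1) = m.
Proof. by move=> im; rewrite /= maxseq_rcons_le ma. Qed.

Let msr_new : maxseq (rcons_tuple a m.+1) = m.+1.
Proof. by rewrite /= -{1}ma maxseq_rcons_new ma. Qed.

(** The derivative of [df a (Pi_ r) x] in r with the points [x] frozen, as the chain rule predicts
    it. Its companion [slot_slope] freezes the measure and lets slot [i] follow the segment of
    [z]. *)
Definition measure_slope (r : R) (x : m.-tuple E) : 'M[R]_(tdim e k, d) :=
  mint Pi setT (fun z => contr
    (df (rcons_tuple a m.+1) (Pi_ r) (rcons_tuple x (interp r z))) (incr z)).

Definition slot_slope (r : R) (x : m.-tuple E) (i : 'I_m) (z : Z) :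
    'M[R]_(tdim e k, d) :=
  contr (df (rcons_tuple a i.+1) (Pi_ r) x) (incr z).

Lemma measurable_new_slot r (x : m.-tuple E) :
  measurable_fun setT (fun v => df (rcons_tuple a m.+1) (Pi_ r) (rcons_tuple x v)).
Proof.
have [[_ _ _ hl] _] := hCb.
by have [] := hl k m a (Pi_ r) x kn pa ma (moment_Pi r).
Qed.

Lemma rintegrable_measure_slope r (x : m.-tuple E) i j : rintegrable Pi setT (fun z => contr
    (df (rcons_tuple a m.+1) (Pi_ r) (rcons_tuple x (interp r z))) (incr z) i j).
Proof.
apply: (rintegrable_contr (B := B (rcons_tuple a m.+1))).
- apply: (measurableT_comp (measurable_new_slot r x)); exact: measurable_interp.
- exact: measurable_incr.
- move=> z; apply: (hCb.2 k.+1 m.+1 (rcons_tuple a m.+1) _ _ _).1 => //.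
    exact: psr.
  exact: moment_Pi.
- exact: idist1.
Qed.

(** [Pi_ (r + t)] is the law of u + t v for u = [interp r] and v = [incr], which is the situation of
    [lions_chain_rule]. *)
Lemma is_derive_measure (r : R) (x : m.-tuple E) i j :
  is_derive r 1 (fun s => df a (Pi_ s) x i j) (measure_slope r x i j).
Proof.
have [[_ _ _ hl] hb] := hCb.
apply: is_derive_expansion => eps eps0.
pose D v := df (rcons_tuple a m.+1) (Pi_ r) (rcons_tuple x v).
have law t : same_law (Pi_ (r + t)) Pi id (fun z => interp r z + t *: incr z).
  apply: same_law_sym; apply: (@eq_same_law _ _ _ _ _ _ _ _ _ _ (interp (r + t))).
    by move=> z; rewrite interpD.
  exact: same_law_sym (same_law_interp Pi _).
have kn' : (0 < k.+1 <= n)%N by [].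
have hlions t : lions_derivative P (fun M => df a M x) (Pi_ (r + t))
    (fun v => df (rcons_tuple a m.+1) (Pi_ (r + t)) (rcons_tuple x v)).
  exact: (hl k m a (Pi_ (r + t)) x kn pa ma (moment_Pi _)).
have hlions0 : lions_derivative P (fun M => df a M x) (Pi_ (r + 0)) D.
  by rewrite addr0 /D; have := hlions 0; rewrite addr0.
have DB v : enorm (D v) <= B (rcons_tuple a m.+1).
  by apply: (df_bound (psr (leqnn m)) msr_new) => //; exact: moment_Pi.
have DL v v' : enorm (D v - D v') <= `|L (rcons_tuple a m.+1)| * enorm (v - v').
  have W0 : (W1 (Pi_ r) (Pi_ r) <= 0%:E)%E by exact: W1_measure_eq.
  have := df_lipschitz (psr (leqnn m)) msr_new (rcons_tuple x v)
    (rcons_tuple x v') kn' (moment_Pi r) (moment_Pi r) W0 (lexx 0).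
  rewrite add0r big_ord_recr /= !tnth_rcons_max big1 ?add0r// => l _.
  by rewrite !tnth_rcons_widen subrr enorm0.
have [delta delta0 hdelta] := lions_chain_rule atomP
  (fun M N fM MN => df_measure_eq pa ma x (ltnW kn) fM MN)
  (measurable_interp r) (@measurable_incr R e) (iinterp r) idist2 law
  (fun t => ex_intro _ _ (hlions t)) hlions0 (normr_ge0 _) DB DL eps0.
exists delta => // t /hdelta; rewrite addr0 => h.
apply: le_trans h; apply: le_trans (entry_le_enorm _ i j).
by rewrite !mxE.
Qed.

Lemma is_derive_slot (r : R) M (x : m.-tuple E) (i : 'I_m) (z : Z) i0 j0 :
  finite_moment 2 M ->
  is_derive r 1 (fun s => df a M (set_slot x i (interp s z)) i0 j0)
    (contr (df (rcons_tuple a i.+1) M (set_slot x i (interp r z))) (incr z) i0 j0).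
Proof.
move=> fM; have [[_ _ hd _] _] := hCb.
have := hd k m a M (set_slot x i (interp r z)) i kn pa ma fM.
have -> : tnth (set_slot x i (interp r z)) i = z.1 + r *: incr z.
  by rewrite tnth_mktuple eqxx.
have -> : (fun v => df a M (set_slot (set_slot x i (interp r z)) i v)) =
    (fun v => df a M (set_slot x i v)).
  apply/funext => v; congr (df a M); apply: eq_from_tnth => l.
  by rewrite !tnth_mktuple; case: eqP.
exact: is_derive_line.
Qed.

Lemma slot_slope_lipschitz r r' (x x' : m.-tuple E) (i : 'I_m) z :
  enorm (slot_slope r x i z - slot_slope r' x' i z) <=
  `|L (rcons_tuple a i.+1)| *
    (`|r - r'| * M1 + \sum_(l < m) enorm (tnth x l - tnth x' l)) * dist z.
Proof.
rewrite /slot_slope -contrBl (le_trans (enorm_contr _ _))// ler_wpM2r ?enorm_ge0//.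
exact: (df_interp_lipschitz (psr (ltnW (ltn_ord i))) (msr (ltn_ord i))).
Qed.

(** The second moment enters because the new slot [interp r z] moves by |r - r'| * dist z and is
    paired with an increment of length [dist z]. *)
Lemma measure_slope_lipschitz r r' (x x' : m.-tuple E) :
  enorm (measure_slope r x - measure_slope r' x') <=
  `|L (rcons_tuple a m.+1)| *
    ((`|r - r'| * M1 + \sum_(l < m) enorm (tnth x l - tnth x' l)) * M1
      + `|r - r'| * M2).
Proof.
set Lm := `|_|; have Lm0 : 0 <= Lm by exact: normr_ge0.
rewrite /measure_slope -mintB//; try exact: rintegrable_measure_slope.
pose s := `|r - r'| * M1 + \sum_(l < m) enorm (tnth x l - tnth x' l).
have ib : rintegrable Pi setT
    (fun z => Lm * (s * dist z + `|r - r'| * dist z ^+ 2)).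
  apply: rintegrableZ => //; apply: rintegrableD => //; apply: rintegrableZ => //.
    exact: idist1.
  exact: idist2.
apply: (le_trans (enorm_mint measurableT _ ib _)).
- move=> i j; apply: eq_rintegrable (rintegrableB measurableT
    (rintegrable_measure_slope r x i j) (rintegrable_measure_slope r' x' i j)).
  by move=> z; rewrite !mxE.
- move=> z _; rewrite -contrBl (le_trans (enorm_contr _ _))//.
  have := df_interp_lipschitz (psr (leqnn m)) msr_new r r'
    (rcons_tuple x (interp r z)) (rcons_tuple x' (interp r' z)) kn.
  rewrite big_ord_recr/= !tnth_rcons_max enorm_interpB -/Lm => h.
  have -> : Lm * (s * dist z + `|r - r'| * dist z ^+ 2) =
      Lm * (s + `|r - r'| * dist z) * dist z by ring.
  rewrite ler_wpM2r ?enorm_ge0// (le_trans h)// ler_wpM2l// /s -addrA lerD2l.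
  rewrite lerD2r; apply: ler_sum => l _.
  by rewrite !tnth_rcons_widen.
- rewrite RintegralZl//; last first.
    by apply: rintegrableD => //; apply: rintegrableZ => //; [exact: idist1|exact: idist2].
  rewrite RintegralD//; try by apply: rintegrableZ => //; [exact: idist1|exact: idist2].
    by rewrite !RintegralZl//; [exact: idist2|exact: idist1].
  apply: rintegrableZ => //; exact: idist1.
  apply: rintegrableZ => //; exact: idist2.
Qed.

(** Index 0 of [s] is reserved for the time of the measure; index l + 1 is the time of slot l. *)
Definition pathx (s : 'I_m.+1 -> R) (zs : m.-tuple Z) : m.-tuple E :=
  [tuple interp (s (lift ord0 l)) (tnth zs l) | l < m].

Lemma pathx_lipschitz s s' zs :
  \sum_(l < m) enorm (tnth (pathx s zs) l - tnth (pathx s' zs) l) <=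
    wsum (@dist R e) zs * \sum_j `|s j - s' j|.
Proof.
rewrite big_ord_recl mulrDr ler_wpDl ?mulr_ge0 ?wsum_ge0//; first exact: dist_ge0.
rewrite mulr_sumr; apply: ler_sum => l _; rewrite !tnth_mktuple enorm_interpB.
rewrite mulrC ler_wpM2r// /wsum (bigD1 l)//= lerDl.
by apply: sumr_ge0 => i _; exact: dist_ge0.
Qed.

Definition slope_const : R := \sum_(i < m.+1) `|L (rcons_tuple a i.+1)|.

Lemma slope_const_ge (i : 'I_m.+1) : `|L (rcons_tuple a i.+1)| <= slope_const.
Proof. by rewrite /slope_const (bigD1 i)//= lerDl sumr_ge0. Qed.

Definition path_slope (r : R) (zs : m.-tuple Z) : 'M[R]_(tdim e k, d) :=
  let x := map_tuple (interp r) zs in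
  measure_slope r x + \sum_(l < m) slot_slope r x l (tnth zs l).

(** [lipschitz_partials_expansion] in the m + 1 separate times, evaluated on the diagonal. The
    explicit dependence on [zs] is what allows the error to be integrated afterwards. *)
Lemma path_expansion r t zs i j :
  `|(df a (Pi_ (r + t)) (map_tuple (interp (r + t)) zs) -
     df a (Pi_ r) (map_tuple (interp r) zs) - t *: path_slope r zs) i j| <=
  slope_const * (1 + M1 + M2 + wsum (@dist R e) zs) ^+ 2 * m.+1%:R ^+ 2 * t ^+ 2.
Proof.
set W := wsum _ _.
pose H s := df a (Pi_ (s ord0)) (pathx s zs) i j.
pose DH (idx : 'I_m.+1) (s : 'I_m.+1 -> R) : R :=
  if unlift ord0 idx is Some l
  then slot_slope (s ord0) (pathx s zs) l (tnth zs l) i j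
  else measure_slope (s ord0) (pathx s zs) i j.
have mapE r' : map_tuple (interp r') zs = pathx (fun _ => r') zs.
  by apply: eq_from_tnth => l; rewrite tnth_map tnth_mktuple.
have W0 : 0 <= W by apply: wsum_ge0; exact: dist_ge0.
have M10 : 0 <= M1 := mean_dist_ge0 Pi.
have M20 : 0 <= M2 by apply: Rintegral_ge0 => z _; exact: sqr_ge0.
have C0 : 0 <= slope_const by rewrite sumr_ge0.
have K0 : 0 <= slope_const * (1 + M1 + M2 + W) ^+ 2 by rewrite mulr_ge0 ?sqr_ge0.
have dH idx s (q : R) :
    is_derive q 1 (fun q => H (upd s idx q)) (DH idx (upd s idx q)).
  rewrite /DH /H; case: (unliftP ord0 idx) => [l ->|->]; last first.
    have pe q' : pathx (upd s ord0 q') zs = pathx s zs.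
      by apply: eq_from_tnth => l; rewrite !tnth_mktuple /upd.
    have -> : (fun q0 => df a (Pi_ (upd s ord0 q0 ord0)) (pathx (upd s ord0 q0) zs) i j) =
        (fun q0 => df a (Pi_ q0) (pathx s zs) i j).
      by apply/funext => q0; rewrite pe /upd eqxx.
    rewrite pe /upd eqxx; exact: is_derive_measure.
  have pe q' : pathx (upd s (lift ord0 l) q') zs =
      set_slot (pathx s zs) l (interp q' (tnth zs l)).
    apply: eq_from_tnth => l'; rewrite !tnth_mktuple /upd (inj_eq lift_inj).
    by case: eqP => // ->.
  have ue q' : upd s (lift ord0 l) q' ord0 = s ord0 by rewrite /upd.
  rewrite /slot_slope pe ue.
  have -> : (fun q0 => df a (Pi_ (upd s (lift ord0 l) q0 ord0))
        (pathx (upd s (lift ord0 l) q0) zs) i j) =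
      (fun q0 => df a (Pi_ (s ord0)) (set_slot (pathx s zs) l (interp q0 (tnth zs l))) i j).
    by apply/funext => q0; rewrite pe ue.
  by apply: is_derive_slot; exact: moment_Pi.
(* A slot contributes (M1 + W) W and the measure (M1 + W) M1 + M2; the square (1 + M1 + M2 + W)^2
   dominates both. *)
have lH idx s s' : `|DH idx s - DH idx s'| <=
    slope_const * (1 + M1 + M2 + W) ^+ 2 * \sum_q `|s q - s' q|.
  set D := \sum_q _; have D0 : 0 <= D by exact: sumr_ge0.
  have sD : `|s ord0 - s' ord0| <= D.
    by rewrite /D big_ord_recl lerDl sumr_ge0.
  have base : `|s ord0 - s' ord0| * M1 +
      \sum_(l < m) enorm (tnth (pathx s zs) l - tnth (pathx s' zs) l) <= (M1 + W) * D.
    by rewrite mulrDl lerD ?pathx_lipschitz// mulrC ler_wpM2l.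
  rewrite -mulrA /DH; case: (unliftP ord0 idx) => [l _|_].
    have -> (A A' : 'M[R]_(tdim e k, d)) : A i j - A' i j = (A - A') i j.
      by rewrite !mxE.
    rewrite (le_trans (entry_le_enorm _ i j))//.
    rewrite (le_trans (slot_slope_lipschitz _ _ _ _ _ _))// -mulrA.
    have Ll : `|L (rcons_tuple a l.+1)| <= slope_const.
      exact: (slope_const_ge (widen_ord (leqnSn m) l)).
    have dW : dist (tnth zs l) <= W.
      rewrite /W /wsum (bigD1 l)//= lerDl; apply: sumr_ge0 => *; exact: dist_ge0.
    apply: ler_pM => //.
      rewrite mulr_ge0 ?addr_ge0 ?mulr_ge0 ?dist_ge0//.
      by apply: sumr_ge0 => *; exact: enorm_ge0.
    apply: (@le_trans _ _ ((M1 + W) * D * W)).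
      apply: ler_pM => //; last exact: dist_ge0.
      rewrite addr_ge0 ?mulr_ge0//; by apply: sumr_ge0 => *; exact: enorm_ge0.
    rewrite mulrAC ler_wpM2r//.
    have := mulr_ge0 M10 W0; have := mulr_ge0 M10 M20; have := mulr_ge0 M20 W0.
    have := sqr_ge0 M1; have := sqr_ge0 M2; nra.
  have -> (A A' : 'M[R]_(tdim e k, d)) : A i j - A' i j = (A - A') i j.
    by rewrite !mxE.
  rewrite (le_trans (entry_le_enorm _ i j))//.
  rewrite (le_trans (measure_slope_lipschitz _ _ _ _))//.
  apply: ler_pM => //.
  - rewrite addr_ge0 ?mulr_ge0 ?addr_ge0 ?mulr_ge0//.
    by apply: sumr_ge0 => *; exact: enorm_ge0.
  - exact: (slope_const_ge ord_max).
  - apply: (@le_trans _ _ ((M1 + W) * D * M1 + D * M2)).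
      by rewrite lerD// ler_wpM2r.
    rewrite mulrAC [D * M2]mulrC -mulrDl ler_wpM2r//.
    have := mulr_ge0 M10 W0; have := mulr_ge0 M10 M20; have := mulr_ge0 M20 W0.
    have := sqr_ge0 M1; have := sqr_ge0 M2; have := sqr_ge0 W; nra.
have := lipschitz_partials_expansion r t K0 dH lH.
rewrite big_ord_recl /DH unlift_none; under eq_bigr do rewrite liftK.
congr (_ <= _); congr `|_|.
rewrite /H /path_slope !mapE !mxE summxE.
by congr (_ - _).
Qed.

End next_derivative.
End class_calculus.

Lemma mint_mulmx {disp} {T : measurableType disp} {R : realType} {p q r}
    (mu : {measure set T -> \bar R}) (A : 'M[R]_(p, q)) (F : T -> 'M[R]_(q, r)) :
  (forall i j, rintegrable mu setT (fun x => F x i j)) ->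
  mint mu setT (fun x => A *m F x) = A *m mint mu setT F.
Proof.
move=> iF; apply/matrixP => i j; rewrite !mxE.
under eq_Rintegral do rewrite mxE.
rewrite Rintegral_sum//; last by move=> l; exact: rintegrableZ.
by apply: eq_bigr => l _; rewrite RintegralZl// mxE.
Qed.

(** * Tensor products of increments *)

Section increments.
Context {R : realType} {e : nat}.
Local Notation E := 'rV[R]_e.
Local Notation Z := (E * E)%type.
Local Notation ws := (wsum (@dist R e)).

Lemma eq_tens (v v' : nat -> E) k : (forall i, (i < k)%N -> v i = v' i) ->
  tens v k = tens v' k.
Proof.
elim: k => [//|k IH] h /=; rewrite (h k)// IH// => i ik.
by apply: h; rewrite ltnW.
Qed.

Lemma increments_rcons {k m} (a : k.-tuple nat) i (zs : m.-tuple Z) :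
  increments (rcons_tuple a i.+1) zs =
  tens1 (increments a zs) (incr (nth 0 zs i)).
Proof.
rewrite /increments /= nth_rcons size_tuple ltnn eqxx; congr tens1.
by apply: eq_tens => l lk; rewrite nth_rcons size_tuple lk.
Qed.

(** The letters of [a] lie between 1 and m, so position m of the longer tuple is never read. *)
Lemma increments_widen {k m} (a : k.-tuple nat) (zs : m.-tuple Z) z :
  pseq a -> maxseq a = m -> increments a (rcons_tuple zs z) = increments a zs.
Proof.
move=> /and3P[/all_nthP alla _ _] ma; apply: eq_tens => i ik.
rewrite nth_rcons size_tuple ifT//.
have sa : (i < size a)%N by rewrite size_tuple.
rewrite prednK ?alla// -ma; apply: leq_bigmax_seq => //.
exact: mem_nth.
Qed.

(** Past the end of the tuple the default pair (0, 0) has zero increment, so the bound holds for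
    every [i]. *)
Lemma enorm_nth_le {m} (zs : m.-tuple Z) i : enorm (incr (nth 0 zs i)) <= ws zs.
Proof.
have [im|mi] := ltnP i m; last first.
  rewrite nth_default ?size_tuple// /incr subrr enorm0.
  by apply: wsum_ge0 => z; exact: dist_ge0.
rewrite -[i]/(val (Ordinal im)) -tnth_nth /wsum (bigD1 (Ordinal im))//= lerDl.
by apply: sumr_ge0 => *; exact: dist_ge0.
Qed.

Lemma enorm_increments {k m} (a : k.-tuple nat) (zs : m.-tuple Z) :
  enorm (increments a zs) <= ws zs ^+ k.
Proof.
have ws0 : 0 <= ws zs by apply: wsum_ge0 => z; exact: dist_ge0.
suff H k' : enorm (tens (fun i => incr (nth 0 zs (nth 0%N a i).-1)) k') <= ws zs ^+ k'.
  exact: H.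
elim: k' => [|k' IH] /=.
  rewrite expr0 (le_trans (enorm_le_sum _))// !big_ord1 mxE normr1//.
rewrite enorm_tens1 exprSr; apply: ler_pM => //; try exact: enorm_ge0.
exact: enorm_nth_le.
Qed.

Lemma measurable_increments {k m} (a : k.-tuple nat) :
  measurable_fun setT (fun zs : m.-tuple Z => increments a zs).
Proof.
suff H k' : measurable_fun setT (fun zs : m.-tuple Z =>
    tens (fun i => incr (nth 0 zs (nth 0%N a i).-1)) k') by exact: H.
elim: k' => [|k' IH] /=; first exact: measurable_cst.
apply/measurable_fun_mxP => i l; rewrite ord1; case/mxvec_indexP: l => i' l.
under eq_fun do rewrite tens1E.
move/measurable_fun_mxP : IH => IH; apply: measurable_funM; first exact: IH.
suff : measurable_fun setT
    (fun zs : m.-tuple Z => incr (nth 0 zs (nth 0%N a k').-1)).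
  by move/measurable_fun_mxP; exact.
apply: (measurableT_comp (@measurable_incr R e)).
move: (_.-1) => q; have [im|mi] := ltnP q m; last first.
  rewrite (_ : (fun zs : m.-tuple Z => nth 0 zs q) = cst 0); last first.
    by apply/funext => zs; rewrite nth_default ?size_tuple.
  exact: measurable_cst.
rewrite (_ : (fun zs : m.-tuple Z => nth 0 zs q) = (fun zs => tnth zs (Ordinal im))).
  exact: measurable_tnth.
by apply/funext => zs; rewrite (tnth_nth 0).
Qed.

End increments.

(** * Differentiating the integrated terms *)

Section taylor_terms.
Context {R : realType} {e d : nat} {disp} {T : measurableType disp}.
Context (P : probability T R) (n : nat) (B L : seq nat -> R).
Context (f : probability 'rV[R]_e R -> 'rV[R]_d) (df : derivs R e d).
Context (Pi : probability ('rV[R]_e * 'rV[R]_e)%type R).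
Hypotheses (n_gt0 : (0 < n)%N) (atomP : atomless P) (hCb : Cb P n B L f df).
Hypothesis idist : forall p, (p <= n.+1)%N ->
  rintegrable Pi setT (fun z => dist z ^+ p).
Hypothesis iinterp : forall r,
  rintegrable Pi setT (fun z => enorm (interp r z) ^+ 2).
Local Notation E := 'rV[R]_e.
Local Notation Z := (E * E)%type.
Local Notation Pi_ r := (joint_interp Pi r).
Local Notation M1 := (mean_dist Pi).
Local Notation M2 := (\int[Pi]_z (dist z ^+ 2)).
Local Notation ws := (wsum (@dist R e)).
Local Notation tame := (tame (@dist R e) n.+1).

(** The integrand of D^a with the measure and the points transported to time r. *)
Definition term {k} (m : nat) (a : k.-tuple nat) (r : R) (zs : m.-tuple Z) :
    'rV[R]_d :=
  increments a zs *m df a (Pi_ r) (map_tuple (interp r) zs).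

Definition Phi {k} (m : nat) (a : k.-tuple nat) (r : R) : 'rV[R]_d :=
  mint (powm Pi m) setT (term a r).

Let d0 (z : Z) : 0 <= dist z. Proof. exact: dist_ge0. Qed.
Let md : measurable_fun setT (@dist R e). Proof. exact: measurable_dist. Qed.
Let idn : rintegrable Pi setT (fun z : Z => dist z ^+ n.+1).
Proof. exact: idist. Qed.
Let ws0 m (zs : m.-tuple Z) : 0 <= ws zs.
Proof. by apply: wsum_ge0. Qed.

Section one_sequence.
Context (k m : nat) (a : k.-tuple nat) (pa : pseq a) (ma : maxseq a = m).

(** Joint measurability in time and points, which Fubini's theorem for the remainder requires,
    follows from the joint Lipschitz bound. *)
Lemma measurable_df {d'} {S : measurableType d'} (s : S -> R)
    (zs : S -> m.-tuple Z) i j : (0 < k <= n)%N ->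
  measurable_fun setT s -> measurable_fun setT zs ->
  measurable_fun setT
    (fun y => df a (Pi_ (s y)) (map_tuple (interp (s y)) (zs y)) i j).
Proof.
move=> kn ms mzs.
pose X (l : 'I_m) y := interp (s y) (tnth (zs y) l).
have -> : (fun y => df a (Pi_ (s y)) (map_tuple (interp (s y)) (zs y)) i j) =
    (fun y => df a (Pi_ (s y)) [tuple X l y | l < m] i j).
  apply/funext => y; congr (df a _ _ i j); apply: eq_from_tnth => l.
  by rewrite tnth_map tnth_mktuple.
apply: (lipschitz_measurable_tuple (H := fun r x => df a (Pi_ r) x i j)
  (K := `|L a| * (M1 + 1))) => //.
  move=> r r' x x'.
  have -> : df a (Pi_ r) x i j - df a (Pi_ r') x' i j =
      (df a (Pi_ r) x - df a (Pi_ r') x') i j by rewrite !mxE.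
  rewrite (le_trans (entry_le_enorm _ i j))//.
  rewrite (le_trans (df_interp_lipschitz hCb idist iinterp pa ma _ _ _ _ kn))//.
  rewrite -mulrA ler_wpM2l//.
  have := mean_dist_ge0 Pi; set Sx := \sum_(l < m) _.
  have : 0 <= Sx by apply: sumr_ge0 => *; exact: enorm_ge0.
  by have := normr_ge0 (r - r'); nra.
move=> l; have mz : measurable_fun setT (fun y => tnth (zs y) l).
  exact: (measurableT_comp (measurable_tnth l) mzs).
apply: measurable_addmx; first exact: (measurableT_comp measurable_fst mz).
have /measurable_fun_mxP mi : measurable_fun setT (fun y => incr (tnth (zs y) l)).
  exact: (measurableT_comp (@measurable_incr R e) mz).
apply/measurable_fun_mxP => i' j'; under eq_fun do rewrite mxE.
by apply: measurable_funM => //; exact: mi.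
Qed.

Lemma maxseq0 : k = 0%N -> m = 0%N.
Proof. by move=> k0; move: ma; subst k; rewrite maxseq_tuple0. Qed.

(** For k = 0 there is no Lipschitz bound, but then m = 0 and the function lives on the single empty
    tuple; [df_bounded] makes the same distinction. *)
Lemma measurable_df_fixed r i j : (k <= n)%N ->
  measurable_fun setT
    (fun zs : m.-tuple Z => df a (Pi_ r) (map_tuple (interp r) zs) i j).
Proof.
move=> kn; have [k0|k0] := posnP k; last first.
  by apply: (@measurable_df _ _ (cst r) id) => //; rewrite k0.
have m0 := maxseq0 k0.
suff -> : (fun zs : m.-tuple Z => df a (Pi_ r) (map_tuple (interp r) zs) i j) =
   cst (df a (Pi_ r) (map_tuple (interp r) (nseq_tuple m 0)) i j).
  exact: measurable_cst.
apply/funext => zs /=; congr (df a _ (map_tuple _ _) i j).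
by apply: eq_from_tnth => -[l lm]; exfalso; move: lm; rewrite m0.
Qed.

Lemma df_bounded r : (k <= n)%N ->
  exists2 b, 0 <= b & forall x : m.-tuple E, enorm (df a (Pi_ r) x) <= b.
Proof.
move=> kn; have [k0|k0] := posnP k; last first.
  have kn' : (0 < k <= n)%N by rewrite k0.
  have h x := df_bound hCb pa ma x kn' (moment_Pi iinterp r).
  exists (B a) => //; apply: le_trans (h (nseq_tuple m 0)); exact: enorm_ge0.
have m0 := maxseq0 k0.
exists (enorm (df a (Pi_ r) (nseq_tuple m 0))); first exact: enorm_ge0.
move=> x; rewrite (_ : x = nseq_tuple m 0)//.
by apply: eq_from_tnth => -[l lm]; exfalso; move: lm; rewrite m0.
Qed.

Lemma term_tame r j : (k <= n)%N -> tame (fun zs : m.-tuple Z => term a r zs 0 j).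
Proof.
move=> kn; split.
  under eq_fun do rewrite mxE; apply: measurable_sum => l.
  have /measurable_fun_mxP mI := @measurable_increments R e k m a.
  by apply: measurable_funM; [exact: mI|exact: measurable_df_fixed].
have [b b0 hb] := df_bounded r kn; exists b, 1; split => // zs.
rewrite (le_trans (entry_le_enorm _ _ _))// (le_trans (enorm_mulmx _ _))//.
rewrite mulrC ler_pM ?enorm_ge0// (le_trans (enorm_increments _ _))//.
rewrite (@le_trans _ _ ((1 + ws zs) ^+ k))//.
  by rewrite lerXn2r ?nnegrE ?addr_ge0// lerDr.
by apply: ler_weXn2l; [rewrite lerDl|exact: leqW].
Qed.

End one_sequence.

Section derivative_step.
Context (k m : nat) (a : k.-tuple nat) (pa : pseq a) (ma : maxseq a = m).
Hypothesis kn : (k < n)%N.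

Let psr i : (i <= m)%N -> pseq (rcons_tuple a i.+1).
Proof. by move=> im; rewrite pseq_rcons pa ma. Qed.

Let msr i : (i < m)%N -> maxseq (rcons_tuple a i.+1) = m.
Proof. by move=> im; rewrite /= maxseq_rcons_le ma. Qed.

Let msr_new : maxseq (rcons_tuple a m.+1) = m.+1.
Proof. by rewrite /= -{1}ma maxseq_rcons_new ma. Qed.

(** Each partial slope, multiplied by the increments of [a], is the term of an extension of [a]; the
    new letter comes with its own integration variable. *)
Lemma increments_path_slope r (zs : m.-tuple Z) :
  increments a zs *m path_slope df Pi a r zs =
  mint Pi setT (fun z => term (rcons_tuple a m.+1) r (rcons_tuple zs z)) +
  \sum_(l < m) term (rcons_tuple a l.+1) r zs.
Proof.
rewrite /path_slope mulmxDr mulmx_sumr; congr (_ + _); last first.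
  apply: eq_bigr => l _; rewrite /slot_slope -mulmx_contr /term increments_rcons.
  by rewrite (tnth_nth 0).
rewrite /measure_slope -mint_mulmx; last first.
  by move=> i j; exact: (rintegrable_measure_slope hCb idist iinterp pa ma kn r).
congr (mint Pi setT); apply/funext => z.
rewrite -mulmx_contr /term increments_rcons increments_widen//.
rewrite nth_rcons size_tuple ltnn eqxx.
have -> // : rcons_tuple (map_tuple (interp r) zs) (interp r z) =
  map_tuple (interp r) (rcons_tuple zs z).
by apply: val_inj; rewrite /= map_rcons.
Qed.

(** The second-order error of [path_expansion], multiplied by the increments, is at most
    [U zs * t ^+ 2] with [U] integrable. Integration leaves a quadratic error in t. *)
Lemma is_derive_Phi (r : R) j :
  is_derive r 1 (fun s => Phi m a s 0 j)
    ((Phi m.+1 (rcons_tuple a m.+1) r +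
      \sum_(l < m) Phi m (rcons_tuple a l.+1) r) 0 j).
Proof.
have tn : tame (fun zs : m.+1.-tuple Z => term (rcons_tuple a m.+1) r zs 0 j).
  exact: (term_tame (psr (leqnn m)) msr_new).
have to (l : 'I_m) : tame (fun zs : m.-tuple Z => term (rcons_tuple a l.+1) r zs 0 j).
  exact: (term_tame (psr (ltnW (ltn_ord l))) (msr (ltn_ord l))).
pose G (zs : m.-tuple Z) := (increments a zs *m path_slope df Pi a r zs) 0 j.
have GE zs : G zs = \int[Pi]_z term (rcons_tuple a m.+1) r (rcons_tuple zs z) 0 j +
    \sum_(l < m) term (rcons_tuple a l.+1) r zs 0 j.
  by rewrite /G increments_path_slope !mxE summxE.
have i1 := rintegrable_fubini_in d0 md idn tn.
have i2 : rintegrable (powm Pi m) setT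
    (fun zs => \sum_(l < m) term (rcons_tuple a l.+1) r zs 0 j).
  by apply: rintegrable_sum => // l; exact: (tame_rintegrable d0 md idn (to l)).
have iG : rintegrable (powm Pi m) setT G.
  by apply: eq_rintegrable (rintegrableD measurableT i1 i2) => zs; exact: GE.
have -> : (Phi m.+1 (rcons_tuple a m.+1) r +
      \sum_(l < m) Phi m (rcons_tuple a l.+1) r) 0 j = \int[powm Pi m]_zs G zs.
  under eq_Rintegral do rewrite GE.
  rewrite RintegralD// -(tame_fubini_in d0 md idn tn) !mxE summxE; congr (_ + _).
  rewrite Rintegral_sum//; last by move=> l; exact: (tame_rintegrable d0 md idn (to l)).
  by apply: eq_bigr => l _; rewrite mxE.
have iF s : rintegrable (powm Pi m) setT (fun zs => term a s zs 0 j).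
  by apply: (tame_rintegrable d0 md idn); apply: term_tame => //; exact: ltnW.
pose c := 1 + M1 + M2.
have c1 : 1 <= c.
  rewrite /c -addrA lerDl addr_ge0 ?mean_dist_ge0//.
  by apply: Rintegral_ge0 => z _; exact: sqr_ge0.
have c0 : 0 <= c by exact: le_trans c1.
(* The factor [tdim e k] comes from summing entrywise bounds. It influences only the existence of
   the derivative, not the constant of the theorem. *)
pose K := (tdim e k)%:R * (slope_const L m a * m.+1%:R ^+ 2).
have sc0 : 0 <= slope_const L m a by exact: sumr_ge0.
have K0 : 0 <= K by rewrite !mulr_ge0.
pose U (zs : m.-tuple Z) := K * (c + ws zs) ^+ n.+1.
have U0 zs : 0 <= U zs by rewrite mulr_ge0// exprn_ge0// addr_ge0.
have iU : rintegrable (powm Pi m) setT U.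
  apply: (tame_rintegrable d0 md idn); split.
    apply: measurable_funM => //; apply: measurable_funX; apply: measurable_funD => //.
    exact: measurable_wsum.
  by exists K, c; split => // zs; rewrite ger0_norm.
have bound t : `|Phi m a (r + t) 0 j - Phi m a r 0 j - t * \int[powm Pi m]_zs G zs| <=
    (\int[powm Pi m]_zs U zs) * t ^+ 2.
  rewrite !mxE -RintegralZl// -RintegralB// -RintegralB//; last 2 first.
    exact: rintegrableB.
    exact: rintegrableZ.
  rewrite -RintegralZr//.
  have iD : rintegrable (powm Pi m) setT
      (fun zs => term a (r + t) zs 0 j - term a r zs 0 j - t * G zs).
    by apply: rintegrableB => //; [exact: rintegrableB|exact: rintegrableZ].
  apply: normr_Rintegral_le => //.
  - by apply/measurable_EFinP; exact: (measurable_int _ iD).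
  - apply: eq_rintegrable (rintegrableZ measurableT (t ^+ 2) iU) => zs.
    by rewrite mulrC.
  move=> zs _.
  set D := df a (Pi_ (r + t)) (map_tuple (interp (r + t)) zs) -
     df a (Pi_ r) (map_tuple (interp r) zs) - t *: path_slope df Pi a r zs.
  have -> : term a (r + t) zs 0 j - term a r zs 0 j - t * G zs =
      (increments a zs *m D) 0 j.
    by rewrite /G /term /D !mulmxBr -scalemxAr !mxE.
  rewrite mxE (le_trans (ler_norm_sum _ _ _))//.
  rewrite (@le_trans _ _ (\sum_(l < tdim e k) (slope_const L m a * m.+1%:R ^+ 2 *
      (c + ws zs) ^+ n.+1 * t ^+ 2)))//; last first.
    rewrite sumr_const card_ord -[leLHS]mulr_natl /U /K !mulrA//.
  apply: ler_sum => l _; rewrite normrM.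
  have h := path_expansion n_gt0 atomP hCb idist iinterp pa ma kn r t zs l j.
  rewrite -/D -/c in h.
  rewrite (@le_trans _ _ (ws zs ^+ k * (slope_const L m a * (c + ws zs) ^+ 2 *
      m.+1%:R ^+ 2 * t ^+ 2)))//.
    apply: ler_pM => //.
    by rewrite (le_trans (entry_le_enorm _ _ _))// enorm_increments.
  have -> : ws zs ^+ k * (slope_const L m a * (c + ws zs) ^+ 2 *
      m.+1%:R ^+ 2 * t ^+ 2) = slope_const L m a * m.+1%:R ^+ 2 *
      (ws zs ^+ k * (c + ws zs) ^+ 2) * t ^+ 2 by ring.
  rewrite ler_wpM2r ?sqr_ge0// ler_wpM2l ?mulr_ge0//.
  rewrite (@le_trans _ _ ((c + ws zs) ^+ k * (c + ws zs) ^+ 2))//.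
    apply: ler_wpM2r; first exact: sqr_ge0.
    have wz0 : 0 <= ws zs by exact: ws0.
    apply: lerXn2r; rewrite ?nnegrE; [exact: wz0|exact: addr_ge0|].
    by rewrite lerDr.
  (* The degree k + 2 is at most n + 1 since k < n, and the base is at least [c], hence at least
     1. *)
  rewrite -exprD; apply: ler_weXn2l; last by rewrite addn2.
  by rewrite (le_trans c1)// lerDl.
apply: is_derive_expansion => eps eps0.
set V := \int[_]_zs U zs in bound.
have V0 : 0 <= V by exact: Rintegral_ge0.
exists (eps / (V + 1)); first by rewrite divr_gt0// ltr_wpDl.
move=> t; rewrite ler_pdivlMr ?ltr_wpDl// => ht; rewrite (le_trans (bound t))//.
rewrite -[t ^+ 2]real_normK ?num_real// expr2 mulrA ler_wpM2r//.
by rewrite (le_trans _ ht)// mulrC ler_wpM2l// lerDl.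
Qed.

End derivative_step.
End taylor_terms.

(** * Taylor's formula *)

Section taylor_integral.
Context {R : realType}.
Local Notation leb := (@lebesgue_measure R).
Local Notation I01 := (`[0, 1]%classic : set R).

Lemma continuous_rintegrable01 (g : R -> R) : continuous g -> rintegrable leb I01 g.
Proof.
move=> cg; apply: continuous_compact_integrable; first exact: segment_compact.
by apply: continuous_subspaceT.
Qed.

Lemma FTC01 (F g : R -> R) : (forall x : R, is_derive x 1 F (g x)) ->
  continuous g -> \int[leb]_(x in I01) g x = F 1 - F 0.
Proof.
move=> dF cg; have cF : continuous F.
  by move=> x; apply/differentiable_continuous/derivable1_diffP; case: (dF x).
rewrite /Rintegral (@continuous_FTC2 _ g F 0 1)//.
- by apply: continuous_subspaceT.
- split; first by move=> x _; case: (dF x).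
    by apply: cvg_at_right_filter; exact: cF.
  by apply: cvg_at_left_filter; exact: cF.
- by move=> x _; rewrite derive1E; case: (dF x).
Qed.

Lemma continuous_is_derive (F g : R -> R) :
  (forall x : R, is_derive x 1 F (g x)) -> continuous F.
Proof.
by move=> dF x; apply/differentiable_continuous/derivable1_diffP; case: (dF x).
Qed.

Lemma is_derive_onem_pow (k : nat) (x : R) :
  is_derive x 1 (fun x => (1 - x) ^+ k.+1) (- (k.+1%:R * (1 - x) ^+ k)).
Proof.
have h1 : is_derive x 1 (fun x : R => 1 - x) (-1).
  have := is_deriveB (is_derive_cst (1 : R) x 1) (is_derive_id x 1).
  by rewrite sub0r.
have -> : (fun x : R => (1 - x) ^+ k.+1) = (fun x : R => 1 - x) ^+ k.+1.
  by apply/funext => y; rewrite exprfctE.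
apply: trigger_derive (is_deriveX k.+1 h1) _.
by rewrite /GRing.scale /= mulrN1.
Qed.

Lemma continuous_onem_pow n : continuous (fun x : R => (1 - x) ^+ n).
Proof.
case: n => [|n]; last exact: continuous_is_derive (is_derive_onem_pow n).
by under eq_fun do rewrite expr0; exact: cst_continuous.
Qed.

(** The product rule telescopes: lowering the power of 1 - x in one summand cancels the derivative
    of [ph] in the summand before. *)
Lemma taylor_antiderivative (ph : nat -> R -> R) n (x : R) :
  (forall k (x : R), (k < n.+1)%N -> is_derive x 1 (ph k) (ph k.+1 x)) ->
  is_derive x 1
    (fun x => \sum_(k < n.+1) (k`!%:R)^-1 * (ph k x * (1 - x) ^+ k))
    ((n`!%:R)^-1 * ((1 - x) ^+ n * ph n.+1 x)).
Proof.
elim: n => [|n IH] dph.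
  have -> : (fun x => \sum_(k < 1) (k`!%:R)^-1 * (ph k x * (1 - x) ^+ k)) = ph 0.
    by apply/funext => y; rewrite big_ord1 fact0 invr1 expr0 mul1r mulr1.
  by rewrite fact0 invr1 expr0 !mul1r; exact: dph.
have -> : (fun x => \sum_(k < n.+2) (k`!%:R)^-1 * (ph k x * (1 - x) ^+ k)) =
    (fun x => \sum_(k < n.+1) (k`!%:R)^-1 * (ph k x * (1 - x) ^+ k)) +
    (n.+1`!%:R)^-1 *: (ph n.+1 * (fun x => (1 - x) ^+ n.+1)).
  by apply/funext => y; rewrite big_ord_recr.
have h1 := IH (fun k y kn => dph k y (leqW kn)).
have h2 := is_deriveZ (n.+1`!%:R)^-1
  (is_deriveM (dph n.+1 x (ltnSn _)) (is_derive_onem_pow n x)).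
apply: trigger_derive (is_deriveD h1 h2) _.
rewrite /GRing.scale /= factS natrM.
have n1 : n.+1%:R != 0 :> R by rewrite pnatr_eq0.
have -> : (n`!%:R)^-1 = (n.+1%:R * n`!%:R)^-1 * n.+1%:R :> R.
  by rewrite invfM mulrAC mulVf ?mul1r.
by move: (_^-1) => c; ring.
Qed.

Lemma taylor_integral (ph : nat -> R -> R) n :
  (forall k (x : R), (k < n.+1)%N -> is_derive x 1 (ph k) (ph k.+1 x)) ->
  continuous (ph n.+1) ->
  ph 0%N 1 = \sum_(k < n.+1) (k`!%:R)^-1 * ph k 0 +
    (n`!%:R)^-1 * \int[leb]_(x in I01) ((1 - x) ^+ n * ph n.+1 x).
Proof.
move=> dph cph.
have cpow : continuous (fun x : R => (1 - x) ^+ n).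
  exact: continuous_onem_pow.
have cg : continuous (fun x : R => (1 - x) ^+ n * ph n.+1 x).
  by move=> x; apply: cvgM; [exact: cpow|exact: cph].
have cg' : continuous (fun x : R => (n`!%:R)^-1 * ((1 - x) ^+ n * ph n.+1 x)).
  by move=> x; apply: cvgM; [exact: cvg_cst|exact: cg].
have := FTC01 (fun x => taylor_antiderivative x dph) cg'.
rewrite RintegralZl//; last exact: continuous_rintegrable01.
move=> ->.
have -> : \sum_(k < n.+1) (k`!%:R)^-1 * (ph k 1 * (1 - 1) ^+ k) = ph 0%N 1.
  rewrite big_ord_recl /= fact0 invr1 mul1r expr0 mulr1 big1 ?addr0// => k _.
  by rewrite subrr expr0n /= !mulr0.
have -> : \sum_(k < n.+1) (k`!%:R)^-1 * (ph k 0 * (1 - 0) ^+ k) =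
    \sum_(k < n.+1) (k`!%:R)^-1 * ph k 0.
  by apply: eq_bigr => k _; rewrite subr0 expr1n mulr1.
by rewrite addrC subrK.
Qed.

Lemma Rintegral_onem_pow n : \int[leb]_(x in I01) ((1 - x) ^+ n) = (n.+1%:R)^-1 :> R.
Proof.
have cpow : continuous (fun x : R => (1 - x) ^+ n).
  exact: continuous_onem_pow.
have dF (x : R) : is_derive x 1 (fun x => - (n.+1%:R)^-1 * (1 - x) ^+ n.+1) ((1 - x) ^+ n).
  have h := is_deriveZ (- (n.+1%:R)^-1) (is_derive_onem_pow n x).
  apply: trigger_derive h _; rewrite /GRing.scale /= mulrNN mulrA mulVf ?pnatr_eq0// mul1r//.
rewrite (FTC01 dF cpow) subrr subr0 expr0n /= mulr0 expr1n mulr1 sub0r.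
by rewrite opprK.
Qed.

(** The graph of the power lies above its tangent at [c]. Multiplying the inequality for [q] by x
    leaves the surplus (q + 1) c^q (x - c)^2. *)
Lemma tangent_power (x c : R) q : 0 <= x -> 0 <= c ->
  q.+1%:R * c ^+ q * x - q%:R * c ^+ q.+1 <= x ^+ q.+1.
Proof.
move=> x0 c0; elim: q => [|q IH]; first by rewrite !mul1r mul0r subr0.
have h := ler_wpM2l x0 IH; rewrite -exprS in h; apply: le_trans h.
rewrite -subr_ge0 [X in 0 <= X](_ : _ = q.+1%:R * c ^+ q * (x - c) ^+ 2).
  by apply: mulr_ge0; [rewrite mulr_ge0 ?exprn_ge0|exact: sqr_ge0].
by rewrite !exprS -[q.+2%:R]natr1 -[q.+1%:R]natr1; ring.
Qed.

(** Jensen's inequality, by integrating the tangent at the mean. *)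
Lemma Rintegral_power_le {disp} {T : measurableType disp} (P : probability T R)
    (h : T -> R) q : (forall x, 0 <= h x) -> rintegrable P setT h ->
  rintegrable P setT (fun x => h x ^+ q.+1) ->
  (\int[P]_x h x) ^+ q.+1 <= \int[P]_x (h x ^+ q.+1).
Proof.
move=> h0 ih iq; set c := \int[P]_x h x.
have c0 : 0 <= c by exact: Rintegral_ge0.
have ib : rintegrable P setT (fun x => q.+1%:R * c ^+ q * h x - q%:R * c ^+ q.+1).
  by apply: rintegrableB => //; [exact: rintegrableZ|exact: rintegrable_cst].
apply: (le_trans _ (le_Rintegral_prob ib iq (fun x => tangent_power q (h0 x) c0))).
rewrite RintegralB//; [|exact: rintegrableZ|exact: rintegrable_cst].
rewrite RintegralZl// Rintegral_prob_cst -/c -natr1 exprS.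
by rewrite le_eqVlt; apply/orP; left; apply/eqP; ring.
Qed.

End taylor_integral.

(** * The remainder *)

Lemma is_derive_sum_seq {R : realType} (I : eqType) (s : seq I) (F : I -> R -> R)
    (dF : I -> R) (x : R) :
  (forall i, i \in s -> is_derive x 1 (F i) (dF i)) ->
  is_derive x 1 (fun y => \sum_(i <- s) F i y) (\sum_(i <- s) dF i).
Proof.
elim: s => [|i s IH] h.
  by rewrite big_nil; under eq_fun do rewrite big_nil; exact: is_derive_cst.
rewrite big_cons; under eq_fun do rewrite big_cons.
apply: (@is_deriveD _ _ _ (F i) (fun y => \sum_(i <- s) F i y)).
  by apply: h; rewrite mem_head.
by apply: IH => l ls; apply: h; rewrite in_cons ls orbT.
Qed.

Lemma lipschitz_continuous_real {R : realType} (g : R -> R) (K : R) :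
  (forall x y, `|g x - g y| <= K * `|x - y|) -> continuous g.
Proof.
move=> hg x; apply/cvgrPdist_le => eps eps0.
have K1 : 0 < `|K| + 1 by rewrite ltr_wpDl.
near=> y; rewrite (le_trans (hg x y))//.
rewrite (@le_trans _ _ ((`|K| + 1) * `|x - y|))//.
  by rewrite ler_wpM2r// (le_trans (ler_norm K))// lerDl.
rewrite -ler_pdivlMl//; near: y; apply: cvgr_dist_le; first exact: cvg_id.
by rewrite mulr_gt0// invr_gt0.
Unshelve. all: by end_near. Qed.

Lemma Rintegral_indic_mul {R : realType} (D : set (measurableTypeR R)) (g : R -> R) :
  (\int[@lebesgue_measure R]_x (\1_D x * g x)%:E =
   \int[@lebesgue_measure R]_(x in D) (g x)%:E)%E.
Proof.
rewrite [RHS]integral_mkcond; apply: eq_integral => x _.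
by rewrite patchE indicE; case: ifP => _; rewrite ?mul1r ?mul0r.
Qed.

(** Lebesgue measure lives on [measurableTypeR R]; the identity carries measurability between the
    two copies of the line. *)
Lemma measurable_idTR {R : realType} :
  measurable_fun setT (fun x : measurableTypeR R => x : R).
Proof. by move=> _ A mA; rewrite setTI. Qed.

Lemma rintegrable_indic_mul {R : realType} (D : set (measurableTypeR R))
    (g : R -> R) :
  measurable D -> rintegrable (@lebesgue_measure R) D g ->
  rintegrable (@lebesgue_measure R) setT (fun x => \1_D x * g x).
Proof.
move=> mD ig; have := (integrable_mkcond _ mD).1 ig; congr (integrable _ _ _).
apply/funext => x; rewrite patchE /= indicE.
by case: ifP => _; rewrite ?mul1r ?mul0r.
Qed.

Section taylor_remainder.
Context {R : realType} {e d : nat} {disp} {T : measurableType disp}.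
Context (P : probability T R) (n : nat) (B L : seq nat -> R).
Context (f : probability 'rV[R]_e R -> 'rV[R]_d) (df : derivs R e d).
Context (Pi : probability ('rV[R]_e * 'rV[R]_e)%type R).
Hypotheses (n_gt0 : (0 < n)%N) (atomP : atomless P) (hCb : Cb P n B L f df).
Hypothesis idist : forall p, (p <= n.+1)%N ->
  rintegrable Pi setT (fun z => dist z ^+ p).
Hypothesis iinterp : forall r,
  rintegrable Pi setT (fun z => enorm (interp r z) ^+ 2).
Local Notation E := 'rV[R]_e.
Local Notation Z := (E * E)%type.
Local Notation Pi_ r := (joint_interp Pi r).
Local Notation M1 := (mean_dist Pi).
Local Notation Mn := (\int[Pi]_z (dist z ^+ n.+1)).
Local Notation ws := (wsum (@dist R e)).
Local Notation tame := (tame (@dist R e) n.+1).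
Local Notation leb := (@lebesgue_measure R).
Local Notation RR := (measurableTypeR R).
Local Notation I01 := (`[0, 1]%classic : set RR).
Local Notation term := (term df Pi).
Local Notation Phi := (Phi df Pi).

Let d0 (z : Z) : 0 <= dist z. Proof. exact: dist_ge0. Qed.
Let md : measurable_fun setT (@dist R e). Proof. exact: measurable_dist. Qed.
Let idn : rintegrable Pi setT (fun z : Z => dist z ^+ n.+1).
Proof. exact: idist. Qed.
Let ws0 m (zs : m.-tuple Z) : 0 <= ws zs.
Proof. by apply: wsum_ge0. Qed.
Let M10 : 0 <= M1. Proof. exact: mean_dist_ge0. Qed.

(** Up to order n this is the k-th derivative of f (Pi_xi) at xi = r. *)
Definition taylor_coef (k : nat) (r : R) : 'rV[R]_d :=
  \sum_(a <- pseqs k) Phi (maxseq a) a r.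

Lemma is_derive_taylor_coef k (r : R) j : (k < n)%N ->
  is_derive r 1 (fun s => taylor_coef k s 0 j) (taylor_coef k.+1 r 0 j).
Proof.
move=> kn; have -> : (fun s => taylor_coef k s 0 j) =
    (fun s => \sum_(a <- pseqs k) Phi (maxseq a) a s 0 j).
  by apply/funext => s; rewrite /taylor_coef summxE.
rewrite /taylor_coef sum_pseqsS summxE.
apply: is_derive_sum_seq => a; rewrite mem_pseqs => pa.
have := is_derive_Phi n_gt0 atomP hCb idist iinterp pa erefl kn r j.
congr (is_derive _ _ _ (fun_of_matrix _ 0 j)).
rewrite big_ord_recr /= maxseq_rcons_new addrC; congr (_ + _).
apply: eq_bigr => l _; rewrite maxseq_rcons_le//; exact: ltn_ord.
Qed.

Section one_remainder.
Context (m : nat) (a : n.-tuple nat) (pa : pseq a) (ma : maxseq a = m).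

Let nn : (0 < n <= n)%N. Proof. by rewrite n_gt0 /=. Qed.

Lemma df_path_lipschitz r r' (zs : m.-tuple Z) :
  enorm (df a (Pi_ r) (map_tuple (interp r) zs) -
         df a (Pi_ r') (map_tuple (interp r') zs)) <=
    `|L a| * (`|r - r'| * (M1 + ws zs)).
Proof.
rewrite (le_trans (df_interp_lipschitz hCb idist iinterp pa ma _ _ _ _ nn))//.
rewrite ler_wpM2l// mulrDr lerD2l /wsum mulr_sumr; apply: ler_sum => l _.
by rewrite !tnth_map enorm_interpB.
Qed.

(** Dominates n increments times the Lipschitz factor M1 + ws; its degree n + 1 is the highest that
    the moments allow. *)
Definition gauge (zs : m.-tuple Z) : R := `|L a| * (M1 + ws zs) ^+ n.+1.

Lemma gauge_ge (zs : m.-tuple Z) : ws zs ^+ n * (`|L a| * (M1 + ws zs)) <= gauge zs.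
Proof.
rewrite /gauge mulrCA ler_wpM2l// exprSr ler_wpM2r ?addr_ge0 ?ws0//.
by apply: lerXn2r; rewrite ?nnegrE ?addr_ge0 ?ws0// lerDr.
Qed.

Lemma gauge_tame : tame gauge.
Proof.
split.
  apply: measurable_funM => //; apply: measurable_funX; apply: measurable_funD => //.
  exact: measurable_wsum.
exists `|L a|, M1; split => // zs; rewrite ger0_norm// mulr_ge0// exprn_ge0//.
by rewrite addr_ge0// ws0.
Qed.

Lemma term_lipschitz r r' (zs : m.-tuple Z) :
  enorm (term a r zs - term a r' zs) <= `|r - r'| * gauge zs.
Proof.
rewrite /term -mulmxBr (le_trans (enorm_mulmx _ _))//.
apply: (@le_trans _ _ (ws zs ^+ n * (`|L a| * (`|r - r'| * (M1 + ws zs))))).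
  apply: ler_pM; try exact: enorm_ge0; first exact: enorm_increments.
  exact: df_path_lipschitz.
have -> : ws zs ^+ n * (`|L a| * (`|r - r'| * (M1 + ws zs))) =
  `|r - r'| * (ws zs ^+ n * (`|L a| * (M1 + ws zs))) by ring.
by rewrite ler_wpM2l// gauge_ge.
Qed.

Let tterm r j : tame (fun zs : m.-tuple Z => term a r zs 0 j).
Proof. exact: (term_tame hCb idist iinterp pa ma). Qed.

Let iterm r j : rintegrable (powm Pi m) setT (fun zs => term a r zs 0 j).
Proof. exact: (tame_rintegrable d0 md idn (tterm r j)). Qed.

Let igauge : rintegrable (powm Pi m) setT gauge.
Proof. exact: (tame_rintegrable d0 md idn gauge_tame). Qed.

Lemma Phi_continuous j : continuous (fun r => Phi m a r 0 j).
Proof.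
apply: (@lipschitz_continuous_real _ _ (\int[powm Pi m]_zs gauge zs)) => r r'.
rewrite !mxE -RintegralB// [leRHS]mulrC -RintegralZl//.
apply: normr_Rintegral_le => //.
- apply/measurable_EFinP; apply: (measurable_int (powm Pi m)).
  exact: (rintegrableB _ (iterm r j) (iterm r' j)).
- exact: rintegrableZ.
move=> zs _; apply: le_trans (term_lipschitz r r' zs).
by apply: le_trans (entry_le_enorm _ 0 j); rewrite !mxE.
Qed.

(** The integrand of the remainder with [mu] and the points x written as time 0 of the path, which
    makes it a difference of two values of [term]. *)
Definition kernel_term (zs : m.-tuple Z) : 'rV[R]_d :=
  increments a zs *m mint leb I01 (fun xi => (1 - xi) ^+ n.-1 *:
    (df a (Pi_ xi) (map_tuple (interp xi) zs) -
     df a (Pi_ 0) (map_tuple (interp 0) zs))).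

Let mI01 : measurable I01. Proof. exact: measurable_itv. Qed.

Let leb01 : leb I01 = 1%E.
Proof. by rewrite lebesgue_measure_itv /= lte_fin ltr01 oppr0 adde0. Qed.

Let icst (c : R) : rintegrable leb I01 (fun _ => c).
Proof.
by apply: (continuous_rintegrable01 (g := fun _ => c)) => x; exact: cvg_cst.
Qed.

Let onem01 (xi : R) : I01 xi -> 0 <= (1 - xi) ^+ n.-1 <= 1 /\ `|xi - 0| <= 1.
Proof.
rewrite /= in_itv /= => /andP[x0 x1]; rewrite subr0 ger0_norm//; split => //.
by rewrite exprn_ge0 ?subr_ge0//= exprn_ile1 ?subr_ge0// gerBl.
Qed.

Let kernel_le (zs : m.-tuple Z) xi : I01 xi ->
  enorm ((1 - xi) ^+ n.-1 *: (df a (Pi_ xi) (map_tuple (interp xi) zs) -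
     df a (Pi_ 0) (map_tuple (interp 0) zs))) <= `|L a| * (M1 + ws zs).
Proof.
move=> /onem01 [/andP[p0 p1] x1]; rewrite enormZ ger0_norm//.
rewrite -[leRHS]mul1r; apply: ler_pM => //; first exact: enorm_ge0.
rewrite (le_trans (df_path_lipschitz _ _ _))// ler_wpM2l//.
by rewrite ler_piMl// addr_ge0 ?ws0.
Qed.

Let mpow : measurable_fun setT (fun xi : RR => (1 - xi) ^+ n.-1 : R).
Proof.
apply: measurable_funX; apply: measurable_funB => //; exact: measurable_idTR.
Qed.

Let ikernel (zs : m.-tuple Z) i j : rintegrable leb I01 (fun xi => ((1 - xi) ^+ n.-1 *:
    (df a (Pi_ xi) (map_tuple (interp xi) zs) -
     df a (Pi_ 0) (map_tuple (interp 0) zs))) i j).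
Proof.
apply: (rintegrable_dom _ _ (icst (`|L a| * (M1 + ws zs)))) => //.
  apply: measurable_funTS; under eq_fun do rewrite !mxE.
  apply: measurable_funM => //; apply: measurable_funB => //.
  by apply: (measurable_df hCb idist iinterp pa ma (s := fun xi : RR => xi : R) (zs := cst zs)).
move=> xi xi01; rewrite (le_trans (entry_le_enorm _ i j))//.
exact: kernel_le.
Qed.

Lemma enorm_kernel_term (zs : m.-tuple Z) : enorm (kernel_term zs) <= gauge zs.
Proof.
apply: le_trans (gauge_ge zs); rewrite (le_trans (enorm_mulmx _ _))//.
apply: ler_pM; try exact: enorm_ge0; first exact: enorm_increments.
rewrite (le_trans (enorm_mint mI01 (ikernel zs) (icst _) (kernel_le zs)))//.
by rewrite Rintegral_cst// (congr1 fine leb01 : fine (leb _) = 1) mulr1.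
Qed.

Let slice j (zs : m.-tuple Z) (xi : R) : R :=
  (1 - xi) ^+ n.-1 * (term a xi zs 0 j - term a 0 zs 0 j).

Let sliceE j zs xi : slice j zs xi = \sum_i increments a zs 0 i *
  ((1 - xi) ^+ n.-1 *: (df a (Pi_ xi) (map_tuple (interp xi) zs) -
     df a (Pi_ 0) (map_tuple (interp 0) zs))) i j.
Proof.
rewrite /slice /term ![(_ *m _) 0 j]mxE -sumrB mulr_sumr.
by apply: eq_bigr => i _; rewrite !mxE; ring.
Qed.

Let islice j zs : rintegrable leb I01 (slice j zs).
Proof.
have h : rintegrable leb I01 (fun xi => \sum_i increments a zs 0 i *
  ((1 - xi) ^+ n.-1 *: (df a (Pi_ xi) (map_tuple (interp xi) zs) -
     df a (Pi_ 0) (map_tuple (interp 0) zs))) i j).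
  by apply: rintegrable_sum => // i; exact: rintegrableZ.
by move: h; congr (integrable _ _ _); apply/funext => xi /=; rewrite sliceE.
Qed.

Lemma kernel_termE (zs : m.-tuple Z) j : kernel_term zs 0 j =
  \int[leb]_(xi in I01) slice j zs xi.
Proof.
rewrite mxE; under eq_Rintegral do rewrite sliceE.
rewrite Rintegral_sum//; last by move=> i; exact: rintegrableZ.
by apply: eq_bigr => i _; rewrite RintegralZl// mxE.
Qed.

(** The indicator extends the integrand by zero to the whole line, so that Fubini's theorem applies
    on a product of full spaces. *)
Let G j (p : RR * m.-tuple Z) : R := \1_I01 p.1 * slice j p.2 p.1.

Let mG j : measurable_fun setT (G j).
Proof.
apply: measurable_funM; first exact: (measurableT_comp (measurable_indic mI01)).
apply: measurable_funM; first exact: (measurableT_comp mpow).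
have /measurable_fun_mxP mI := @measurable_increments R e n m a.
apply: measurable_funB.
  under eq_fun do rewrite mxE; apply: measurable_sum => l; apply: measurable_funM.
    exact: (measurableT_comp (mI 0 l)).
  by apply: (measurable_df hCb idist iinterp pa ma).
by have [m0 _] := tterm 0 j; exact: (measurableT_comp m0).
Qed.

Let G_le j xi zs : `|G j (xi, zs)| <= \1_I01 xi * gauge zs.
Proof.
rewrite /G /slice /= indicE; case: (boolP (xi \in I01)); rewrite ?mul0r ?normr0// !mul1r.
move=> /set_mem /onem01 [/andP[p0 p1] x1]; rewrite normrM ger0_norm//.
have g0 : 0 <= gauge zs by apply: le_trans (enorm_kernel_term zs); exact: enorm_ge0.
rewrite -[leRHS]mul1r; apply: ler_pM => //.
have -> : term a xi zs 0 j - term a 0 zs 0 j = (term a xi zs - term a 0 zs) 0 j.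
  by rewrite !mxE.
rewrite (le_trans (entry_le_enorm _ _ _))// (le_trans (term_lipschitz _ _ _))//.
by rewrite ler_piMl.
Qed.

Let iG1 j zs : (\int[leb]_xi (G j (xi, zs))%:E = (kernel_term zs 0 j)%:E)%E.
Proof.
rewrite Rintegral_indic_mul kernel_termE /Rintegral fineK//.
exact: (integrable_fin_num mI01 (islice j zs)).
Qed.

Let iG2 j xi : (\int[powm Pi m]_zs (G j (xi, zs))%:E =
  (\1_I01 xi * ((1 - xi) ^+ n.-1 * (Phi m a xi 0 j - Phi m a 0 0 j)))%:E)%E.
Proof.
have id_ : rintegrable (powm Pi m) setT (fun zs => term a xi zs 0 j - term a 0 zs 0 j).
  exact: rintegrableB.
have iG : rintegrable (powm Pi m) setT (fun zs => G j (xi, zs)).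
  have h := rintegrableZ measurableT (\1_I01 xi)
    (rintegrableZ measurableT ((1 - xi) ^+ n.-1) id_).
  exact: h.
rewrite -[LHS]fineK; last exact: (integrable_fin_num measurableT iG).
congr (_%:E); rewrite -[LHS]/(\int[powm Pi m]_zs G j (xi, zs)).
rewrite /G /slice /= RintegralZl//; last exact: rintegrableZ.
by rewrite RintegralZl// RintegralB// !mxE.
Qed.

Let iG j : (leb \x powm Pi m)%E.-integrable setT (EFin \o G j).
Proof.
have mE : measurable_fun setT (EFin \o G j) by exact/measurable_EFinP.
suff H : (\int[leb]_x \int[powm Pi m]_y `|(EFin \o G j) (x, y)| < +oo)%E.
  have := (@integrable12ltyP _ _ _ _ _ leb (powm Pi m) _ mE).2 H.
  exact.
set V := \int[powm Pi m]_zs gauge zs.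
have mabs : measurable_fun setT (fun x => `|(EFin \o G j) x|%E).
  exact: measurableT_comp.
have i1 : rintegrable leb setT (fun xi => \1_I01 xi * V).
  by apply: rintegrable_indic_mul.
apply: (@le_lt_trans _ _ (\int[leb]_xi (\1_I01 xi * V)%:E)%E); last first.
  move: (integrable_fin_num measurableT i1).
  by rewrite fin_numElt => /andP[].
apply: ge0_le_integral => //.
- by move=> xi _; exact: integral_ge0.
- exact: (measurable_fun_fubini_tonelli_F (fun x => `|(EFin \o G j) x|%E)).
- exact: (measurable_int _ i1).
move=> xi _; rewrite /V.
have ig : rintegrable (powm Pi m) setT (fun zs => \1_I01 xi * gauge zs).
  exact: rintegrableZ.
apply: (@le_trans _ _ (\int[powm Pi m]_zs (\1_I01 xi * gauge zs)%:E)%E).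
  apply: ge0_le_integral => //.
  - apply: measurableT_comp => //; apply/measurable_EFinP.
    exact: (measurableT_comp (mG j)).
  - exact: (measurable_int _ ig).
  - by move=> zs _; rewrite lee_fin; exact: G_le.
rewrite -RintegralZl// /Rintegral fineK//.
exact: (integrable_fin_num measurableT ig).
Qed.

(** Measurability in [zs] is part of Fubini's theorem, the kernel being a partial integral of
    [G]. *)
Lemma kernel_term_tame j : tame (fun zs => kernel_term zs 0 j).
Proof.
split.
  apply/measurable_EFinP.
  have -> : (EFin \o (fun zs => kernel_term zs 0 j)) =
      (fun zs => \int[leb]_xi (G j (xi, zs))%:E)%E.
    by apply/funext => zs; rewrite iG1.
  exact: (measurable_fubini_G (iG j)).
exists `|L a|, M1; split => // zs.
by rewrite (le_trans (entry_le_enorm _ _ _))// enorm_kernel_term.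
Qed.

Lemma Rintegral_kernel_term j : \int[powm Pi m]_zs kernel_term zs 0 j =
  \int[leb]_(xi in I01) ((1 - xi) ^+ n.-1 * (Phi m a xi 0 j - Phi m a 0 0 j)).
Proof.
rewrite /Rintegral -Rintegral_indic_mul; congr fine.
have := Fubini (iG j); rewrite /=.
under eq_integral do rewrite iG2.
by move=> ->; apply: eq_integral => zs _; rewrite iG1.
Qed.

(** The power of M1 + ws is split by [exprD_le] and [exprn_sum_le], giving 2^(n+1) and m^(n+1). The
    m slots have equal marginals, which raises the latter to m^(n+2), and Jensen's inequality turns
    the power of [M1] into the moment, the summand 1. *)
Lemma enorm_mint_kernel_term :
  enorm (mint (powm Pi m) setT kernel_term) <=
  `|L a| * (2 ^+ n.+1 * (1 + m%:R ^+ n.+2)) * Mn.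
Proof.
have ik i j : rintegrable (powm Pi m) setT (fun zs => kernel_term zs i j).
  by rewrite ord1; exact: (tame_rintegrable d0 md idn (kernel_term_tame j)).
rewrite (le_trans (enorm_mint measurableT ik igauge (fun zs _ => enorm_kernel_term zs)))//.
pose U (zs : m.-tuple Z) := `|L a| * (2 ^+ n.+1 *
  (M1 ^+ n.+1 + m%:R ^+ n.+1 * \sum_(i < m) dist (tnth zs i) ^+ n.+1)).
have is_ : rintegrable (powm Pi m) setT (fun zs => \sum_(i < m) dist (tnth zs i) ^+ n.+1).
  by apply: rintegrable_sum => // i; exact: rintegrable_wpow.
have is2 : rintegrable (powm Pi m) setT (fun zs =>
    M1 ^+ n.+1 + m%:R ^+ n.+1 * \sum_(i < m) dist (tnth zs i) ^+ n.+1).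
  by apply: rintegrableD => //; [exact: rintegrable_cst|exact: rintegrableZ].
have iU : rintegrable (powm Pi m) setT U by do 2!apply: rintegrableZ => //.
apply: (@le_trans _ _ (\int[powm Pi m]_zs U zs)).
  apply: le_Rintegral_prob => // zs; rewrite /gauge /U ler_wpM2l//.
  rewrite (le_trans (exprD_le _ M10 (ws0 zs)))// ler_wpM2l ?exprn_ge0// lerD2l.
  have := exprn_sum_le n.+1 (fun i : 'I_m => d0 (tnth zs i)).
  by rewrite expr0n add0r.
rewrite RintegralZl//; last exact: rintegrableZ.
rewrite RintegralZl// RintegralD//; [|exact: rintegrable_cst|exact: rintegrableZ].
rewrite Rintegral_prob_cst RintegralZl// Rintegral_sum//; last first.
  by move=> i; exact: rintegrable_wpow.
under eq_bigr do rewrite (Rintegral_wpow Pi n.+1 md).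
rewrite sumr_const card_ord -!mulrA ler_wpM2l// ler_wpM2l ?exprn_ge0//.
rewrite mulrDl mul1r -[Mn *+ m]mulr_natl mulrA -exprSr lerD2r.
apply: Rintegral_power_le => //. exact: (idist1 idist).
Qed.

End one_remainder.
End taylor_remainder.

Lemma continuous_sum_seq {R : realType} (I : eqType) (s : seq I) (F : I -> R -> R) :
  (forall i, i \in s -> continuous (F i)) ->
  continuous (fun r => \sum_(i <- s) F i r).
Proof.
elim: s => [|i s IH] h.
  by under eq_fun do rewrite big_nil; exact: cst_continuous.
under eq_fun do rewrite big_cons; move=> r; apply: cvgD.
  by apply: h; rewrite mem_head.
by apply: IH => l ls; apply: h; rewrite in_cons ls orbT.
Qed.

Lemma Rintegral_sum_seq {disp} {T : measurableType disp} {R : realType}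
    (mu : {measure set T -> \bar R}) (D : set T) (I : eqType) (s : seq I)
    (F : I -> T -> R) : measurable D ->
  (forall i, i \in s -> rintegrable mu D (F i)) ->
  \int[mu]_(x in D) (\sum_(i <- s) F i x) = \sum_(i <- s) \int[mu]_(x in D) F i x.
Proof.
move=> mD iF; pose F' i x := if i \in s then F i x else 0.
have FF' x : \sum_(i <- s) F i x = \sum_(i <- s) F' i x.
  by apply: eq_big_seq => i si; rewrite /F' si.
under eq_Rintegral do rewrite FF'.
rewrite Rintegral_sum//.
  by apply: eq_big_seq => i si; apply: eq_Rintegral => x _; rewrite /F' si.
move=> i; rewrite /F'; case: (boolP (i \in s)) => [/iF//|_].
exact: integrable0.
Qed.

(** * Identification with the operators and the remainder of the statement *)

Section expansion_identities.
Context {R : realType} {e d : nat} {disp} {T : measurableType disp}.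
Context (P : probability T R) (n : nat) (B L : seq nat -> R).
Context (f : probability 'rV[R]_e R -> 'rV[R]_d) (df : derivs R e d).
Context (mu nu : probability 'rV[R]_e R).
Context (Pi : probability ('rV[R]_e * 'rV[R]_e)%type R).
Hypotheses (n_gt0 : (0 < n)%N) (atomP : atomless P) (hCb : Cb P n B L f df).
Hypotheses (mom_mu : finite_moment n.+1 mu) (mom_nu : finite_moment n.+1 nu).
Hypothesis joint_Pi : joint Pi mu nu.
Local Notation E := 'rV[R]_e.
Local Notation Z := (E * E)%type.

Let idist p (pn : (p <= n.+1)%N) := rintegrable_dist mom_mu mom_nu joint_Pi pn.
Let iinterp r := rintegrable_interp n_gt0 mom_mu mom_nu joint_Pi r.
Let mu2 := moment_mu n_gt0 mom_mu mom_nu joint_Pi.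
Let nu2 := moment_nu n_gt0 mom_mu mom_nu joint_Pi.

Let df_mu k (a : k.-tuple nat) (zs : (maxseq a).-tuple Z) :
  (k <= n)%N -> pseq a ->
  df a mu (map_tuple fst zs) = df a (joint_interp Pi 0) (map_tuple (interp 0) zs).
Proof.
move=> kn pa; have -> : map_tuple fst zs = map_tuple (interp 0) zs.
  by apply: eq_from_tnth => l; rewrite !tnth_map interp0.
exact: (df_measure_eq hCb pa erefl _ kn mu2 (interp0_law joint_Pi)).
Qed.

Lemma Dop_Phi k (a : k.-tuple nat) : (k <= n)%N -> pseq a ->
  Dop df a mu Pi = Phi df Pi (maxseq a) a 0.
Proof.
move=> kn pa; rewrite /Dop.
have -> : (fun z : (maxseq a).-tuple Z => increments a z *m df a mu (map_tuple fst z)) =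
    term df Pi a 0.
  by apply/funext => zs; rewrite df_mu.
rewrite (iint_powm (@dist_ge0 R e) (@measurable_dist R e) (idist (leqnn n.+1)))// => i j.
rewrite ord1; exact: (term_tame hCb idist iinterp pa erefl).
Qed.

Lemma remainder_kernel_term : remainder n df mu Pi =
  (n.-1`!%:R)^-1 *: \sum_(a <- pseqs n)
    mint (powm Pi (maxseq a)) setT (@kernel_term R e d n df Pi (maxseq a) a).
Proof.
rewrite /remainder; congr (_ *: _); apply: eq_big_seq => a; rewrite mem_pseqs => pa.
rewrite -(iint_powm (@dist_ge0 R e) (@measurable_dist R e) (idist (leqnn n.+1))).
  congr (iint Pi); apply/funext => zs; rewrite /kernel_term /remainder_kernel.
  by rewrite df_mu.
move=> i j; rewrite ord1.
exact: (kernel_term_tame n_gt0 hCb idist iinterp pa erefl).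
Qed.

Lemma taylor_coef0 : taylor_coef df Pi 0 1 = f nu.
Proof.
have [[fext f0 _ _] _] := hCb.
rewrite /taylor_coef pseqs0 big_seq1 (fext _ _ nu2 (interp1_law joint_Pi)).
rewrite -(f0 _ (moment_Pi iinterp 1)).
(* The length [maxseq [tuple]] occurs in the types of the tuples; it is generalised before being
   replaced by 0. *)
move: (maxseq_tuple0 [tuple]); move: (maxseq _) => m m0; subst m.
apply/rowP => j; rewrite mxE.
rewrite /Rintegral /= integral_dirac//=; last first.
  have h := term_tame (m := 0) hCb idist iinterp (pseq_tuple0 [tuple])
    (maxseq_tuple0 _) 1 j (leq0n n).
  by apply/measurable_EFinP; case: h.
rewrite indicT mul1r /term mxE /= big_ord1 mxE mul1r.
by rewrite (tuple0 (map_tuple _ _)).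
Qed.

End expansion_identities.

Theorem theorem2p16 (R : realType) (n : nat) (n_gt0 : (0 < n)%N)
    (B L : seq nat -> R) :
  exists C : R,
    forall (e d : nat) (disp : measure_display) (T : measurableType disp)
      (P : probability T R), atomless P ->
    forall (f : probability 'rV[R]_e R -> 'rV[R]_d) (df : derivs R e d),
      Cb P n B L f df ->
    forall (mu nu : probability 'rV[R]_e R)
      (Pi : probability ('rV[R]_e * 'rV[R]_e)%type R),
      finite_moment n.+1 mu -> finite_moment n.+1 nu -> joint Pi mu nu ->
      f nu = \sum_(k < n.+1) \sum_(a <- pseqs k)
                (k`!%:R)^-1 *: Dop df a mu Pi
             + remainder n df mu Pi /\
      ((enorm (remainder n df mu Pi))%:E <=
       C%:E * \int[Pi]_z (enorm (z.2 - z.1) ^+ n.+1)%:E)%E.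
Proof.
(* The bounds of [enorm_mint_kernel_term], summed over A_n with the prefactor of the remainder; only
   Lipschitz constants of order n occur. *)
exists ((n.-1`!%:R)^-1 * \sum_(a <- pseqs n)
  (`|L a| * (2 ^+ n.+1 * (1 + (maxseq a)%:R ^+ n.+2)))).
move=> e d disp T P atomP f df hCb mu nu Pi mom_mu mom_nu joint_Pi.
have idist p (pn : (p <= n.+1)%N) := rintegrable_dist mom_mu mom_nu joint_Pi pn.
have iinterp := rintegrable_interp n_gt0 mom_mu mom_nu joint_Pi.
have remE := remainder_kernel_term n_gt0 hCb mom_mu mom_nu joint_Pi.
split; last first.
  have idn : rintegrable Pi setT (fun z => enorm (z.2 - z.1) ^+ n.+1).
    exact: (idist n.+1 (leqnn _)).
  rewrite -[X in (_ * X)%E]fineK; last exact: (integrable_fin_num measurableT idn).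
  rewrite -EFinM lee_fin remE enormZ ger0_norm ?invr_ge0// -mulrA ler_wpM2l ?invr_ge0//.
  rewrite mulr_suml (le_trans (enorm_sum _ _))// big_seq [leRHS]big_seq.
  apply: ler_sum => a; rewrite mem_pseqs => pa.
  exact: (enorm_mint_kernel_term n_gt0 hCb idist iinterp pa erefl).
apply/rowP => j.
have dphi k (x : R) : (k < n.-1.+1)%N ->
    is_derive x 1 (fun s => taylor_coef df Pi k s 0 j) (taylor_coef df Pi k.+1 x 0 j).
  rewrite prednK// => kn; exact: (is_derive_taylor_coef n_gt0 atomP hCb idist iinterp).
have cPhi (a : n.-tuple nat) : a \in pseqs n ->
    continuous (fun r => Phi df Pi (maxseq a) a r 0 j).
  rewrite mem_pseqs => pa.
  exact: (Phi_continuous n_gt0 hCb idist iinterp pa erefl).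
have tcE r : taylor_coef df Pi n r 0 j =
    \sum_(a <- pseqs n) Phi df Pi (maxseq a) a r 0 j by rewrite /taylor_coef summxE.
have cphi : continuous (fun r => taylor_coef df Pi n r 0 j).
  under eq_fun do rewrite tcE; exact: continuous_sum_seq.
(* The last coefficient in the sum is the one of order n - 1, because the coefficient of order n is
   known to be continuous but not differentiable. Its value at 0 is subtracted under the integral
   afterwards. *)
have := taylor_integral (ph := fun k r => taylor_coef df Pi k r 0 j) dphi.
rewrite prednK// => /(_ cphi).
rewrite (taylor_coef0 n_gt0 hCb mom_mu mom_nu joint_Pi) => ->.
rewrite mxE summxE big_ord_recr/= -addrA; congr (_ + _).
  apply: eq_bigr => k _; rewrite /taylor_coef !summxE mulr_sumr.
  apply: eq_big_seq => a; rewrite mem_pseqs => pa.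
  by rewrite [RHS]mxE (Dop_Phi n_gt0 hCb mom_mu mom_nu joint_Pi (ltnW (ltn_ord k)) pa).
have DE : (\sum_(a <- pseqs n) (n`!%:R)^-1 *: Dop df a mu Pi) 0 j =
    (n`!%:R)^-1 * taylor_coef df Pi n 0 0 j.
  rewrite /taylor_coef !summxE mulr_sumr.
  apply: eq_big_seq => a; rewrite mem_pseqs => pa.
  by rewrite [LHS]mxE (Dop_Phi n_gt0 hCb mom_mu mom_nu joint_Pi (leqnn n) pa).
have RE : (\sum_(a <- pseqs n) mint (powm Pi (maxseq a)) setT
      (@kernel_term R e d n df Pi (maxseq a) a)) 0 j =
    \int[lebesgue_measure]_(x in `[0, 1]%classic)
      ((1 - x) ^+ n.-1 * (taylor_coef df Pi n x 0 j - taylor_coef df Pi n 0 0 j)).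
  under eq_Rintegral do rewrite !tcE -sumrB mulr_sumr.
  rewrite summxE Rintegral_sum_seq; last 2 first.
  - exact: measurable_itv.
  - move=> a pa; apply: continuous_rintegrable01 => x; apply: cvgM.
      exact: (@continuous_onem_pow R n.-1).
    by apply: cvgB; [exact: cPhi|exact: cvg_cst].
  apply: eq_big_seq => a; rewrite mem_pseqs => pa.
  by rewrite mxE (Rintegral_kernel_term n_gt0 hCb idist iinterp pa erefl).
have i1 : rintegrable (@lebesgue_measure R) `[0, 1]%classic
    (fun x => (1 - x) ^+ n.-1 * taylor_coef df Pi n x 0 j).
  apply: continuous_rintegrable01 => x; apply: cvgM; last exact: cphi.
  exact: (@continuous_onem_pow R n.-1).
have i2 : rintegrable (@lebesgue_measure R) `[0, 1]%classic (fun x => (1 - x) ^+ n.-1).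
  exact: continuous_rintegrable01 (@continuous_onem_pow R n.-1).
have mI : measurable (`[0, 1]%classic : set (measurableTypeR R)) by exact: measurable_itv.
have i3 c : rintegrable (@lebesgue_measure R) `[0, 1]%classic
    (fun x => (1 - x) ^+ n.-1 * c).
  by apply: eq_rintegrable (rintegrableZ mI c i2) => x; rewrite mulrC.
(* The integral of (1 - xi)^(n-1) is 1/n, so the subtracted value at 0 carries the factor 1/((n-1)!
   n) = 1/n! and cancels the term of order n in the sum. *)
rewrite DE remE [in RHS]mxE RE; under [in RHS]eq_Rintegral do rewrite mulrBr.
rewrite RintegralB//.
rewrite RintegralZr// Rintegral_onem_pow prednK// mulrBr addrCA [X in _ = _ + X](_ : _ = 0).
  by rewrite addr0.
rewrite -{1}(prednK n_gt0) factS prednK// natrM invfM.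
by ring.
Qed.
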